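(* Let $G$ be a finite group and let $K\trianglelefteq G$ with $\mathbf{Z}(K)\subseteq\mathbf{Z}(G)$. Suppose that $K/\mathbf{Z}(K)$ is a minimal normal subgroup of $G/\mathbf{Z}(K)$ and is isomorphic to $S^n$, where $S$ is a non-abelian finite simple group which satisfies the inductive Feit condition. Let $\tau\in\mathrm{Irr}(K)$ be $G$-invariant. Then there exist a pair $(U,\mu)$, where $U<K$ and $\mu\in\mathrm{Irr}(U)$, such that $\mathbf{N}_K(U)=U$, $G=K\mathbf{N}_G(U)$, and a $\mathcal{G}$-equivariant bijection $$^*:\mathrm{Irr}(G\mid\tau^{\mathcal G})\to\mathrm{Irr}(\mathbf{N}_G(U)\mid\mu^{\mathcal G})$$ which respects ratios of degrees. Therefore, if $\chi\in\mathrm{Irr}(G\mid\tau^{\mathcal G})$ and $\xi=\chi^*$, then $\chi(1)/\tau(1)=\xi(1)/\mu(1)$, $\mathbb{Q}(\chi)=\mathbb{Q}(\xi)$, and $[\chi_{\mathbf{Z}(K)},\xi_{\mathbf{Z}(K)}]\ne 0$.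
   Context: All groups are finite and characters are complex. $\mathbb{Q}(\chi)$ is the field generated by the values of $\chi$; $[\cdot,\cdot]$ is the usual inner product of characters. For $N\trianglelefteq G$ (or $N\trianglelefteq H$) and $\theta\in\mathrm{Irr}(N)$, $\mathrm{Irr}(G\mid\theta^{\mathcal G})$ is the set of $\chi\in\mathrm{Irr}(G)$ such that some Galois conjugate $\theta^\sigma$, $\sigma\in\mathcal{G}$, is a constituent of $\chi_N$. Actions. $\mathbb{Q}^{\mathrm{ab}}\subset\mathbb{C}$ is the field generated by all roots of unity and $\mathcal{G}=\mathrm{Gal}(\mathbb{Q}^{\mathrm{ab}}/\mathbb{Q})$, acting on $\mathrm{Irr}(Y)$ by $\chi^\sigma(y)=\sigma(\chi(y))$. If $\Gamma$ acts on $Y$ from the right by automorphisms $y\mapsto y^\gamma$, it acts on $\mathrm{Irr}(Y)$ by $\chi^\gamma(y^\gamma)=\chi(y)$; so $\Gamma\times\mathcal{G}$ acts on $\mathrm{Irr}(Y)$ by $\chi^{(\gamma,\sigma)}=(\chi^\gamma)^\sigma$. $(\Gamma\times\mathcal{G})_\chi$ is the stabilizer of $\chi$; $\chi^{\mathcal G}$ is the $\mathcal G$-orbit of $\chi$; $\Gamma_\chi$, $\Gamma_{\chi^{\mathcal G}}$ are the stabilizers in $\Gamma$ of $\chi$ and (setwise) of $\chi^{\mathcal G}$. If $N\trianglelefteq G$, $G$ acts on $N$ by conjugation $n^g=g^{-1}ng$. $\mathrm{Aut}(X)$ acts on $X$ from the right (product $\alpha\beta:=\beta\circ\alpha$), and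 for $U\le X$, $\mathrm{Aut}(X)_U=\{\alpha: U^\alpha=U\}$ acts on both $X$ and $U$. Projective representations. $\mathcal{P}:G\to\mathrm{GL}_n(\mathbb{C})$ is a projective representation with factor set $\alpha:G\times G\to\mathbb{C}^\times$ if $\mathcal{P}(x)\mathcal{P}(y)=\alpha(x,y)\mathcal{P}(xy)$ for all $x,y$. If $N\trianglelefteq G$ and $\theta\in\mathrm{Irr}(N)$ is $G$-invariant, $\mathcal{P}$ is associated with $(G,N,\theta)$ if $\mathcal{P}|_N$ is a representation affording $\theta$ and $\mathcal{P}(gn)=\mathcal{P}(g)\mathcal{P}(n)$, $\mathcal{P}(ng)=\mathcal{P}(n)\mathcal{P}(g)$ for $g\in G,n\in N$. If $N\trianglelefteq G$, $\theta\in\mathrm{Irr}(N)$, $\mathcal{P}$ is a projective representation of $G_\theta$ associated with $(G_\theta,N,\theta)$ with entries in $\mathbb{Q}^{\mathrm{ab}}$, and $a=(g,\sigma)\in(G\times\mathcal{G})_\theta$, put $\mathcal{P}^a(x)=\sigma(\mathcal{P}(gxg^{-1}))$ (entrywise); there is a unique function $\mu_a:G_\theta\to\mathbb{C}^\times$, constant on cosets of $N$, with $\mu_a(1)=1$ and $\mathcal{P}^a$ similar to $\mu_a\mathcal{P}$. $\mathcal{G}$-triples. $(G,N,\theta)_{\mathcal G}$ is a $\mathcal{G}$-triple if $N\trianglelefteq G$, $\theta\in\mathrm{Irr}(N)$ and $G=G_{\theta^{\mathcal G}}$. For $\mathcal{G}$-triples write $(G,N,\theta)_{\mathcal G}\succeq_{\mathsf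 c}(H,M,\varphi)_{\mathcal G}$ if: (1) $H\le G$, $G=NH$, $N\cap H=M$, $\mathbf{C}_G(N)\subseteq H$; (2) $(H\times\mathcal{G})_\theta=(H\times\mathcal{G})_\varphi$ (so $H_\theta=H_\varphi$); (3) there are projective representations $\mathcal{P}$, $\mathcal{P}'$ associated with $(G_\theta,N,\theta)$, $(H_\varphi,M,\varphi)$, with entries in $\mathbb{Q}^{\mathrm{ab}}$ and factor sets $\alpha,\alpha'$ whose values are roots of unity, such that $\alpha|_{H_\theta\times H_\theta}=\alpha'$ and for each $c\in\mathbf{C}_G(N)$ the scalar matrices $\mathcal{P}(c)$, $\mathcal{P}'(c)$ correspond to the same scalar; (4) for these and every $a\in(H\times\mathcal{G})_\theta$, the functions $\mu_a$ (from $\mathcal P$) and $\mu'_a$ (from $\mathcal{P}'$) agree on $H_\theta$. Inductive Feit condition. Let $S$ be a finite non-abelian simple group and $X$ a universal covering group of $S$. $S$ satisfies the inductive Feit condition if for every $\chi\in\mathrm{Irr}(X)$ there is a pair $(U,\mu)$ with $U<X$ (proper) and $\mu\in\mathrm{Irr}(U)$ such that: (i) $U=\mathbf{N}_X(U)$ and $U$ is intravariant in $X$, i.e. for each $w\in\mathrm{Aut}(X)$ there is $x\in X$ with $U^w=U^x$; (ii) $(\Gamma\times\mathcal{G})_\chi=(\Gamma\times\mathcal{G})_\mu$, where $\Gamma=\mathrm{Aut}(X)_U$; (iii) $(X\rtimes\Gamma_{\chi^{\mathcal G}},X,\chi)_{\mathcal G}\succeq_{\mathsf c}(U\rtimes\Gamma_{\chi^{\mathcal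 G}},U,\mu)_{\mathcal G}$. *)

(* Defs.v *)
From HB Require Import structures.
From mathcomp Require Import all_boot all_order all_algebra all_fingroup.
From mathcomp Require Import all_solvable all_field all_character.
From mathcomp Require Import boolp classical_sets functions.

Set Implicit Arguments.
Unset Strict Implicit.
Unset Printing Implicit Defensive.

Import GRing.Theory.

Local Open Scope ring_scope.

(* Complex characters are algC-valued (classfun, character); the complex      *)
(* numbers are represented by algC throughout.                                *)

Inductive field_gen (A : algC -> Prop) : algC -> Prop :=
| FieldGen_mem z of A z : field_gen A z
| FieldGen_one : field_gen A 1
| FieldGen_sub x y of field_gen A x & field_gen A y : field_gen A (x - y)
| FieldGen_div x y of field_gen A x & field_gen A y : field_gen A (x / y).

Definition is_root_of_unity (z : algC) : Prop :=
  exists2 n : nat, (0 < n)%N & z ^+ n = 1.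

Definition Qab : algC -> Prop := field_gen is_root_of_unity.

(* Gal(Qab/Q). An element is carried by a function on algC of which only the  *)
(* values on Qab are meaningful: no condition is put on them elsewhere.       *)
(* Injectivity, and the fact that Q is fixed, follow from the ring axioms.    *)
Record galQab := GalQab {
  galQab_fun :> algC -> algC;
  galQab_in : forall x, Qab x -> Qab (galQab_fun x);
  galQab_onto : forall y, Qab y -> exists2 x, Qab x & galQab_fun x = y;
  galQab1 : galQab_fun 1 = 1;
  galQabB : forall x y, Qab x -> Qab y ->
    galQab_fun (x - y) = galQab_fun x - galQab_fun y;
  galQabM : forall x y, Qab x -> Qab y ->
    galQab_fun (x * y) = galQab_fun x * galQab_fun y
}.

Lemma galQab0 (s : galQab) : s 0 = 0.
Proof.
have Q1 := FieldGen_one is_root_of_unity.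
by rewrite -[X in s X](subrr 1) (galQabB s Q1 Q1) subrr.
Qed.

Section Actions.

Variables (gT : finGroupType) (Y : {group gT}).
Implicit Types (phi theta : 'CF(Y)) (s : galQab) (a : {perm gT}).

Definition cfGal s phi : 'CF(Y) := cfun_comp (galQab0 s) phi.

Definition galOrbit phi : set 'CF(Y) := range (cfGal^~ phi).

(* phi^a (y^a) = phi y, where a induces an automorphism of Y. This follows    *)
(* the pattern of cfConjg, with junk value phi if a does not act on Y. The    *)
(* product of {perm gT} is (a * b) x = b (a x), as a right action requires.   *)
Definition acts_on a : bool := morphic Y a && (a @: Y == Y :> {set gT}).

Fact cfAutact_subproof a phi :
  is_class_fun <<Y>>%g [ffun y => phi (if acts_on a then (a^-1)%g y else y)].
Proof.
rewrite genGid; have [/andP[/morphicP aM /eqP aY] | _] := boolP (acts_on a).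
  have mema y : ((a^-1)%g y \in Y) = (y \in Y).
    by rewrite -{2}aY -{2}[y](permKV a) mem_imset //; apply: perm_inj.
  apply: intro_class_fun => [x y Yx Yy | x notYx].
    suff ->: ((a^-1)%g (x ^ y) = (a^-1)%g x ^ (a^-1)%g y)%g.
      by rewrite cfunJ ?mema.
    have [Yu Yv] : (a^-1)%g x \in Y /\ (a^-1)%g y \in Y by rewrite !mema.
    apply: (@perm_inj _ a); rewrite permKV -{1}[x](permKV a) -{1}[y](permKV a).
    rewrite /conjg; set u := (a^-1)%g x; set v := (a^-1)%g y.
    have aV : (a v^-1 = (a v)^-1)%g.
      apply: (mulIg (a v)); rewrite mulVg -aM ?groupV // mulVg.
      by apply: (mulIg (a 1%g)); rewrite mul1g -aM ?group1 // mulg1.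
    by rewrite !aM ?groupM ?groupV // aV.
  by rewrite cfun0 // mema.
by apply: intro_class_fun => [x y _ Yy | x notYx]; [exact: cfunJ | exact: cfun0].
Qed.
Definition cfAutact a phi : 'CF(Y) := Cfun 1 (cfAutact_subproof a phi).

Lemma cfAutactE a phi y : acts_on a -> cfAutact a phi (a y) = phi y.
Proof. by move=> aY; rewrite cfunElock aY permK. Qed.

End Actions.

Section Triples.

Variable gT : finGroupType.
Implicit Types (G H M N : {group gT}) (g : gT) (s : galQab).

Definition IrrOver G N (theta : 'CF(N)) : set 'CF(G) :=
  fun chi => chi \in irr G /\
    exists s : galQab, '['Res[N] chi, cfGal s theta] != 0.

Definition Gtriple G N (theta : 'CF(N)) : Prop :=
  [/\ (N <| G)%g, theta \in irr N
    & forall g, g \in G ->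
        ((fun psi => (psi ^ g)%CF) @` galOrbit theta)%classic = galOrbit theta].

Definition proj_repr G n (P : gT -> 'M[algC]_n) (alpha : gT -> gT -> algC) :=
  (forall x, x \in G -> P x \in unitmx) /\
  (forall x y, x \in G -> y \in G ->
     alpha x y != 0 /\ P x *m P y = alpha x y *: P (x * y)%g).

Definition proj_associated G N (theta : 'CF(N)) n (P : gT -> 'M[algC]_n) :=
  [/\ (N <| G)%g, theta \in irr N, G \subset 'I[theta]%g,
      exists2 rN : mx_representation algC N n,
        {in N, forall x, rN x = P x} & cfRepr rN = theta
    & forall g x, g \in G -> x \in N ->
        P (g * x)%g = P g *m P x /\ P (x * g)%g = P x *m P g].

Definition fixed_by N (theta : 'CF(N)) g s : Prop := cfGal s (theta ^ g)%CF = theta.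

(* mu is the function mu_a on T attached to a = (g, s), where T is the        *)
(* inertia group of theta and P is associated with (T, N, theta): mu is       *)
(* constant on cosets of N, mu 1 = 1, and P^a is similar to mu P. Only the    *)
(* values of mu on T matter. They exist and are unique, so that Gtriple_ge_c  *)
(* may bind mu and mu' existentially.                                         *)
Definition is_mu (T N : {group gT}) n (P : gT -> 'M[algC]_n) g s
    (mu : gT -> algC) : Prop :=
  [/\ forall x, x \in T -> mu x != 0,
      forall x y, x \in T -> y \in N -> mu (x * y)%g = mu x,
      mu 1%g = 1
    & exists2 Q : 'M[algC]_n, Q \in unitmx &
        forall x, x \in T ->
          map_mx s (P (g * x * g^-1)%g) = mu x *: (invmx Q *m P x *m Q)].

Definition Gtriple_ge_c G N (theta : 'CF(N)) H M (phi : 'CF(M)) : Prop :=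
  [/\ Gtriple G theta /\ Gtriple H phi,
      [/\ H \subset G, G = (N * H)%g :> {set gT}, N :&: H = M :> {set gT}
        & 'C_G(N)%g \subset H],
      forall g s, g \in H -> (fixed_by theta g s <-> fixed_by phi g s)
    & exists n n' (P : gT -> 'M[algC]_n) (P' : gT -> 'M[algC]_n')
             (alpha alpha' : gT -> gT -> algC),
      let GT := 'I_G[theta]%G in let HT := 'I_H[phi]%G in
      [/\ [/\ proj_repr GT P alpha, proj_associated GT theta P,
              forall x i j, x \in GT -> Qab (P x i j)
            & forall x y, x \in GT -> y \in GT -> is_root_of_unity (alpha x y)],
          [/\ proj_repr HT P' alpha', proj_associated HT phi P',
              forall x i j, x \in HT -> Qab (P' x i j)
            & forall x y, x \in HT -> y \in HT -> is_root_of_unity (alpha' x y)],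
          {in HT &, forall x y, alpha x y = alpha' x y},
          forall c, c \in 'C_G(N)%g ->
            exists z : algC, P c = z%:M /\ P' c = z%:M
        & forall g s, g \in H -> fixed_by theta g s ->
            exists mu mu' : gT -> algC,
              [/\ is_mu GT N P g s mu, is_mu HT M P' g s mu'
                & {in HT, mu =1 mu'}]]].

End Triples.

(* X is a universal covering group of the perfect group S: a perfect central  *)
(* extension of S mapping to every other (finite) central extension over S;   *)
(* such a map is unique, X being perfect.                                     *)
Definition universal_cover (xT sT : finGroupType) (X : {group xT})
    (S : {group sT}) : Prop :=
  X^`(1)%g = X /\
  exists pi : {morphism X >-> sT},
    [/\ pi @* X = S, 'ker pi \subset 'Z(X)
      & forall (eT : finGroupType) (E : {group eT})
               (rho : {morphism E >-> sT}),
          rho @* E = S -> 'ker rho \subset 'Z(E) ->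
          exists f : {morphism X >-> eT},
            f @* X \subset E /\ {in X, forall x, rho (f x) = pi x}]%g.

Section SemidirectProduct.

Variables (xT : finGroupType) (X : {group xT}).
Implicit Types (U : {group xT}) (A : {set {perm xT}}).

Let sd1 := sdpair1 [Aut X].
Let sd2 := sdpair2 [Aut X].

(* U ><| A, for U <= X and a subgroup A of Aut(X)_U, taken inside the external *)
(* product X ><| Aut(X). The join <*> is the product set, as A normalizes U.   *)
Definition sdAut U A : {group sdprod_by [Aut X]} :=
  (sd1 @* U <*> sd2 @* A)%G.

Fact isom_sdBase : isom X (sd1 @* X) sd1.
Proof. exact: sub_isom (subxx X) (erefl _) (injm_sdpair1 _). Qed.

Definition sdBase U : {group sdprod_by [Aut X]} := (sd1 @* U)%G.
Definition sdChar U (sUX : U \subset X) (phi : 'CF(U)) : 'CF(sdBase U) :=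
  cfIsom (restr_isom sUX isom_sdBase) phi.

End SemidirectProduct.

Definition intravariant (xT : finGroupType) (U X : {group xT}) : Prop :=
  forall w, w \in Aut X -> exists2 x, x \in X & w @: U = (U :^ x)%g.

Definition AutStab (xT : finGroupType) (X U : {group xT}) : {set {perm xT}} :=
  [set a in Aut X | a @: U == U :> {set xT}].

Definition orbitStab (xT : finGroupType) (Y : {group xT})
    (A : {set {perm xT}}) (chi : 'CF(Y)) : {set {perm xT}} :=
  [set a in A | `[< (cfAutact a @` galOrbit chi)%classic = galOrbit chi >]].

(* The universal covering group of a non-abelian simple group exists and is   *)
(* unique up to isomorphism, so it may be quantified existentially here.      *)
Definition inductive_Feit (sT : finGroupType) (S : {group sT}) : Prop :=
  exists (xT : finGroupType) (X : {group xT}),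
    universal_cover X S /\
    forall chi : 'CF(X), chi \in irr X ->
    exists (U : {group xT}) (mu : 'CF(U)) (pUX : U \proper X),
      let Gam := AutStab X U in
      let GamChi := orbitStab Gam chi in
      [/\ mu \in irr U,
          'N_X(U)%g = U /\ intravariant U X,
          forall a (s : galQab), a \in Gam ->
            (cfGal s (cfAutact a chi) = chi <-> cfGal s (cfAutact a mu) = mu)
        & Gtriple_ge_c (sdAut X X GamChi) (sdChar (subxx X) chi)
                       (sdAut X U GamChi) (sdChar (proper_sub pUX) mu)].

Definition cfField (gT : finGroupType) (G : {group gT}) (chi : 'CF(G)) :
    algC -> Prop :=
  field_gen (fun z => exists2 g, g \in G & z = chi g).

(* Main.v *)
(* G acts on K through the universal cover X of S: lifting the projections of *)
(* K / Z(K) onto S gives morphisms f i : X -> K with pairwise commuting       *)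
(* images, K = Z(K) prod_i f i (X), and conjugation by g in G permutes the    *)
(* f i up to automorphisms of X. Since tau is G-invariant and G permutes the  *)
(* f i transitively, tau (prod_i f i (x i)) = prod_i chi (x i) for a single   *)
(* chi. If (U0, mu) is the pair attached to chi, take                         *)
(* U = Z(K) prod_i f i (U0), with the corresponding product of copies of mu.  *)
(* The intertwining operators of the Feit condition, tensored and followed by *)
(* the permutation of the factors, give projective representations P of       *)
(* H = N_G(U) over tau and P' over that product, with the same factor set,    *)
(* the same scalars and the same behaviour under Galois automorphisms.        *)
(* A character over tau has the form h k |-> tr (P h T k) * q h, and it       *)
(* corresponds to h u |-> tr (P' h T' u) * q h. This map is isometric by      *)
(* Schur orthogonality, hence injective with irreducible values; it preserves *)
(* multiplicities, whose squares sum to |G : K| = |H : U| on both sides,      *)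
(* hence it is onto.                                                          *)

Require Import Defs.
From HB Require Import structures.
From mathcomp Require Import all_boot all_order all_algebra all_fingroup.
From mathcomp Require Import all_solvable all_field all_character mxtens.

Set Implicit Arguments.
Unset Strict Implicit.
Unset Printing Implicit Defensive.

Import Order.TTheory GroupScope GRing.Theory Num.Theory.

Local Open Scope ring_scope.

Local Notation "A *t B" := (tensmx A B) (at level 40, left associativity).

(** * Galois automorphisms and fields of values *)

(** Four independent ideas meet in the proof.

    Structure of K. The universal property of X and the minimality of K / Z(K) give commuting
    morphisms f i : X -> K which together with Z(K) generate K and which G permutes transitively, up
    to automorphisms of X ([components_exist]). Hence an invariant tau is, up to scalars on Z(K), a
    tensor power of one chi in Irr(X) ([tau_power]).

    Transfer of the Feit condition. [extract_feit] turns the condition for chi into matrices: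
    representations affording chi and mu, and intertwiners indexed by automorphisms of X, which
    multiply with the same factors, take the same central scalars and are twisted alike by Galois
    automorphisms. Tensor induction carries these properties to [projK] and [projU] on H = N_G(U)
    ([projKM], [projK_inner], [projK_aut]).

    Clifford theory. A character over tau is afforded on H by P h tensor Q h ([Clifford_tens]), with
    Q projective for the inverse factor set. Since P' has the factor set of P, P' tensor Q is a
    genuine representation of H over the product of the copies of mu. Inner products depend on Q
    alone ([triple_match_dot]), so the map is an isometry, and a count makes it onto
    ([triple_corr_onto]).

    Galois orbits. tau and the product character have the same Galois stabilizer ([stab_tau_muK]),
    so the bijection extends by conjugation to characters over the whole orbits ([orbit_bijection]).
    Corresponding characters restrict to K and to U with the same multiplicity; this yields the
    degrees and the restriction to Z(K). The equality of fields of values is equivariance read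
    through Galois theory ([cfField_sub]). *)

Lemma field_gen_sub_rmorph (nu : {rmorphism algC -> algC}) (A B : algC -> Prop) z :
  (forall w, A w -> B (nu w)) -> field_gen A z -> field_gen B (nu z).
Proof.
move=> sAB; elim=> {z} [z Az||x y _ Bx _ By|x y _ Bx _ By].
- by apply: FieldGen_mem; apply: sAB.
- by rewrite rmorph1; apply: FieldGen_one.
- by rewrite rmorphB; apply: FieldGen_sub.
by rewrite fmorph_div; apply: FieldGen_div.
Qed.

Lemma root_of_unity_rmorph (nu : {rmorphism algC -> algC}) z :
  is_root_of_unity z -> is_root_of_unity (nu z).
Proof. by case=> n n_gt0 zn1; exists n; rewrite // -rmorphXn zn1 rmorph1. Qed.

Lemma Qab_rmorph (nu : {rmorphism algC -> algC}) z : Qab z -> Qab (nu z).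
Proof. exact/field_gen_sub_rmorph/root_of_unity_rmorph. Qed.

Lemma Qab_rmorph_onto (nu : {rmorphism algC -> algC}) z :
  Qab z -> exists2 w, Qab w & nu w = z.
Proof.
by move=> Qz; exists (algC_invaut nu z); [apply: Qab_rmorph | apply: algC_invautK].
Qed.

Definition galQab_of (nu : {rmorphism algC -> algC}) : galQab :=
  @GalQab nu (Qab_rmorph nu) (Qab_rmorph_onto nu) (rmorph1 nu)
    (fun x y _ _ => rmorphB nu x y) (fun x y _ _ => rmorphM nu x y).

Lemma cfGal_of (gT : finGroupType) (Y : {group gT}) nu (phi : 'CF(Y)) :
  cfGal (galQab_of nu) phi = cfAut nu phi.
Proof. by apply/cfunP => y; rewrite !cfunE. Qed.

Section GalQabClosure.

Variable s : galQab.

Lemma Qab0 : Qab 0.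
Proof. by rewrite -(subrr 1); apply: FieldGen_sub; apply: FieldGen_one. Qed.

Lemma QabD x y : Qab x -> Qab y -> Qab (x + y).
Proof.
move=> Qx Qy; rewrite -[y]opprK -[- y]sub0r; apply: FieldGen_sub => //.
by apply: FieldGen_sub => //; apply: Qab0.
Qed.

Lemma QabM x y : Qab x -> Qab y -> Qab (x * y).
Proof.
move=> Qx Qy; rewrite -[y]invrK -[y^-1]div1r; apply: FieldGen_div => //.
by apply: FieldGen_div => //; apply: FieldGen_one.
Qed.

Lemma galQabD x y : Qab x -> Qab y -> s (x + y) = s x + s y.
Proof.
move=> Qx Qy; have Q0 := Qab0; have Qny : Qab (- y).
  by rewrite -sub0r; apply: FieldGen_sub.
by rewrite -{1}[y]opprK galQabB // -[- y]sub0r galQabB // galQab0 sub0r opprK.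
Qed.

Lemma galQabX x n : Qab x -> Qab (x ^+ n) /\ s (x ^+ n) = s x ^+ n.
Proof.
move=> Qx; elim: n => [|n [Qn IHn]]; first by split;
  [apply: FieldGen_one | apply: galQab1].
by rewrite !exprS galQabM // IHn; split=> //; apply: QabM.
Qed.

Lemma galQab_sum_seq (r : seq algC) :
  (forall z, z \in r -> Qab z) ->
  Qab (\sum_(z <- r) z) /\ s (\sum_(z <- r) z) = \sum_(z <- r) s z.
Proof.
elim: r => [|z r IHr] Qr; first by rewrite !big_nil; split;
  [apply: Qab0 | apply: galQab0].
have [|Qs Es] := IHr; first by move=> w rw; apply: Qr; rewrite inE rw orbT.
have Qz : Qab z by apply: Qr; rewrite mem_head.
by rewrite !big_cons galQabD // Es; split=> //; apply: QabD.
Qed.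

(* s raises the m-th roots of unity to some power coprime to m. *)
Lemma galQab_rmorph m : (0 < m)%N ->
  exists nu : {rmorphism algC -> algC}, forall z, z ^+ m = 1 -> nu z = s z.
Proof.
move=> m_gt0; have [w prim_w] := C_prim_root_exists m_gt0.
have Qroot z : z ^+ m = 1 -> Qab z.
  by move=> zm1; apply: FieldGen_mem; exists m.
have Qw : Qab w by apply: Qroot; apply: prim_expr_order.
have sw k : s (w ^+ k) = s w ^+ k by have [] := galQabX k Qw.
have swm : s w ^+ m = 1 by rewrite -sw (prim_expr_order prim_w) galQab1.
have [k Dsw] := prim_rootP prim_w swm.
have inj_s x y : Qab x -> Qab y -> s x = s y -> x = y.
  move=> Qx Qy eq_s; apply/eqP; rewrite -subr_eq0; apply: contraT => nz_xy.
  have Qxy : Qab (x - y) by apply: FieldGen_sub.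
  have := galQab1 s; rewrite -(divff nz_xy) galQabM //; last first.
    by rewrite -div1r; apply: FieldGen_div => //; apply: FieldGen_one.
  by rewrite galQabB // eq_s subrr mul0r divff // => /eqP; rewrite eq_sym oner_eq0.
(* [s] is injective on [Qab], so it preserves the exact order of [w]. *)
have co_k_m : coprime k m.
  have prim_sw : m.-primitive_root (s w).
    apply/andP; split=> //; apply/forallP => i.
    have /andP[_ /forallP/(_ i)/eqP <-] := prim_w.
    rewrite !unity_rootE -sw; apply/eqP; apply/eqP/eqP => [sw1|->]; last first.
      by rewrite galQab1.
    apply: inj_s; rewrite ?sw1 ?galQab1 //; last exact: FieldGen_one.
    by have [] := galQabX i.+1 Qw.
  by rewrite -(prim_root_exp_coprime _ prim_w) -Dsw.
have [nu Dnu] := Qn_aut_exists co_k_m; exists nu => z zm1.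
have [i ->] := prim_rootP prim_w zm1.
by rewrite sw Dsw rmorphXn Dnu // (prim_expr_order prim_w).
Qed.

End GalQabClosure.

(** On the cyclic group generated by x the character is a sum of linear characters. The exponent is
    the order of the whole type, so that it does not depend on Y, phi or x. *)
Lemma char_root_sum (gT : finGroupType) (Y : {group gT}) (phi : 'CF(Y)) x :
  phi \is a character -> exists2 r : seq algC,
    phi x = \sum_(z <- r) z & {in r, forall z, z ^+ #|[set: gT]| = 1}.
Proof.
move=> Nphi; have [Yx | notYx] := boolP (x \in Y); last first.
  by exists [::]; rewrite ?big_nil ?cfun0.
have sXY : <[x]> \subset Y by rewrite cycle_subG.
rewrite -(cfResE phi sXY (cycle_id x)).
have /char_sum_irr[r ->] := cfRes_char <[x]> Nphi.
exists [seq ('chi_i : 'CF(<[x]>)) x | i <- r]; first by rewrite big_map sum_cfunE.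
move=> _ /mapP[i _ ->]; have Lx := irr_cyclic_lin i (cycle_cyclic x).
have /dvdnP[k ->] : (#[x] %| #|[set: gT]|)%N by apply: order_dvdG; rewrite inE.
by rewrite mulnC exprM (lin_char_unity_root Lx (cycle_id x)) expr1n.
Qed.

(** Character values are sums of roots of unity of bounded order, on which [s] agrees with an
    automorphism of [algC]. One [nu] serves all subgroups at once; from here on the Galois action
    can be handled by [cfAut]. *)
Lemma galQab_char (gT : finGroupType) (s : galQab) :
  exists nu : {rmorphism algC -> algC},
    forall (Y : {group gT}) (phi : 'CF(Y)), phi \is a character ->
    cfGal s phi = cfAut nu phi.
Proof.
have [nu Dnu] := galQab_rmorph s (cardG_gt0 [set: gT]); exists nu => Y phi Nphi.
apply/cfunP => x; have [r Dphi r1] := char_root_sum x Nphi.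
rewrite !cfunE Dphi rmorph_sum.
have [z rz | _ ->] := @galQab_sum_seq s r.
  by apply: FieldGen_mem; exists #|[set: gT]|; rewrite ?r1.
by apply: eq_big_seq => z rz; rewrite Dnu ?r1.
Qed.

(** Links the intermediate fields of [L] to the inductive [field_gen]: an element of the adjoined
    field is a polynomial in the last generator with coefficients in the previous field. *)
Lemma field_gen_Fadjoin_seq (L : splittingFieldType rat)
    (f : {rmorphism L -> algC}) (A : algC -> Prop) (r : seq L) z :
  (forall x, x \in r -> A (f x)) -> z \in <<1 & r>>%VS -> field_gen A (f z).
Proof.
have A0 : field_gen A 0.
  by rewrite -(subrr 1); apply: FieldGen_sub; apply: FieldGen_one.
have AD x y : field_gen A x -> field_gen A y -> field_gen A (x + y).
  move=> Ax Ay; rewrite -[y]opprK -[- y]sub0r.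
  by apply: FieldGen_sub => //; apply: FieldGen_sub.
have AM x y : field_gen A x -> field_gen A y -> field_gen A (x * y).
  move=> Ax Ay; rewrite -[y]invrK -[y^-1]div1r; apply: FieldGen_div => //.
  by apply: FieldGen_div => //; apply: FieldGen_one.
elim/last_ind: r z => [|r x IHr] z Ar.
  rewrite Fadjoin_nil => /vlineP[q ->]; rewrite alg_num_field fmorph_rat.
  have An (n : nat) : field_gen A n%:R.
    by elim: n => // n IHn; rewrite -natr1; apply: AD => //; apply: FieldGen_one.
  have AZ (n : int) : field_gen A n%:~R.
    case: n => n; first exact: An.
    by rewrite NegzE mulrNz -sub0r; apply: FieldGen_sub => //; apply: An.
  by rewrite /ratr; apply: FieldGen_div; apply: AZ.
have {}IHr y : y \in <<1 & r>>%VS -> field_gen A (f y).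
  by apply: IHr => w rw; apply: Ar; rewrite mem_rcons inE rw orbT.
rewrite adjoin_rcons => /Fadjoin_polyP[p /polyOverP Kp ->].
have Ax : field_gen A (f x) by apply/FieldGen_mem/Ar; rewrite mem_rcons mem_head.
rewrite horner_coef rmorph_sum; apply: (big_ind (field_gen A)) => // i _.
rewrite rmorphM rmorphXn; apply: (AM); first exact: IHr.
by elim: (i : nat) => [|k IHk]; [apply: FieldGen_one | rewrite exprS; apply: AM].
Qed.

(** Galois correspondence inside a splitting field [L] that contains all the values: a value of xi
    is fixed by every automorphism fixing the values of chi, so it lies in the field they
    generate. *)
Lemma cfField_sub (gT : finGroupType) (A G H : {group gT})
    (chi : 'CF(G)) (xi : 'CF(H)) :
    G \subset A -> H \subset A -> chi \is a character -> xi \is a character ->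
    (forall nu : {rmorphism algC -> algC},
       cfAut nu chi = chi -> cfAut nu xi = xi) ->
  forall z, cfField xi z -> cfField chi z.
Proof.
move=> sGA sHA Nchi Nxi chi_xi z; elim=> {z} [_ [h Hh ->]||x y _ Bx _ By|x y _ Bx _ By];
  try by [apply: FieldGen_one | apply: FieldGen_sub | apply: FieldGen_div].
have [L galL [f gal_f [w _ Lchar]]] := group_num_field_exists A.
have [a Da] := Lchar _ _ _ Nxi h (order_dvdG (subsetP sHA h Hh)).
have val g : {b | f b = chi g}.
  have [Gg | notGg] := boolP (g \in G);
    first exact: Lchar (order_dvdG (subsetP sGA g Gg)).
  by exists 0; rewrite rmorph0 cfun0.
pose r := [seq sval (val g) | g <- enum G].
have galK : galois <<1 & r>> {:L} by apply: galoisS galL; rewrite sub1v subvf.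
rewrite -Da; apply: (@field_gen_Fadjoin_seq _ f _ r).
  move=> _ /mapP[g Gg ->]; exists g; first by rewrite mem_enum in Gg.
  exact: svalP (val g).
rewrite -(galois_fixedField galK); apply/fixedFieldP; first exact: memvf.
(* The automorphism [x] of [L] extends to [algC], where the hypothesis on [nu] applies. *)
move=> x Gx; have [nu Dnu] := gal_f x.
have x_fix b : b \in <<1 & r>>%VS -> x b = b by apply: fixed_gal Gx; apply: subvf.
have nu_chi : cfAut nu chi = chi.
  apply/cfunP => g; rewrite cfunE.
  have [Gg | notGg] := boolP (g \in G); last by rewrite cfun0 // rmorph0.
  rewrite -(svalP (val g)) -Dnu x_fix //.
  by apply: seqv_sub_adjoin; apply: map_f; rewrite mem_enum.
apply: (fmorph_inj f); rewrite Dnu Da.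
by have /cfunP/(_ h) := chi_xi nu nu_chi; rewrite cfunE.
Qed.

(** * Tensor products of matrices *)

Section TensorMatrices.

Variables (R : comNzRingType) (I : finType) (d : nat).
Implicit Types (A B : I -> 'M[R]_d) (p q : {perm I}) (c : I -> R).

Definition index_fun (s : 'I_#|{ffun I -> 'I_d}|) : {ffun I -> 'I_d} := enum_val s.

Lemma sum_index_fun (F : {ffun I -> 'I_d} -> R) : \sum_s F (index_fun s) = \sum_f F f.
Proof.
rewrite (reindex (@enum_rank {ffun I -> 'I_d})) /=; last exact/onW_bij/enum_rank_bij.
by apply: eq_bigr => f _; rewrite /index_fun enum_rankK.
Qed.

(* The tensor product of the A i, followed by the permutation p of the        *)
(* factors; basis vectors are indexed by functions I -> 'I_d.                 *)
Definition tens_perm A p : 'M[R]_#|{ffun I -> 'I_d}| :=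
  \matrix_(s, t) \prod_i A i (index_fun s i) (index_fun t (p i)).

Lemma eq_tens_perm A B p : A =1 B -> tens_perm A p = tens_perm B p.
Proof.
by move=> eqAB; apply/matrixP => s t; rewrite !mxE; apply: eq_bigr => i _; rewrite eqAB.
Qed.

Lemma tens_permM A B p q :
  tens_perm A p *m tens_perm B q = tens_perm (fun i => A i *m B (p i)) (p * q)%g.
Proof.
apply/matrixP => s t; rewrite !mxE.
pose F (f : {ffun I -> 'I_d}) :=
  \prod_i (A i (index_fun s i) (f (p i)) * B (p i) (f (p i)) (index_fun t (q (p i)))).
transitivity (\sum_f F f).
  rewrite -(sum_index_fun F); apply: eq_bigr => j _; rewrite !mxE /F big_split /=.
  congr (_ * _); rewrite (reindex_inj (@perm_inj _ p)).
  by apply: eq_bigr.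
transitivity (\sum_(f : {ffun I -> 'I_d})
    \prod_i (A i (index_fun s i) (f i) * B (p i) (f i) (index_fun t (q (p i))))).
  (* Reindexing by p replaces f (p i) by f i; the sum over all functions of a product then factors
     as a product of sums. *)
  pose h (f : {ffun I -> 'I_d}) : {ffun I -> 'I_d} := [ffun i => f ((p^-1)%g i)].
  have h_bij : bijective h.
    exists (fun f : {ffun I -> 'I_d} => [ffun i => f (p i)]) => f; apply/ffunP => i;
    rewrite !ffunE.
      by rewrite permK.
    by rewrite permKV.
  rewrite (reindex h) /=; last exact: onW_bij.
  apply: eq_bigr => f _; apply: eq_bigr => i _; rewrite !ffunE permK //.
rewrite -(bigA_distr_bigA (fun i j => A i (index_fun s i) j * B (p i) j (index_fun t (q
  (p i))))) /=.
by apply: eq_bigr => i _; rewrite mxE permM.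
Qed.

Lemma tens_perm1 : tens_perm (fun=> 1%:M) 1 = 1%:M.
Proof.
apply/matrixP => s t; rewrite !mxE.
have [-> | neq_st] := eqVneq s t.
  by rewrite big1 // => i _; rewrite perm1 mxE eqxx.
have /existsP[i neq_i] : [exists i, index_fun s i != index_fun t i].
  apply: contraR neq_st => /existsPn eq_st; apply/eqP/enum_val_inj/ffunP => i.
  by apply/eqP; rewrite -[_ == _]negbK eq_st.
by rewrite (bigD1 i) //= perm1 mxE (negbTE neq_i) mul0r.
Qed.

Lemma tens_permZ c A p :
  tens_perm (fun i => c i *: A i) p = (\prod_i c i) *: tens_perm A p.
Proof.
apply/matrixP => s t; rewrite !mxE -big_split.
by apply: eq_bigr => i _; rewrite mxE.
Qed.

Lemma tens_perm_scalar c : tens_perm (fun i => (c i)%:M) 1 = (\prod_i c i)%:M.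
Proof.
rewrite -scalemx1 -tens_perm1 -tens_permZ.
by apply: eq_tens_perm => i; rewrite scalemx1.
Qed.

Lemma tens_perm_tr A : \tr (tens_perm A 1) = \prod_i \tr (A i).
Proof.
rewrite /mxtrace bigA_distr_bigA /=.
rewrite -(sum_index_fun (fun f : {ffun I -> 'I_d} => \prod_i A i (f i) (f i))).
by apply: eq_bigr => s _; rewrite mxE; apply: eq_bigr => i _; rewrite perm1.
Qed.

End TensorMatrices.

Lemma tens_perm_unit (F : fieldType) (I : finType) d (A : I -> 'M[F]_d) (p : {perm I}) :
  (forall i, A i \in unitmx) -> tens_perm A p \in unitmx.
Proof.
move=> uA; pose B i := invmx (A ((p^-1)%g i)).
suff AB1 : tens_perm A p *m tens_perm B p^-1 = 1%:M by have [] := mulmx1_unit AB1.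
rewrite tens_permM mulgV -tens_perm1; apply: eq_tens_perm => i.
by rewrite /B permK mulmxV.
Qed.

Lemma map_tens_perm (R S : comNzRingType) (f : {rmorphism R -> S}) (I : finType) d
    (A : I -> 'M[R]_d) (p : {perm I}) :
  map_mx f (tens_perm A p) = tens_perm (fun i => map_mx f (A i)) p.
Proof.
apply/matrixP => s t; rewrite !mxE rmorph_prod.
by apply: eq_bigr => i _; rewrite mxE.
Qed.

(** * Matrices affording a character *)

Lemma mxtrace_mul_delta (R : comNzRingType) d (A : 'M[R]_d) i j :
  \tr (A *m delta_mx i j) = A j i.
Proof.
rewrite /mxtrace (bigD1 j) //= mxE (bigD1 i) //= mxE !eqxx mulr1 !big1 ?addr0 //.
  by move=> k ne_kj; rewrite mxE big1 // => l _; rewrite mxE (negbTE ne_kj) andbF mulr0.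
by move=> k ne_ki; rewrite mxE (negbTE ne_ki) mulr0.
Qed.

Lemma mul_delta_mulE (R : comNzRingType) d (A B : 'M[R]_d) i j k l :
  (A *m delta_mx i j *m B) k l = A k i * B j l.
Proof.
rewrite -(mul_delta_mx (0 : 'I_1)) mulmxA -mulmxA -colE -rowE.
by rewrite !mxE big_ord1 !mxE.
Qed.

Section Affords.

Variables (gT : finGroupType) (G : {group gT}).
Implicit Type phi : 'CF(G).

(** The representation is a bare function on the group type, so that it can be given by formulas,
    conjugated by a matrix and restricted to subgroups without repackaging. *)
Definition affords d (T : gT -> 'M[algC]_d) (phi : 'CF(G)) :=
  mx_repr G T /\ {in G, forall x, phi x = \tr (T x)}.

Lemma affords_cfRepr d (T : gT -> 'M[algC]_d) phi (hT : mx_repr G T) :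
  {in G, forall x, phi x = \tr (T x)} -> phi = cfRepr (MxRepresentation hT).
Proof. by move=> trT; apply/cfun_inP => x Gx; rewrite cfunE Gx trT. Qed.

Lemma affords1 d (T : gT -> 'M[algC]_d) phi : affords T phi -> phi 1%g = d%:R.
Proof. by case=> -[T1 _] ->; rewrite // T1 mxtrace1. Qed.

Lemma char_afforded d phi :
  phi \is a character -> phi 1%g = d%:R -> exists T : gT -> 'M[algC]_d, affords T phi.
Proof.
case/char_reprP => -[n rG] ->; rewrite cfRepr1 => /eqP; rewrite eqr_nat => /eqP <-.
exists rG; split; first by case: (rG).
by move=> x Gx; rewrite cfunE Gx.
Qed.

Lemma affords_sim d (T1 T2 : gT -> 'M[algC]_d) phi :
  affords T1 phi -> affords T2 phi ->
  exists2 B, B \in unitmx & {in G, forall x, T1 x *m B = B *m T2 x}.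
Proof.
case=> h1 tr1 [h2 tr2].
have := affords_cfRepr h2 tr2; rewrite {1}(affords_cfRepr h1 tr1) => /cfRepr_inj[B _].
by rewrite row_free_unit => uB eqB; exists B.
Qed.

(** Schur's lemma: over the complex numbers irreducibility is absolute. *)
Lemma affords_irr_cent d (T : gT -> 'M[algC]_d) phi :
    affords T phi -> phi \in irr G ->
  (0 < d)%N /\ forall A, {in G, forall x, A *m T x = T x *m A} -> exists a, A = a%:M.
Proof.
move=> TG irr_phi; have d_gt0 : (0 < d)%N.
  by have:= irr1_gt0 (cfIirr phi); rewrite cfIirrE // (affords1 TG) ltr0n.
have [hT trT] := TG; pose rT := MxRepresentation hT.
have irr_rT : mx_irreducible rT.
  have /irr_reprP[rG irr_rG] := irr_phi; rewrite (affords_cfRepr hT trT).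
  by move=> /cfRepr_inj/mx_rsim_sym sim; apply: mx_rsim_irr sim irr_rG.
split=> // A cAT; apply/is_scalar_mxP.
apply: (mx_abs_irr_cent_scalar (rG := rT)); first exact: groupC.
by apply/centgmxP.
Qed.

Lemma mx_repr_unit d (T : gT -> 'M[algC]_d) x : mx_repr G T -> x \in G -> T x \in unitmx.
Proof. by move=> hT Gx; apply: (repr_mx_unit (MxRepresentation hT)). Qed.

Lemma mx_reprV d (T : gT -> 'M[algC]_d) x :
  mx_repr G T -> x \in G -> T x^-1%g = invmx (T x).
Proof. by move=> hT Gx; apply: (repr_mxV (MxRepresentation hT)). Qed.

(** Schur orthogonality in trace form. The sum of the conjugates of a matrix Z under T commutes with
    T, hence is a scalar, which its trace determines; the product of two traces is reduced to this
    case by expanding over matrix units. *)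
Lemma sum_mxtrace_irr d (T : gT -> 'M[algC]_d) phi X Y :
    affords T phi -> phi \in irr G ->
  \sum_(x in G) \tr (X *m T x) * \tr (T x^-1%g *m Y) = #|G|%:R / d%:R * \tr (X *m Y).
Proof.
move=> TG irr_phi; have [d_gt0 cT] := affords_irr_cent TG irr_phi.
have [hT _] := TG; have [T1 TM] := hT.
have nz_d : d%:R != 0 :> algC by rewrite pnatr_eq0 -lt0n.
have trE (A B : 'M[algC]_d) :
    \tr A * \tr B = \sum_i \sum_j \tr (A *m delta_mx i j *m B *m delta_mx j i).
  rewrite /mxtrace big_distrl /=; apply: eq_bigr => i _; rewrite big_distrr /=.
  apply: eq_bigr => j _.
  by rewrite -[RHS]/(\tr _) mxtrace_mul_delta mul_delta_mulE.
have tr_delta i j : \tr (delta_mx i j : 'M[algC]_d) = (j == i)%:R.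
  by rewrite -[delta_mx i j]mul1mx mxtrace_mul_delta mxE.
have avg Z : \sum_(x in G) T x *m Z *m T x^-1%g = (#|G|%:R * \tr Z / d%:R)%:M.
  set A := \sum_(x in G) _.
  have [a Da] : exists a, A = a%:M.
    apply: cT => y Gy; rewrite /A mulmx_suml mulmx_sumr (reindex_inj (mulgI y)) /=.
    apply: eq_big => [x | x Gyx]; first by rewrite groupMl.
    have Gx : x \in G by rewrite groupMl in Gyx.
    by rewrite invMg !TM ?groupV // -!mulmxA -TM ?groupV // mulVg T1 mulmx1.
  rewrite Da; congr _%:M; apply: (mulIf nz_d); rewrite divfK //.
  have := congr1 mxtrace Da; rewrite mxtrace_scalar -[RHS]mulr_natr => <-.
  rewrite /A raddf_sum /= (eq_bigr (fun=> \tr Z)) ?sumr_const ?mulr_natl // => x Gx.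
  by rewrite mxtrace_mulC mulmxA -TM ?groupV // mulVg T1 mul1mx.
transitivity (\sum_i \sum_j \tr (X *m (\sum_(x in G) T x *m delta_mx i j *m T x^-1%g)
                                 *m Y *m delta_mx j i)).
  under eq_bigr => x _ do rewrite trE.
  rewrite exchange_big; apply: eq_bigr => i _; rewrite exchange_big;
    apply: eq_bigr => j _.
  rewrite mulmx_sumr !mulmx_suml raddf_sum /=; apply: eq_bigr => x _.
  by rewrite !mulmxA.
transitivity (\sum_i #|G|%:R / d%:R * (X *m Y) i i).
  apply: eq_bigr => i _; rewrite (bigD1 i) //= avg [X in _ + X]big1 ?addr0 => [|j neq_ji].
    rewrite mxtrace_mul_delta tr_delta eqxx mulr1.
    by rewrite mul_mx_scalar -!scalemxAl mxE.
  rewrite avg mxtrace_mul_delta tr_delta (negbTE neq_ji).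
  by rewrite mulr0 mul0r raddf0 mulmx0 mul0mx mxE.
by rewrite -big_distrr.
Qed.

End Affords.

(** * Clifford theory over projective representations *)

Section TensMx.

Variable R : comNzRingType.

Lemma mxtrace_tens m n (A : 'M[R]_m) (B : 'M[R]_n) : \tr (A *t B) = \tr A * \tr B.
Proof. by rewrite /mxtrace mulr_sum; apply: eq_bigr => k _; rewrite mxE. Qed.

Lemma tens1mx1 m n : (1%:M : 'M[R]_m) *t (1%:M : 'M[R]_n) = 1%:M.
Proof.
apply/matrixP => i j; rewrite !mxE.
case: (mxtens_indexP i) => i1 i2; case: (mxtens_indexP j) => j1 j2.
rewrite !mxtens_indexK (inj_eq (can_inj (@mxtens_indexK m n))) -pair_eqE /= -natrM mulnb.
by [].
Qed.

Lemma tensZmx m n a (A : 'M[R]_m) (B : 'M[R]_n) : (a *: A) *t B = a *: (A *t B).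
Proof. by apply/matrixP => i j; rewrite !mxE mulrA. Qed.

Lemma tensmxZ m n a (A : 'M[R]_m) (B : 'M[R]_n) : A *t (a *: B) = a *: (A *t B).
Proof. by apply/matrixP => i j; rewrite !mxE mulrCA. Qed.

Lemma tens1mx_inj m n (A B : 'M[R]_n) :
  (0 < m)%N -> (1%:M : 'M[R]_m) *t A = 1%:M *t B -> A = B.
Proof.
move=> m_gt0 eqAB; apply/matrixP => i j; pose k := Ordinal m_gt0.
have /matrixP/(_ (mxtens_index (k, i)) (mxtens_index (k, j))) := eqAB.
by rewrite !tensmxE mxE eqxx !mul1r.
Qed.

End TensMx.

Section Clifford.

Variables (gT : finGroupType) (N : {group gT}) (d : nat) (T : gT -> 'M[algC]_d).
Variable theta : 'CF(N).
Hypotheses (affT : affords T theta) (irr_theta : theta \in irr N).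

(** Each d by d block of X commutes with T, so it is scalar by Schur's lemma, and these scalars form
    Q. *)
Lemma tens_cent e (X : 'M[algC]_(d * e)) :
    {in N, forall x, X *m (T x *t (1%:M : 'M_e)) = (T x *t 1%:M) *m X} ->
  exists Q : 'M_e, X = 1%:M *t Q.
Proof.
have [d_gt0 cT] := affords_irr_cent affT irr_theta; pose i0 := Ordinal d_gt0.
move=> cX; pose Xb a b := \matrix_(i < d, j < d) X (mxtens_index (i, a)) (mxtens_index
  (j, b)).
exists (\matrix_(a, b) Xb a b i0 i0); apply/matrixP => k l.
case: (mxtens_indexP k) => i a; case: (mxtens_indexP l) => j b.
have /cT[q Dq] : {in N, forall x, Xb a b *m T x = T x *m Xb a b}.
  move=> x Nx; have /matrixP XT := cX x Nx; apply/matrixP => r s.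
  have := XT (mxtens_index (r, a)) (mxtens_index (s, b)); rewrite !mxE.
  have red (f : 'I_(d * e) -> algC) : \sum_k f k = \sum_i \sum_c f (mxtens_index (i, c)).
    rewrite pair_big /=; rewrite (reindex (@mxtens_index d e)) /=; last first.
      by exists (@mxtens_unindex d e) => u _; rewrite ?mxtens_indexK ?mxtens_unindexK.
    by apply: eq_bigr => -[].
  rewrite !red => XTrs.
  transitivity (\sum_i0 \sum_c
      X (mxtens_index (r, a)) (mxtens_index (i0, c)) *
      (T x *t (1%:M : 'M_e)) (mxtens_index (i0, c)) (mxtens_index (s, b))).
    apply: eq_bigr => t _; rewrite (bigD1 b) //= big1 ?addr0 => [|c ne_cb].
      by rewrite tensmxE !mxE eqxx mulr1.
    by rewrite tensmxE !mxE (negbTE ne_cb) !mulr0.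
  rewrite XTrs; apply: eq_bigr => t _; rewrite (bigD1 a) //= big1 ?addr0 => [|c ne_ca].
    by rewrite tensmxE !mxE eqxx mulr1.
  by rewrite tensmxE !mxE eq_sym (negbTE ne_ca) !(mulr0, mul0r).
have XbE r s : X (mxtens_index (r, a)) (mxtens_index (s, b)) = q *+ (r == s).
  by have /matrixP/(_ r s) := Dq; rewrite !mxE.
by rewrite tensmxE !mxE !XbE eqxx mulr_natl.
Qed.

Variables (A H : {group gT}) (P : gT -> 'M[algC]_d).
Hypotheses (nNA : (N <| A)%g) (sHA : H \subset A) (defA : A = (N * H)%g :> {set gT}).
Hypothesis uP : {in H, forall h, P h \in unitmx}.
Hypothesis TP : {in N & H, forall x h, T x *m P h = P h *m T (x ^ h)%g}.

(** [P h] makes T similar to its conjugate by h, so theta is fixed by H, and trivially by N. *)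
Lemma intertwined_inertia : A \subset 'I[theta]%g.
Proof.
have [_ trT] := affT; have [sNA nNA'] := andP nNA.
rewrite defA mulG_subG sub_inertia //=; apply/subsetP => h Hh.
have nNh : h \in 'N(N)%g by apply: (subsetP nNA'); apply: (subsetP sHA).
rewrite inE nNh; apply/eqP/cfun_inP => x Nx.
rewrite cfConjgE // !trT // ?memJ_norm ?groupV //.
have := TP (_ : x ^ h^-1 \in N)%g Hh; rewrite memJ_norm ?groupV // conjgKV => /(_ Nx) TPx.
rewrite -[T x](mulKmx (uP Hh)) -TPx mxtrace_mulC mulmxK ?uP //.
Qed.

(** The restriction of chi to N is a multiple e of theta, so a basis exists in which it is T tensor
    1. There the inverse of [P h] tensor 1, times [E h], commutes with T tensor 1, and [tens_cent]
    makes it 1 tensor [Q h]. *)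
Lemma Clifford_tens chi :
    chi \in irr A -> '['Res[N] chi, theta] != 0 ->
  exists e (E : gT -> 'M[algC]_(d * e)) (Q : gT -> 'M[algC]_e),
  [/\ affords E chi, (0 < e)%N,
      {in N, forall x, E x = T x *t 1%:M},
      {in H, forall h, E h = P h *t Q h} &
      {in H, forall h, Q h \in unitmx}].
Proof.
move=> irr_chi chiNtheta; have [sNA _] := andP nNA; have [hT trT] := affT.
have /irrP[i Dchi] := irr_chi; have /irrP[j Dtheta] := irr_theta.
have [e De] : exists e : nat, '['Res[N] chi, theta] = e%:R.
  by apply/natrP; rewrite Cnat_cfdot_char ?cfRes_char ?irrWchar.
have ResE : 'Res[N] chi = e%:R *: theta.
  have := Clifford_Res_sum_cfclass nNA (_ : j \in irr_constt ('Res[N] 'chi_i)).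
  rewrite irr_consttE -Dchi -Dtheta => /(_ chiNtheta) ->.
  by rewrite cfclass_invariant ?intertwined_inertia // big_seq1 De.
have e_gt0 : (0 < e)%N by rewrite lt0n; apply: contraNneq chiNtheta => e0; rewrite De e0.
have chi1 : chi 1%g = (d * e)%:R.
  by rewrite -(cfRes1 N) ResE cfunE (affords1 affT) mulrC natrM.
have [E0 affE0] := char_afforded (irrWchar irr_chi) chi1.
have [hE0 trE0] := affE0; have [E01 E0M] := hE0.
have hT1 : affords (fun x => T x *t (1%:M : 'M_e)) ('Res[N] chi).
  case: hT => [T1 TM]; split=> [|x Nx].
    split=> [|x y Nx Ny]; first by rewrite T1 tens1mx1.
    by rewrite TM // tensmx_mul mulmx1.
  by rewrite ResE cfunE mxtrace_tens mxtrace1 trT // mulrC.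
have hE0N : affords E0 ('Res[N] chi).
  split=> [|x Nx]; last by rewrite cfResE // trE0 // (subsetP sNA).
  by split=> // x y Nx Ny; rewrite E0M // (subsetP sNA).
have [B uB EB] := affords_sim hE0N hT1.
pose E g := invmx B *m E0 g *m B.
have ET : {in N, forall x, E x = T x *t 1%:M} by move=> x Nx;
  rewrite /E -mulmxA EB // mulKmx.
have EM : {in A &, {morph E : x y / (x * y)%g >-> x *m y}}.
  by move=> x y Ax Ay; rewrite /E E0M // !mulmxA mulmxK.
have affE : affords E chi.
  split=> [|x Ax]; last by rewrite /E mxtrace_mulC mulmxA mulmxV // mul1mx trE0.
  by split=> //; rewrite /E E01 mulmx1 mulVmx.
have [hE _] := affE; clearbody E.
pose X h := (invmx (P h) *t (1%:M : 'M_e)) *m E h.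
have cX : {in H & N, forall h x, X h *m (T x *t 1%:M) = (T x *t 1%:M) *m X h}.
  move=> h x Hh Nx; have Ah := subsetP sHA h Hh.
  have nNh : h \in 'N(N)%g by apply: subsetP Ah; apply: normal_norm nNA.
  have Nxh : (x ^ h^-1)%g \in N by rewrite memJ_norm ?groupV.
  have [Ax Axh] : x \in A /\ (x ^ h^-1)%g \in A by rewrite !(subsetP sNA).
  rewrite /X -mulmxA -{1}ET // -EM // conjgCV EM // ET //.
  rewrite !mulmxA !tensmx_mul !mulmx1; congr (_ *t _ *m _).
  have PT : T (x ^ h^-1)%g *m P h = P h *m T x by rewrite TP // conjgKV.
  by rewrite -[T (x ^ h^-1)%g](mulmxK (uP Hh)) PT !mulmxA mulVmx ?uP // mul1mx.
have QP (h : gT) : exists Q : 'M[algC]_e, h \in H -> X h = 1%:M *t Q.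
  have [Hh | _] := boolP (h \in H); last by exists 0.
  by have [Q] := tens_cent (fun x Nx => cX h x Hh Nx); exists Q.
have [Q DQ] : exists Q : gT -> 'M[algC]_e, {in H, forall h, X h = 1%:M *t Q h}.
  by have [Q DQ] := fin_all_exists QP; exists Q => h /DQ.
exists e, E, Q; split=> // h Hh.
  rewrite -[P h]mulmx1 -[Q h]mul1mx -tensmx_mul -DQ // /X mulmxA tensmx_mul.
  by rewrite mulmxV ?uP // mulmx1 tens1mx1 mul1mx.
have uE : E h \in unitmx by apply: (mx_repr_unit hE); apply: (subsetP sHA).
have uX : X h \in unitmx.
  rewrite unitmx_mul uE andbT.
  suff : (invmx (P h) *t (1%:M : 'M_e)) *m (P h *t 1%:M) = 1%:M by case/mulmx1_unit.
  by rewrite tensmx_mul mulVmx ?uP // mulmx1 tens1mx1.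
(* The inverse of [X h] commutes with the same matrices, so it is also of the form 1 tensor Q', and
   Q' inverts [Q h]. *)
have [Q' DQ'] : exists Q', invmx (X h) = 1%:M *t Q'.
  apply: tens_cent => x Nx; apply: (canLR (mulKmx uX)).
  by rewrite mulmxA cX // mulmxK.
have d_gt0 : (0 < d)%N by have [] := affords_irr_cent affT irr_theta.
have : (1%:M : 'M_d) *t (Q h *m Q') = 1%:M *t 1%:M.
  by rewrite -{1}[1%:M]mulmx1 -tensmx_mul -DQ // -DQ' mulmxV // tens1mx1.
by case/(tens1mx_inj d_gt0)/mulmx1_unit.
Qed.

Lemma sum_mulG (H1 N1 : {group gT}) (F : gT -> algC) :
  \sum_(h in H1) \sum_(x in N1) F (h * x)%g
    = #|H1 :&: N1|%:R * \sum_(g in (H1 * N1)%g) F g.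
Proof.
rewrite pair_big /=.
rewrite (partition_big (fun u => u.1 * u.2)%g [in (H1 * N1)%g]) /=; last first.
  by move=> u /andP[H1u N1u]; apply: mem_mulg.
rewrite big_distrr /=; apply: eq_bigr => _ /mulsgP[h x Hh Nx ->].
(* The fibre of multiplication over h * x is a copy of the intersection, embedded by [f]. *)
pose f u := ((h * u)%g, (u^-1 * x)%g).
have f_inj : injective f by move=> u v [/mulgI].
rewrite (eq_bigr (fun=> F (h * x)%g)) => [|u /andP[_ /eqP -> //]].
rewrite sumr_const mulr_natl -(card_imset _ f_inj); congr (_ *+ _).
apply: eq_card => -[a b]; rewrite unfold_in /=;
  apply/andP/imsetP => [|[u /setIP[Hu Nu] [-> ->]]].
  case=> /andP[Ha Nb] /eqP Dab; exists (h^-1 * a)%g.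
    rewrite inE groupM ?groupV //=; have -> : (h^-1 * a = x * b^-1)%g.
      by apply: (canLR (mulKg _)); rewrite mulgA -Dab mulgK.
    by rewrite groupM ?groupV.
  by rewrite /f mulKVg invMg invgK -mulgA -Dab mulKg.
by rewrite !groupM ?groupV // mulgA mulgK.
Qed.

(** Summing over the cosets of N, Schur orthogonality with [P h] and its inverse cancels P and T and
    leaves only the multiplicity parts a and b. Since the conjugate of psi is written with inverse
    matrices, [P h] may be non-unitary. *)
Lemma proj_dot (phi psi : 'CF(A)) (a b : gT -> algC) :
    {in H & N, forall h x, phi (h * x)%g = \tr (P h *m T x) * a h} ->
    {in H & N, forall h x, (psi (h * x)%g)^* = \tr (T x^-1%g *m invmx (P h)) * b h} ->
  '[phi, psi] = #|H|%:R^-1 * \sum_(h in H) a h * b h.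
Proof.
move=> phiE psiE; have [d_gt0 _] := affords_irr_cent affT irr_theta.
have [sNA nNA'] := andP nNA.
have nz_d : d%:R != 0 :> algC by rewrite pnatr_eq0 -lt0n.
have nzN := neq0CG N; have nzH := neq0CG H; have nzA := neq0CG A.
have sumN h : h \in H ->
    \sum_(x in N) phi (h * x)%g * (psi (h * x)%g)^* = #|N|%:R * (a h * b h).
  move=> Hh; under eq_bigr => x Nx do rewrite phiE // psiE // mulrACA.
  rewrite -mulr_suml (sum_mxtrace_irr _ _ affT irr_theta) mulmxV ?uP // mxtrace1.
  by rewrite divfK.
have cardE : #|N|%:R * #|H|%:R = #|A|%:R * #|H :&: N|%:R :> algC.
  by rewrite -!natrM mul_cardG -defA setIC.
have DHN : (H * N)%g = A :> {set gT}.
  by rewrite defA; apply/normC/(subset_trans sHA).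
rewrite cfdotE; apply: (mulfI nzH); apply: (mulfI nzN); rewrite mulVKf //.
rewrite mulrA cardE -mulrA [X in _ * X]mulrCA mulVKf //.
have := sum_mulG H N (fun g => phi g * (psi g)^*); rewrite DHN => <-.
by rewrite (eq_bigr _ sumN) -mulr_sumr.
Qed.

End Clifford.

(** * The correspondence above an invariant character *)

Lemma irr_dot_eq (gT : finGroupType) (G : {group gT}) (chi psi : 'CF(G)) :
  chi \in irr G -> psi \in irr G -> '[chi, psi] = (chi == psi)%:R.
Proof.
by move=> /irrP[i ->] /irrP[j ->]; rewrite cfdot_irr (inj_eq irr_inj).
Qed.

Section TripleBijection.

Variables (gT : finGroupType) (G K H U : {group gT}).
Hypotheses (nKG : (K <| G)%g) (sHG : H \subset G) (defG : G = (K * H)%g :> {set gT}).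
Hypothesis defU : U = (K :&: H)%g :> {set gT}.
Variables (d d' : nat) (T : gT -> 'M[algC]_d) (T' : gT -> 'M[algC]_d').
Variables (tau : 'CF(K)) (mu : 'CF(U)).
Hypotheses (affT : affords T tau) (irr_tau : tau \in irr K).
Hypotheses (affT' : affords T' mu) (irr_mu : mu \in irr U).
Variables (P : gT -> 'M[algC]_d) (P' : gT -> 'M[algC]_d').
Hypotheses (uP : {in H, forall h, P h \in unitmx}) (uP' : {in H, forall h, P' h \in
  unitmx}).
Hypothesis TP : {in K & H, forall x h, T x *m P h = P h *m T (x ^ h)%g}.
Hypothesis PM : {in H &, forall h l, exists a, [/\ a != 0,
  P h *m P l = a *: P (h * l)%g & P' h *m P' l = a *: P' (h * l)%g]}.
Hypothesis PU : {in U, forall u, exists c, [/\ c != 0, P u = c *: T u & P' u = c *: T'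
  u]}.

Let nUH : (U <| H)%g.
Proof. by rewrite defU setIC; apply: normalGI sHG nKG. Qed.
Let sUH : U \subset H := normal_sub nUH.
Let sUK : U \subset K. Proof. by rewrite defU subsetIl. Qed.
Let sKG : K \subset G := normal_sub nKG.
Let d_gt0 : (0 < d)%N. Proof. by have [] := affords_irr_cent affT irr_tau. Qed.

Lemma scale_unit_inj n (A : 'M[algC]_n) a b :
  (0 < n)%N -> A \in unitmx -> a *: A = b *: A -> a = b.
Proof.
move=> n_gt0 uA /(congr1 (mulmx (invmx A))); rewrite -!scalemxAr mulVmx //.
move/matrixP/(_ (Ordinal n_gt0) (Ordinal n_gt0)).
by rewrite !mxE eqxx !mulr1.
Qed.

(** The relation for P' is inherited from [TP]. Evaluating u * h = h * u ^ h in both ways through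
    [PM] and [PU] introduces scalars that are the same for P and for P', and for P they must
    balance. *)
Lemma sub_intertwines : {in U & H, forall u h, T' u *m P' h = P' h *m T' (u ^ h)%g}.
Proof.
move=> u h Uu Hh; have Hu := subsetP sUH u Uu; have Ku := subsetP sUK u Uu.
have Uuh : (u ^ h)%g \in U by rewrite memJ_norm ?(subsetP (normal_norm nUH)).
have Huh := subsetP sUH _ Uuh.
have [c [nz_c Pu P'u]] := PU Uu; have [b [nz_b Puh P'uh]] := PU Uuh.
have [a1 [nz_a1 M1 M1']] := PM Hu Hh; have [a2 [nz_a2 M2 M2']] := PM Hh Huh.
have eq_g : (h * u ^ h = u * h)%g by rewrite conjgE mulKVg.
have eq_ab : b * a1 = c * a2.
  apply: (scale_unit_inj d_gt0 (uP (groupM Hu Hh))).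
  rewrite -!scalerA -M1 -{1}eq_g -M2 Pu Puh -!scalemxAl -!scalemxAr TP //.
  by rewrite !scalerA mulrC.
apply: (scalerI (mulf_neq0 nz_b nz_c)).
have -> : (b * c) *: (T' u *m P' h) = (b * a1) *: P' (u * h)%g.
  by rewrite -scalerA [c *: _]scalemxAl -P'u M1' scalerA.
by rewrite eq_ab [b * c]mulrC -!scalerA [b *: _]scalemxAr -P'uh M2' eq_g.
Qed.

(** chi and xi share the multiplicity part Q, over P T and over P' T'. Values at inverses are
    recorded separately because the definition keeps no multiplication rule for Q; they give the
    conjugate values needed in [proj_dot]. *)
Definition triple_match (chi : 'CF(G)) (xi : 'CF(H)) :=
  exists e (Q : gT -> 'M[algC]_e),
  [/\ {in H, forall h, Q h \in unitmx},
      {in H & K, forall h x, chi (h * x)%g = \tr (P h *m T x) * \tr (Q h)},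
      {in H & K, forall h x,
         chi (h * x)^-1%g = \tr (T x^-1%g *m invmx (P h)) * \tr (invmx (Q h))},
      {in H & U, forall h x, xi (h * x)%g = \tr (P' h *m T' x) * \tr (Q h)} &
      {in H & U, forall h x,
         xi (h * x)^-1%g = \tr (T' x^-1%g *m invmx (P' h)) * \tr (invmx (Q h))}].

Lemma tens_coef (A N : {group gT}) n e (F : gT -> 'M[algC]_n) (E : gT -> 'M[algC]_(n * e))
    (R : gT -> 'M[algC]_n) (Q : gT -> 'M[algC]_e) (chi : 'CF(A)) :
    N \subset A -> H \subset A -> mx_repr N F -> affords E chi ->
    {in N, forall x, E x = F x *t 1%:M} -> {in H, forall h, E h = R h *t Q h} ->
    {in H, forall h, R h \in unitmx} -> {in H, forall h, Q h \in unitmx} ->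
  {in H & N, forall h x, chi (h * x)%g = \tr (R h *m F x) * \tr (Q h)} /\
  {in H & N, forall h x,
     chi (h * x)^-1%g = \tr (F x^-1%g *m invmx (R h)) * \tr (invmx (Q h))}.
Proof.
move=> sNA sHA hF [hE trE] EF ER uR uQ; have [_ EM] := hE.
split=> h x Hh Nx; have Ah := subsetP sHA h Hh; have Ax := subsetP sNA x Nx.
  by rewrite trE ?groupM // EM // (EF x) // (ER h) // tensmx_mul mulmx1 mxtrace_tens.
rewrite trE ?groupV ?groupM // invMg EM ?groupV // (EF x^-1%g) ?groupV // (mx_reprV hE)
  //.
suff -> : invmx (E h) = invmx (R h) *t invmx (Q h).
  by rewrite tensmx_mul mul1mx mxtrace_tens.
have uE := mx_repr_unit hE Ah.
have EV : E h *m (invmx (R h) *t invmx (Q h)) = 1%:M.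
  by rewrite ER // tensmx_mul mulmxV ?uR // mulmxV ?uQ // tens1mx1.
by rewrite -[RHS](mulKmx uE) EV mulmx1.
Qed.

(** The matrices Q of [Clifford_tens] multiply with the inverse of the factors of P ([QM]), which
    are also those of P'. So P' tensor Q is a genuine representation of H, and on U the scalars of
    P' and Q cancel ([QU]) to leave T' tensor 1. *)
Lemma triple_match_exists chi :
    chi \in irr G -> '['Res[K] chi, tau] != 0 ->
  exists2 xi, xi \is a character & triple_match chi xi.
Proof.
move=> irr_chi chiKtau.
have [e [E [Q [affE e_gt0 ET EP uQ]]]] :=
  Clifford_tens affT irr_tau nKG sHG defG uP TP irr_chi chiKtau.
have [hE _] := affE; have [_ EM] := hE.
have sUG := subset_trans sUK sKG.
have QM h l a : h \in H -> l \in H -> a != 0 -> P h *m P l = a *: P (h * l)%g ->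
    a *: (Q h *m Q l) = Q (h * l)%g.
  move=> Hh Hl nz_a PhPl; have Hhl := groupM Hh Hl.
  have [Gh Gl] := (subsetP sHG h Hh, subsetP sHG l Hl).
  have := EM h l Gh Gl; rewrite !EP // tensmx_mul PhPl tensZmx -tensmxZ => eqQ.
  apply: (tens1mx_inj d_gt0); rewrite -(mulVmx (uP Hhl)).
  rewrite -[Q _ in RHS]mul1mx -[_ *: (_ *m _)]mul1mx -!tensmx_mul.
  by rewrite -eqQ.
have QU u c : u \in U -> c != 0 -> P u = c *: T u -> c *: Q u = 1%:M.
  move=> Uu nz_c Pu; have Hu := subsetP sUH u Uu; have Ku := subsetP sUK u Uu.
  have := EP u Hu; rewrite ET // Pu tensZmx -tensmxZ => eqQ.
  have uT := mx_repr_unit (proj1 affT) Ku.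
  apply: (tens1mx_inj d_gt0); rewrite -(mulVmx uT).
  rewrite -[1%:M in RHS]mul1mx -[_ *: _ in LHS]mul1mx -!tensmx_mul.
  by rewrite -eqQ.
pose E' h := P' h *t Q h.
have E'U : {in U, forall u, E' u = T' u *t 1%:M}.
  move=> u Uu; have [c [nz_c Pu P'u]] := PU Uu.
  by rewrite /E' P'u tensZmx -tensmxZ (QU u c).
have hE' : mx_repr H E'.
  split=> [|h l Hh Hl].
    by have [[T'1 _] _] := affT'; rewrite E'U ?group1 // T'1 tens1mx1.
  have [a [nz_a M M']] := PM Hh Hl.
  by rewrite /E' tensmx_mul M' tensZmx -tensmxZ (QM h l a).
pose xi := cfRepr (MxRepresentation hE').
have affE' : affords E' xi by split=> // h Hh; rewrite cfunE Hh.
exists xi; first exact: cfRepr_char.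
have [m1 m2] := tens_coef sKG sHG (proj1 affT) affE ET EP uP uQ.
have [m3 m4] := tens_coef sUH (subxx H) (proj1 affT') affE' E'U (fun h _ => erefl) uP' uQ.
by exists e, Q; split.
Qed.

Let defH : H = (U * H)%g :> {set gT}.
Proof. by rewrite mulSGid. Qed.

(** By [proj_dot], used over K and over U, both sides are the same average over H of traces of
    [Q1 h] and of the inverse of [Q2 h]. *)
Lemma triple_match_dot chi xi psi eta :
    chi \is a character -> xi \is a character ->
    psi \is a character -> eta \is a character ->
    triple_match chi xi -> triple_match psi eta ->
  '[chi, psi] = '[xi, eta].
Proof.
move=> Nchi Nxi Npsi Neta [e1 [Q1 [uQ1 a1 b1 c1 d1]]] [e2 [Q2 [uQ2 a2 b2 c2 d2]]].
pose a h := \tr (Q1 h); pose b h := \tr (invmx (Q2 h)).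
rewrite (proj_dot affT irr_tau nKG sHG defG uP (a := a) (b := b)) //.
  rewrite (proj_dot affT' irr_mu nUH (subxx H) defH uP' (a := a) (b := b)) //.
  by move=> h x Hh Ux; rewrite -char_inv // d2.
by move=> h x Hh Kx; rewrite -char_inv // b2.
Qed.

Lemma triple_match_res chi xi :
  triple_match chi xi -> exists x,
    {in K, forall k, chi k = x * tau k} /\ {in U, forall u, xi u = x * mu u}.
Proof.
case=> e [Q [_ chiE _ xiE _]]; have [c [_ P1 P'1]] := PU (group1 U).
have [[T1 _] trT] := affT; have [[T'1 _] trT'] := affT'.
exists (c * \tr (Q 1%g)); split=> k Kk.
  by rewrite -{1}[k]mul1g chiE // P1 T1 trT // -scalemxAl mul1mx mxtraceZ mulrAC.
by rewrite -{1}[k]mul1g xiE // P'1 T'1 trT' // -scalemxAl mul1mx mxtraceZ mulrAC.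
Qed.

Lemma triple_match_Res chi xi :
  triple_match chi xi -> exists x,
    'Res[K] chi = x *: tau /\ 'Res[U] xi = x *: mu.
Proof.
case/triple_match_res=> x [chiE xiE]; exists x.
by split; apply/cfun_inP => k Kk; rewrite cfResE // cfunE ?chiE ?xiE.
Qed.

Definition triple_corr chi xi := [/\ chi \in irr G, xi \in irr H, triple_match chi xi,
  '['Res[K] chi, tau] != 0 & '['Res[U] xi, mu] != 0].

(** Inner products of irreducible characters detect equality, so the isometry yields at once that
    the correspondence is single-valued and injective. *)
Lemma triple_corr_eq chi xi psi eta :
  triple_corr chi xi -> triple_corr psi eta -> chi = psi <-> xi = eta.
Proof.
move=> [i1 i2 m1 _ _] [i3 i4 m2 _ _].
have := triple_match_dot (irrWchar i1) (irrWchar i2) (irrWchar i3) (irrWchar i4) m1 m2.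
rewrite !irr_dot_eq // => /eqP; rewrite eqr_nat.
by case: (chi =P psi) => [->|ne1]; case: (xi =P eta) => [->|ne2].
Qed.

Lemma triple_corr_fun chi :
  chi \in irr G -> '['Res[K] chi, tau] != 0 -> exists xi, triple_corr chi xi.
Proof.
move=> irr_chi chiKtau; have [xi Nxi m] := triple_match_exists irr_chi chiKtau.
exists xi; split=> //.
  have Nchi := irrWchar irr_chi.
  by rewrite irrEchar Nxi -(triple_match_dot Nchi Nxi Nchi Nxi m m) irr_dot_eq ?eqxx.
have [x [chiE xiE]] := triple_match_Res m.
by move: chiKtau; rewrite chiE xiE !cfdotZl !irr_dot_eq ?eqxx.
Qed.

Lemma inertia_tau : G \subset 'I[tau]%g.
Proof. exact: (intertwined_inertia affT nKG sHG defG uP TP). Qed.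

Lemma inertia_mu : H \subset 'I[mu]%g.
Proof. exact: (intertwined_inertia affT' nUH (subxx H) defH uP' sub_intertwines). Qed.

(** Both sides are the norm of the induced character, whose restriction to N is |A : N| theta. *)
Lemma sum_Ind_invariant (A N : {group gT}) (theta : 'CF(N)) :
    (N <| A)%g -> theta \in irr N -> A \subset 'I[theta]%g ->
  \sum_i '['Ind[A] theta, 'chi_i] ^+ 2 = #|A : N|%:R.
Proof.
move=> nNA irr_theta IA; transitivity '['Ind[A] theta].
  rewrite cfdot_sum_irr; apply: eq_bigr => i _.
  have /natrP[e ->] : '['Ind[A] theta, 'chi_i] \in Num.nat.
    by rewrite Cnat_cfdot_char ?irr_char // cfInd_char ?irrWchar.
  by rewrite conjC_nat.
by rewrite -Frobenius_reciprocity cfRes_Ind_invariant // cfdotZr irrWnorm // mulr1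
  conjC_nat.
Qed.

(* Sums of squares: both induced characters have norm |G : K| = |H : U|, and  *)
(* the correspondence preserves multiplicities, so it misses no constituent.  *)
Lemma triple_corr_onto xi :
  xi \in irr H -> '['Res[U] xi, mu] != 0 -> exists chi, triple_corr chi xi.
Proof.
move=> irr_xi xiUmu; have /irrP[j Dxi] := irr_xi.
pose S := [pred i | '['Ind[G] tau, 'chi_i] != 0].
have cong (A N : {group gT}) (theta : 'CF(N)) i : theta \in irr N ->
    '['Ind[A] theta, 'chi_i] = '['Res[N] 'chi_i, theta].
  move=> irr_theta; rewrite -Frobenius_reciprocity cfdotC.
  have /natrP[e ->] : '['Res[N] 'chi[A]_i, theta] \in Num.nat.
    by apply: Cnat_cfdot_char; [apply/cfRes_char/irr_char | apply: irrWchar].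
  by rewrite conjC_nat.
have fP i : exists k, i \in S -> triple_corr 'chi_i 'chi_k.
  have [Si | _] := boolP (i \in S); last by exists 0.
  have [|xi' c] := triple_corr_fun (mem_irr i); first by rewrite -cong.
  by have [_ /irrP[k Dk] _ _ _] := c; exists k; rewrite -Dk.
have [f fcorr] := fin_all_exists fP.
have f_inj : {in S &, injective f}.
  move=> i k Si Sk eq_f; apply: irr_inj.
  by apply/(triple_corr_eq (fcorr i Si) (fcorr k Sk)); rewrite eq_f.
have sumG := sum_Ind_invariant nKG irr_tau inertia_tau.
have sumH := sum_Ind_invariant nUH irr_mu inertia_mu.
have eq_idx : #|G : K| = #|H : U|.
  by rewrite [in LHS]defG indexMg -[LHS]indexgI setIC -defU.
have ef i : i \in S -> '['Ind[G] tau, 'chi_i] = '['Ind[H] mu, 'chi_(f i)].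
  move=> Si; have [_ _ m _ _] := fcorr i Si; rewrite !cong //.
  have [x [-> ->]] := triple_match_Res m.
  by rewrite !cfdotZl !irr_dot_eq ?eqxx.
have [[i Si Dj] | notSj] := altP (@imsetP _ _ f (mem S) j).
  by exists 'chi_i; rewrite Dxi Dj; apply: fcorr.
have : \sum_(k | k \notin f @: S) '['Ind[H] mu, 'chi_k] ^+ 2 = 0.
  have eq_sum : \sum_(k in f @: S) '['Ind[H] mu, 'chi_k] ^+ 2 = #|H : U|%:R.
    rewrite -eq_idx -sumG big_imset //= [RHS](bigID [in S]) /=.
    rewrite [X in _ = _ + X]big1 ?addr0 => [|i /negbNE/eqP ->]; last by rewrite expr0n.
    by apply: eq_bigr => i Si; rewrite ef.
  move: sumH; rewrite (bigID [in f @: S]) /= eq_sum => /eqP.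
  by rewrite -[RHS in _ == RHS]addr0 (inj_eq (addrI _)) => /eqP.
move/eqP; rewrite psumr_eq0 => [/allP/(_ j)|k _]; last first.
  have /natrP[e ->] : '['Ind[H] mu, 'chi_k] \in Num.nat.
    by rewrite Cnat_cfdot_char ?irr_char // cfInd_char ?irrWchar.
  by rewrite -natrX ler0n.
rewrite mem_index_enum notSj /= expf_eq0 /= cong // -Dxi (negbTE xiUmu).
by move/(_ isT).
Qed.

(** The factor m is common to P and P'. This is what allows it to be absorbed in the shared
    multiplicity part. *)
Definition compatible_aut (nu : {rmorphism algC -> algC}) :=
  exists S S' (m : gT -> algC),
  [/\ S \in unitmx /\ S' \in unitmx,
      {in K, forall k, map_mx nu (T k) = invmx S *m T k *m S},
      {in U, forall u, map_mx nu (T' u) = invmx S' *m T' u *m S'} &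
      {in H, forall h, [/\ m h != 0, map_mx nu (P h) = m h *: (invmx S *m P h *m S)
        & map_mx nu (P' h) = m h *: (invmx S' *m P' h *m S')]}].

(** Traces ignore the conjugation by S, so nu leaves the factors in R and F unchanged up to the
    scalar a, which moves over to Q. *)
Lemma coef_aut (nu : {rmorphism algC -> algC}) n e (S F R : 'M[algC]_n) (Q :
  'M[algC]_e) a :
    S \in unitmx -> R \in unitmx -> Q \in unitmx -> a != 0 ->
    map_mx nu F = invmx S *m F *m S ->
    map_mx nu R = a *: (invmx S *m R *m S) ->
  nu (\tr (R *m F) * \tr Q) = \tr (R *m F) * \tr (a *: map_mx nu Q) /\
  nu (\tr (F *m invmx R) * \tr (invmx Q))
    = \tr (F *m invmx R) * \tr (invmx (a *: map_mx nu Q)).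
Proof.
move=> uS uR uQ nz_a nuF nuR.
have trS (Y : 'M_n) : \tr (invmx S *m Y *m S) = \tr Y.
  by rewrite mxtrace_mulC mulmxA mulmxV // mul1mx.
have nuRV : map_mx nu (invmx R) = a^-1 *: (invmx S *m invmx R *m S).
  have uA : a *: (invmx S *m R *m S) \in unitmx.
    by rewrite unitmxZ ?unitfE // !unitmx_mul unitmx_inv uS uR.
  rewrite map_invmx nuR -[RHS](mulKmx uA) -scalemxAr -scalemxAl scalerA mulVf // scale1r.
  by rewrite -!mulmxA mulKVmx // mulKVmx // mulVmx // mulmx1.
rewrite !rmorphM -!trace_map_mx !map_mxM nuF nuR nuRV.
rewrite invmxZ ?unitmxZ ?unitfE ?map_unitmx // -map_invmx.
have conjM (Y Z : 'M_n) :
    invmx S *m Y *m S *m (invmx S *m Z *m S) = invmx S *m (Y *m Z) *m S.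
  by rewrite -!mulmxA mulKVmx.
by rewrite -!scalemxAl -!scalemxAr !mxtraceZ !conjM !trS; split; rewrite mulrCA mulrA.
Qed.

Lemma triple_match_aut nu chi xi :
  compatible_aut nu -> triple_match chi xi -> triple_match (cfAut nu chi) (cfAut nu xi).
Proof.
case=> S [S' [m [[uS uS'] nuT nuT' nuP]]] [e [Q [uQ a b c d0]]].
exists e, (fun h => m h *: map_mx nu (Q h));
  split=> [h Hh|h k Hh Kk|h k Hh Kk|h k Hh Uk|h k Hh Uk].
- by have [nz_m _ _] := nuP h Hh; rewrite unitmxZ ?unitfE // map_unitmx uQ.
- have [nz_m nuPh _] := nuP h Hh.
  have [E _] := coef_aut uS (uP Hh) (uQ h Hh) nz_m (nuT k Kk) nuPh.
  by rewrite cfunE a // E.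
- have [nz_m nuPh _] := nuP h Hh.
  have KkV : k^-1%g \in K by rewrite groupV.
  have [_ E] := coef_aut uS (uP Hh) (uQ h Hh) nz_m (nuT _ KkV) nuPh.
  by rewrite cfunE b // E.
- have [nz_m _ nuPh] := nuP h Hh.
  have [E _] := coef_aut uS' (uP' Hh) (uQ h Hh) nz_m (nuT' k Uk) nuPh.
  by rewrite cfunE c // E.
have [nz_m _ nuPh] := nuP h Hh.
have UkV : k^-1%g \in U by rewrite groupV.
have [_ E] := coef_aut uS' (uP' Hh) (uQ h Hh) nz_m (nuT' _ UkV) nuPh.
by rewrite cfunE d0 // E.
Qed.

End TripleBijection.

(** * Extension to Galois orbits *)

Section OrbitExtension.

Variables (gT : finGroupType) (G K H U : {group gT}).
Hypotheses (sHG : H \subset G) (sKG : K \subset G) (sUH : U \subset H).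
Variables (tau : 'CF(K)) (mu : 'CF(U)).
Hypotheses (irr_tau : tau \in irr K) (irr_mu : mu \in irr U).
Variable R : 'CF(G) -> 'CF(H) -> Prop.
Hypothesis R_irr : forall chi xi, R chi xi -> chi \in irr G /\ xi \in irr H.
Hypothesis R_Res : forall chi xi, R chi xi -> exists x,
  'Res[K] chi = x *: tau /\ 'Res[U] xi = x *: mu.
Hypothesis R_fun : forall chi,
  chi \in irr G -> '['Res[K] chi, tau] != 0 -> exists xi, R chi xi.
Hypothesis R_onto : forall xi,
  xi \in irr H -> '['Res[U] xi, mu] != 0 -> exists chi, R chi xi.
Hypothesis R_eq : forall chi xi psi eta, R chi xi -> R psi eta -> chi = psi <-> xi = eta.
Hypothesis R_aut : forall nu chi xi,
  cfAut nu tau = tau -> R chi xi -> R (cfAut nu chi) (cfAut nu xi).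
Hypothesis stab_aut : forall nu, cfAut nu tau = tau <-> cfAut nu mu = mu.

(** Characters over the orbit of theta are the Galois conjugates of those over theta itself. *)
Lemma IrrOver_autP (A N : {group gT}) (theta : 'CF(N)) (chi : 'CF(A)) :
    theta \in irr N ->
  IrrOver theta chi <-> exists (nu : {rmorphism algC -> algC}) (chi0 : 'CF(A)),
    [/\ chi0 \in irr A, '['Res[N] chi0, theta] != 0 & chi = cfAut nu chi0].
Proof.
move=> irr_theta; have Ntheta := irrWchar irr_theta.
split=> [[irr_chi [s chi_s]] | [nu [chi0 [irr0 nz_chi0 ->]]]]; last first.
  split; first by rewrite cfAut_irr.
  by exists (galQab_of nu); rewrite cfGal_of -cfAutRes cfdot_aut_char // fmorph_eq0.
have [nu Dnu] := galQab_char gT s.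
exists nu, (cfAut (algC_invaut nu) chi); rewrite cfAut_irr cfAutVK; split=> //.
rewrite -cfAutRes -[theta](cfAutK nu) cfdot_aut_char ?cfAut_char //.
by rewrite fmorph_eq0 -Dnu.
Qed.

(** The correspondence over tau, transported by all automorphisms; [corr_eq] shows that the choice
    of nu is harmless. *)
Let corr chi xi := exists (nu : {rmorphism algC -> algC}) chi0 xi0,
  [/\ R chi0 xi0, chi = cfAut nu chi0 & xi = cfAut nu xi0].

Let R_Res_neq0 chi xi : R chi xi -> exists x,
  [/\ x != 0, 'Res[K] chi = x *: tau & 'Res[U] xi = x *: mu].
Proof.
move=> Rcx; have [x [Dchi Dxi]] := R_Res Rcx; exists x; split=> //.
have [irr_chi _] := R_irr Rcx; apply: contraTneq (irr1_neq0 (cfIirr chi)) => x0.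
by rewrite cfIirrE // -(cfRes1 K) Dchi x0 scale0r cfunE eqxx.
Qed.

Lemma cfAut_scale_irr (N : {group gT}) (theta : 'CF(N)) (rho : {rmorphism algC ->
  algC}) x y :
  theta \in irr N -> x != 0 -> y *: theta = rho x *: cfAut rho theta ->
  cfAut rho theta = theta.
Proof.
move=> irr_theta nz_x /(congr1 (fun phi => '[phi, cfAut rho theta])).
rewrite !cfdotZl !irr_dot_eq ?cfAut_irr // eqxx mulr1 eq_sym.
case: eqP => // _ /eqP; rewrite mulr0 eq_sym fmorph_eq0.
by rewrite (negbTE nz_x).
Qed.

(** Everything is moved by one automorphism, so that rho = nu'^-1 nu compares characters over tau.
    An equality on either side forces rho to fix tau or mu, hence both, and then [R_aut] and [R_eq]
    apply. *)
Let corr_eq chi xi psi eta : corr chi xi -> corr psi eta -> chi = psi <-> xi = eta.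
Proof.
case=> nu [chi0 [xi0 [R0 -> ->]]] [nu' [psi0 [eta0 [R0' -> ->]]]].
pose rho : {rmorphism algC -> algC} := algC_invaut nu' \o nu.
have autE (A : {group gT}) (phi : 'CF(A)) : cfAut rho phi = cfAut (algC_invaut nu')
  (cfAut nu phi).
  by apply/cfunP => x; rewrite !cfunE.
have eq_rho (A : {group gT}) (phi phi' : 'CF(A)) : cfAut nu phi = cfAut nu' phi' <->
  cfAut rho phi = phi'.
  by rewrite autE; split=> [-> | <-]; rewrite (cfAutK, cfAutVK).
have [x [nz_x Dchi Dxi]] := R_Res_neq0 R0.
have [y [nz_y Dpsi Deta]] := R_Res_neq0 R0'.
rewrite !eq_rho; split=> Drho.
  have rho_tau : cfAut rho tau = tau.
    apply: (@cfAut_scale_irr _ _ _ x y irr_tau nz_x).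
    by rewrite -Dpsi -Drho -cfAutRes Dchi cfAutZ.
  by apply/(R_eq (R_aut rho_tau R0) R0').
have rho_mu : cfAut rho mu = mu.
  apply: (@cfAut_scale_irr _ _ _ x y irr_mu nz_x).
  by rewrite -Deta -Drho -cfAutRes Dxi cfAutZ.
by apply/(R_eq (R_aut (proj2 (stab_aut rho) rho_mu) R0) R0').
Qed.

Let corr_aut nu chi xi : corr chi xi -> corr (cfAut nu chi) (cfAut nu xi).
Proof.
case=> nu' [chi0 [xi0 [R0 -> ->]]]; exists (nu \o nu'), chi0, xi0.
by split=> //; apply/cfunP => x; rewrite !cfunE.
Qed.

Let corr_over chi xi : corr chi xi -> IrrOver tau chi /\ IrrOver mu xi.
Proof.
case=> nu [chi0 [xi0 [R0 -> ->]]]; have [irr_chi irr_xi] := R_irr R0.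
have [x [nz_x Dchi Dxi]] := R_Res_neq0 R0.
split; apply/IrrOver_autP => //; exists nu.
  by exists chi0; rewrite Dchi cfdotZl irr_dot_eq // eqxx mulr1.
by exists xi0; rewrite Dxi cfdotZl irr_dot_eq // eqxx mulr1.
Qed.

Variable Z : {group gT}.
Hypotheses (sZU : Z \subset U) (sZK : Z \subset K).
Hypothesis Zscal : {in Z, forall z, mu z * tau 1%g = tau z * mu 1%g}.

(** Degrees compare through the common multiplicity x of [R_Res]. Equivariance and injectivity show
    that an automorphism fixes chi exactly when it fixes its image, which gives equal fields of
    values. *)
Lemma orbit_bijection : exists star : 'CF(G) -> 'CF(H),
  [/\ functions.set_bij (@IrrOver _ G K tau) (@IrrOver _ H U mu) star,
      forall (s : galQab) (chi : 'CF(G)),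
        IrrOver tau chi -> star (cfGal s chi) = cfGal s (star chi)
    & forall chi : 'CF(G), IrrOver tau chi ->
      let xi := star chi in
      [/\ chi 1%g / tau 1%g = xi 1%g / mu 1%g,
          forall z, cfField chi z <-> cfField xi z
        & '['Res[Z] chi, 'Res[Z] xi] != 0]].
Proof.
(* Outside the characters over the orbit the value 0 is a placeholder. *)
have total chi : exists xi, IrrOver tau chi -> corr chi xi.
  have [/IrrOver_autP | nI] := boolp.pselect (IrrOver tau chi); last by exists 0.
  case=> // nu [chi0 [irr0 nz0 ->]]; have [xi0 R0] := R_fun irr0 nz0.
  by exists (cfAut nu xi0) => _; exists nu, chi0, xi0.
have [star Dstar] := boolp.choice total; exists star.
have star_over chi : IrrOver tau chi -> IrrOver mu (star chi).
  by move=> chi_tau; have [] := corr_over (Dstar _ chi_tau).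
have aut_over nu (chi : 'CF(G)) : IrrOver tau chi -> IrrOver tau (cfAut nu chi).
  by move=> chi_tau; have [] := corr_over (corr_aut nu (Dstar _ chi_tau)).
have star_aut nu chi : IrrOver tau chi -> star (cfAut nu chi) = cfAut nu (star chi).
  move=> chi_tau; have c1 := Dstar _ (aut_over nu _ chi_tau).
  by have c2 := corr_aut nu (Dstar _ chi_tau); apply/(corr_eq c1 c2).
have star_inj chi psi : IrrOver tau chi -> IrrOver tau psi -> star chi = star psi ->
  chi = psi.
  by move=> chi_tau psi_tau /(corr_eq (Dstar _ chi_tau) (Dstar _ psi_tau)).
split.
- split=> [chi | chi psi | xi /IrrOver_autP[] // nu [xi0 [irr0 nz0 ->]]].
  + exact: star_over.
  + by rewrite !classical_sets.in_setE; apply: star_inj.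
  have [chi0 R0] := R_onto irr0 nz0; have c : corr (cfAut nu chi0) (cfAut nu xi0).
    by exists nu, chi0, xi0.
  have [chi_tau _] := corr_over c; exists (cfAut nu chi0) => //.
  by apply/(corr_eq (Dstar _ chi_tau) c).
- move=> s chi chi_tau; have [nu Dnu] := galQab_char gT s.
  have [irr_xi _] := star_over _ chi_tau; have [irr_chi _] := chi_tau.
  by rewrite !Dnu ?irrWchar // star_aut.
move=> chi chi_tau xi.
have [irr_xi _] : IrrOver mu xi by apply: star_over.
have [irr_chi _] := chi_tau; have [Nchi Nxi] := (irrWchar irr_chi, irrWchar irr_xi).
have [nu [chi0 [xi0 [R0 Dchi Dxi]]]] : corr chi xi by apply: Dstar.
have [x [nz_x Rchi Rxi]] := R_Res_neq0 R0.
have nz1 (N : {group gT}) (theta : 'CF(N)) : theta \in irr N -> theta 1%g != 0.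
  by move=> /irrP[i ->]; apply: irr1_neq0.
have [chi1 xi1] : chi0 1%g = x * tau 1%g /\ xi0 1%g = x * mu 1%g.
  by rewrite -(cfRes1 K) -(cfRes1 U xi0) Rchi Rxi !cfunE.
have [irr0 irr0'] := R_irr R0.
split.
- rewrite Dchi Dxi !cfAut_char1 ?irrWchar // chi1 xi1 !mulfK ?nz1 //.
- move=> z; split; apply: (cfField_sub (A := G)) => // rho.
    by move=> Drho; apply: star_inj; rewrite ?star_aut //; apply: aut_over.
  by move=> Drho; rewrite -star_aut // Drho.
(* On Z the functions tau and mu are proportional, so the inner product is a nonzero multiple of the
   norm of the restriction of chi. *)
have eqZ : 'Res[Z] xi = nu (mu 1%g / tau 1%g) *: 'Res[Z] chi.
  apply/cfun_inP => z Zz; have [Uz Kz] := (subsetP sZU z Zz, subsetP sZK z Zz).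
  have sZG := subset_trans sZK sKG; have sZH := subset_trans sZU sUH.
  rewrite cfunE !cfResE // Dchi Dxi !cfunE -rmorphM; congr (nu _).
  rewrite -(cfResE xi0 sUH Uz) -(cfResE chi0 sKG Kz) Rchi Rxi !cfunE.
  rewrite -[mu z](mulfK (nz1 _ _ irr_tau)) Zscal //.
  by rewrite [RHS]mulrCA [tau z * _]mulrC mulrAC.
rewrite eqZ cfdotZr mulf_neq0 //.
  by rewrite fmorph_eq0 fmorph_eq0 mulf_neq0 ?invr_eq0 ?nz1.
by rewrite cfnorm_eq0 cfRes_eq0 -?char1_eq0 ?nz1.
Qed.

End OrbitExtension.

(** * The inductive Feit condition for one character *)

Definition Aut_pair_stab (xT : finGroupType) (X U : {group xT}) (chi : 'CF(X))
    (a : {perm xT}) :=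
  [&& a \in Aut X, a @: U == U :> {set xT} & [forall x in X, chi (a x) == chi x]].

(* All that an invariant tau uses of the inductive Feit condition: Pa and Pa' *)
(* restrict the projective representations of the triples to the stabilizer   *)
(* of chi in Aut(X)_U, and only Galois elements (1, s) are needed.            *)
Record feit_data (xT : finGroupType) (X U : {group xT}) (chi : 'CF(X)) (mu : 'CF(U))
    d d' (D : xT -> 'M[algC]_d) (D' : xT -> 'M[algC]_d')
    (Pa : {perm xT} -> 'M[algC]_d) (Pa' : {perm xT} -> 'M[algC]_d') : Prop := FeitData {
  feit_proper : U \proper X;
  feit_selfnorm : 'N_X(U)%g = U;
  feit_intravariant : intravariant U X;
  feit_irr : mu \in irr U;
  feit_affords : affords D chi;
  feit_affords' : affords D' mu;
  feit_unit : forall a, Aut_pair_stab U chi a -> Pa a \in unitmx /\ Pa' a \in unitmx;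
  feit_intertwines : forall a, Aut_pair_stab U chi a ->
    {in X, forall x, D x *m Pa a = Pa a *m D (a x)};
  feit_mult : forall a b, Aut_pair_stab U chi a -> Aut_pair_stab U chi b ->
    exists c, [/\ c != 0, Pa a *m Pa b = c *: Pa (a * b)%g
                & Pa' a *m Pa' b = c *: Pa' (a * b)%g];
  feit_inner : forall u a, u \in U -> a \in Aut X -> {in X, forall x, a x = (x ^ u)%g} ->
    exists c, [/\ c != 0, Pa a = c *: D u & Pa' a = c *: D' u];
  feit_center : {in 'Z(X)%g, forall z, exists c, D z = c%:M /\ D' z = c%:M};
  feit_gal : forall nu, cfAut nu chi = chi <-> cfAut nu mu = mu;
  feit_aut : forall nu : {rmorphism algC -> algC}, cfAut nu chi = chi ->
    exists S S' (m : {perm xT} -> algC),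
    [/\ S \in unitmx /\ S' \in unitmx,
        {in X, forall x, map_mx nu (D x) = invmx S *m D x *m S},
        {in U, forall u, map_mx nu (D' u) = invmx S' *m D' u *m S'} &
        forall a, Aut_pair_stab U chi a ->
          [/\ m a != 0, map_mx nu (Pa a) = m a *: (invmx S *m Pa a *m S)
            & map_mx nu (Pa' a) = m a *: (invmx S' *m Pa' a *m S')]]
}.

Section ExtractFeit.

Variables (xT : finGroupType) (X U : {group xT}) (chi : 'CF(X)) (mu : 'CF(U)).
Hypotheses (irr_chi : chi \in irr X) (irr_mu : mu \in irr U).
Variable pUX : U \proper X.
Let sUX := proper_sub pUX.
Hypothesis NU : 'N_X(U)%g = U.
Hypothesis IU : intravariant U X.
Let Gam := AutStab X U.
Let GamChi := orbitStab Gam chi.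
Hypothesis eq_stab : forall a (s : galQab), a \in Gam ->
  (cfGal s (cfAutact a chi) = chi <-> cfGal s (cfAutact a mu) = mu).
Hypothesis ge_c : Gtriple_ge_c (sdAut X X GamChi) (sdChar (subxx X) chi)
                               (sdAut X U GamChi) (sdChar (proper_sub pUX) mu).

Let sd1 := sdpair1 [Aut X].
Let sd2 := sdpair2 [Aut X].
Let A1 := sdAut X X GamChi.
Let A2 := sdAut X U GamChi.
Let theta := sdChar (subxx X) chi.
Let phi := sdChar (proper_sub pUX) mu.

Let sd1M : {in X &, {morph sd1 : x y / (x * y)%g}}.
Proof. by move=> x y Xx Xy; rewrite /sd1 -morphM. Qed.

Let sd1V x : x \in X -> sd1 x^-1%g = (sd1 x)^-1%g.
Proof. by move=> Xx; rewrite /sd1 -morphV. Qed.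

Let sdact x a : x \in X -> a \in Aut X -> (sd1 x ^ sd2 a)%g = sd1 (a x).
Proof. by move=> Xx Aa; rewrite /sd1 /sd2 -sdpair_act. Qed.

Let sd1_mem x : x \in X -> sd1 x \in sdBase X X.
Proof. by move=> Xx; apply: mem_morphim. Qed.

Let sd1_memU u : u \in U -> sd1 u \in sdBase X U.
Proof. by move=> Uu; apply: mem_morphim => //; apply: (subsetP sUX). Qed.

Let thetaE x : x \in X -> theta (sd1 x) = chi x.
Proof. by move=> Xx; apply: (cfIsomE (restr_isom (subxx X) (isom_sdBase X))). Qed.

Let phiE u : u \in U -> phi (sd1 u) = mu u.
Proof. by move=> Uu; apply: (cfIsomE (restr_isom (proper_sub pUX) (isom_sdBase X))). Qed.

(** The Galois action commutes with automorphisms, so an automorphism fixing chi fixes every member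
    of its orbit. *)
Let stab_Gam a : Aut_pair_stab U chi a -> a \in GamChi.
Proof.
case/and3P=> Aa Ua /forall_inP chi_a; rewrite inE inE Aa Ua /=; apply/boolp.asboolP.
have acta : Defs.acts_on X a.
  by rewrite /Defs.acts_on Aut_morphic //=; apply/eqP;
    rewrite -[RHS](im_autm Aa) morphimEdom; apply: eq_imset.
have fix_gal s : cfAutact a (cfGal s chi) = cfGal s chi.
  apply/cfun_inP => y Xy; rewrite cfunElock acta !cfunE; congr (s _).
  have Xay : (a^-1)%g y \in X by apply: Aut_closed; rewrite ?groupV.
  by rewrite -(eqP (chi_a _ Xay)) permKV.
apply/classical_sets.seteqP; split=> [_ [_ [s _ <-] <-] | _ [s _ <-]].
  by rewrite fix_gal; exists s.
by exists (cfGal s chi); rewrite ?fix_gal //; exists s.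
Qed.

Let sd2_norm (V : {group xT}) a :
  V \subset X -> a \in Aut X -> a @: V = V :> {set xT} -> sd2 a \in 'N(sdBase X V)%g.
Proof.
move=> sVX Aa aV; apply/normP; rewrite /= /sd2 -sdpair_setact //.
by congr (_ @* _)%g; rewrite -[RHS]aV; apply: eq_imset.
Qed.

Let cfGal_id (Y : {group sdprod_by [Aut X]}) (psi : 'CF(Y)) :
  cfGal (galQab_of idfun) psi = psi.
Proof. by rewrite cfGal_of; apply/cfunP => y; rewrite cfunE. Qed.

Let AutX_im a : a \in Aut X -> a @: X = X :> {set xT}.
Proof. by move=> Aa; rewrite -[RHS](im_autm Aa) morphimEdom; apply: eq_imset. Qed.

Let theta_stab a : Aut_pair_stab U chi a -> (theta ^ sd2 a)%CF = theta.
Proof.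
move=> stab_a; have /and3P[Aa _ /forall_inP chi_a] := stab_a.
apply/cfun_inP => _ /morphimP[x _ Xx ->].
have Xax : (a^-1)%g x \in X by apply: Aut_closed; rewrite ?groupV.
rewrite cfConjgE ?sd2_norm ?AutX_im // /sd2 -morphV // -/(sd2 _) -/(sd1 _).
by rewrite sdact ?groupV // !thetaE // -(eqP (chi_a _ Xax)) permKV.
Qed.

Let sd2A V a : Aut_pair_stab U chi a -> sd2 a \in sdAut X V GamChi.
Proof.
move=> stab_a; have /and3P[Aa _ _] := stab_a.
apply: (subsetP (joing_subr _ _)); apply: mem_morphim => //; exact: stab_Gam.
Qed.

(** D and Pa are the projective representation P of the semidirect product, pulled back along its
    two factors; likewise D' and Pa' come from P'. *)
Lemma extract_feit : exists d d' D D' Pa Pa',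
  @feit_data xT X U chi mu d d' D D' Pa Pa'.
Proof.
case: ge_c => _ [sA21 _ _ sCA2] fix_iff [n [n' [P [P' [al [al' /=]]]]]].
rewrite -/A1 -/A2 -/theta -/phi in fix_iff *.
set GT := 'I_A1[theta]%G; set HT := 'I_A2[phi]%G.
case=> -[[uP PM] [nGT irr_theta _ [rN rNP affr] Pgx] _ _].
case=> [[uP' PM'] [nHT irr_phi _ [rM rMP affr'] Pgx'] _ _] eq_al eq_c eq_mu.
have sd1G x : x \in X -> sd1 x \in GT.
  by move=> Xx; apply: (subsetP (normal_sub nGT)); apply: sd1_mem.
have sd1H u : u \in U -> sd1 u \in HT.
  by move=> Uu; apply: (subsetP (normal_sub nHT)); apply: sd1_memU.
have sd2G a : Aut_pair_stab U chi a -> sd2 a \in GT.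
  move=> stab_a; have /and3P[Aa _ _] := stab_a.
  by rewrite inE sd2A //= inE sd2_norm ?AutX_im //= theta_stab.
have sd2H a : Aut_pair_stab U chi a -> sd2 a \in HT.
  move=> stab_a; have /and3P[Aa /eqP Ua _] := stab_a.
  rewrite inE sd2A //= inE sd2_norm //=; apply/eqP.
  (* With the trivial Galois element, equality of stabilizers says that [sd2 a] fixes [phi] because
     it fixes [theta]. *)
  have := fix_iff (sd2 a) (galQab_of idfun) (sd2A U stab_a).
  by rewrite /fixed_by !cfGal_id; case=> -> //; apply: theta_stab.
have affD : affords (fun x => P (sd1 x)) chi.
  split=> [|x Xx]; last by rewrite -rNP ?sd1_mem // -thetaE // -affr cfunE sd1_mem.
  split=> [|x y Xx Xy]; first by rewrite /sd1 morph1 -rNP ?group1 // repr_mx1.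
  by rewrite sd1M // -!rNP ?groupM ?sd1_mem // repr_mxM ?sd1_mem.
have affD' : affords (fun u => P' (sd1 u)) mu.
  split=> [|x Xx]; last by rewrite -rMP ?sd1_memU // -phiE // -affr' cfunE sd1_memU.
  split=> [|x y Xx Xy]; first by rewrite /sd1 morph1 -rMP ?group1 // repr_mx1.
  by rewrite sd1M ?(subsetP sUX) // -!rMP ?groupM ?sd1_memU // repr_mxM ?sd1_memU.
have [n_gt0 _] := affords_irr_cent affD irr_chi.
exists n, n', (fun x => P (sd1 x)), (fun u => P' (sd1 u)), (fun a => P (sd2 a)), (fun a
  => P' (sd2 a)).
split=> //.
- by move=> a stab_a; rewrite uP ?sd2G // uP' ?sd2H.
- move=> a stab_a x Xx; have /and3P[Aa _ _] := stab_a.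
  have Xax : a x \in X by apply: Aut_closed.
  have [_ <-] := Pgx _ _ (sd2G a stab_a) (sd1_mem Xx).
  have [<- _] := Pgx _ _ (sd2G a stab_a) (sd1_mem Xax).
  by rewrite conjgC sdact.
- move=> a b stab_a stab_b; have [/and3P[Aa _ _] /and3P[Ab _ _]] := (stab_a, stab_b).
  have [nz_al PaPb] := PM _ _ (sd2G a stab_a) (sd2G b stab_b).
  have [_ PaPb'] := PM' _ _ (sd2H a stab_a) (sd2H b stab_b).
  exists (al (sd2 a) (sd2 b)); rewrite PaPb PaPb' -eq_al ?sd2H //.
  by rewrite /sd2 -morphM.
- move=> u a Uu Aa Da; have Xu := subsetP sUX u Uu.
  have stab_a : Aut_pair_stab U chi a.
    apply/and3P; split=> //.
      rewrite eqEcard card_imset ?leqnn ?andbT; last exact: perm_inj.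
      by apply/subsetP => _ /imsetP[v Uv ->]; rewrite Da ?groupJ // (subsetP sUX).
    by apply/forall_inP => x Xx; rewrite Da // cfunJ.
  (* If a is conjugation by u, then [sd1 u] and [sd2 a] act alike on X; so c centralizes the base
     group, and there P and P' take the same scalar. *)
  pose c := ((sd1 u)^-1 * sd2 a)%g.
  have Da2 : sd2 a = (sd1 u * c)%g by rewrite mulKVg.
  have GTc : c \in GT by rewrite groupM ?groupV ?sd1G ?sd2G.
  have HTc : c \in HT by rewrite groupM ?groupV ?sd1H ?sd2H.
  have Cc : c \in 'C_A1(sdBase X X)%g.
    rewrite inE; have /setIP[-> _] /= := GTc; apply/centP => _ /morphimP[x _ Xx ->].
    apply/commute_sym/commgP/conjg_fixP; rewrite -/(sd1 x) conjgM.
    have Xxu : (x ^ u^-1)%g \in X by rewrite groupJ ?groupV.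
    have -> : (sd1 x ^ (sd1 u)^-1 = sd1 (x ^ u^-1))%g.
      by rewrite -sd1V // /sd1 -morphJ ?groupV.
    by rewrite sdact // Da // conjgKV.
  have [z [Pc P'c]] := eq_c c Cc; exists z; split.
  + apply: contraTneq (uP _ GTc) => z0; rewrite Pc z0 raddf0 unitmxE.
    by rewrite -(prednK n_gt0) det0 unitr0.
  + have [_ PE] := Pgx _ _ GTc (sd1_mem Xu).
    by rewrite Da2 PE Pc mul_mx_scalar.
  have [_ PE] := Pgx' _ _ HTc (sd1_memU Uu).
  by rewrite Da2 PE P'c mul_mx_scalar.
- move=> z /setIP[Xz Cz]; apply: eq_c; rewrite inE; have /setIP[-> _] /= := sd1G z Xz.
  apply/centP => _ /morphimP[x _ Xx ->]; rewrite -/(sd1 x) /commute -!sd1M //.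
  by rewrite (centP Cz).
- move=> nu; have Gam1 : 1%g \in Gam.
    by rewrite inE group1 /= (eq_imset _ (@perm1 _)) imset_id.
  have := eq_stab (galQab_of nu) Gam1; rewrite !cfGal_of.
  have cfAutact1 (Y : {group xT}) (psi : 'CF(Y)) : cfAutact 1%g psi = psi.
    by apply/cfunP => y; rewrite cfunElock invg1 perm1 if_same.
  by rewrite !cfAutact1.
move=> nu nu_chi.
have fix1 : fixed_by theta 1%g (galQab_of nu).
  rewrite /fixed_by cfConjgJ1 cfGal_of; apply/cfun_inP => _ /morphimP[x _ Xx ->].
  by rewrite -/(sd1 x) cfunE thetaE // -{2}nu_chi cfunE.
have [f [f' [[nz_f fN f1 [Q uQ fQ]] [_ f'N f'1 [Q' uQ' fQ']] eq_f]]] := eq_mu _ _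
  (group1 _) fix1.
exists Q, Q', (fun a => f (sd2 a)); split=> //.
(* On the base group [f] equals its value at 1, so the factor disappears. *)
- move=> x Xx; have := fQ _ (sd1G x Xx); rewrite mul1g invg1 mulg1.
  by rewrite -[sd1 x]mul1g fN ?group1 ?sd1_mem // f1 scale1r mul1g.
- move=> u Uu; have := fQ' _ (sd1H u Uu); rewrite mul1g invg1 mulg1.
  by rewrite -[sd1 u]mul1g f'N ?group1 ?sd1_memU // f'1 scale1r mul1g.
move=> a stab_a; split; first by apply/nz_f/sd2G.
  by have := fQ _ (sd2G a stab_a); rewrite mul1g invg1 mulg1.
by have := fQ' _ (sd2H a stab_a); rewrite mul1g invg1 mulg1 -eq_f // sd2H.
Qed.

End ExtractFeit.

(** * Components *)

Local Open Scope group_scope.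

Section PerfectMorphisms.

Variables (xT gT : finGroupType) (X : {group xT}).
Hypothesis perfX : X^`(1) = X.

Lemma perfect_morphim_abelian (f : {morphism X >-> gT}) :
  abelian (f @* X) -> {in X, forall x, f x = 1}.
Proof.
move=> /derG1P abX x Xx; have fX1 : f @* X = 1.
  by have := morphim_der f 1 (subxx X); rewrite perfX abX.
by have := mem_morphim f Xx Xx; rewrite fX1 => /set1gP.
Qed.

(** The commutation hypotheses make x |-> (f x)^-1 h x a morphism with abelian image, trivial
    because X is perfect. *)
Lemma perfect_morphism_eq (f h : {morphism X >-> gT}) :
    {in X &, forall x y, commute ((f x)^-1 * h x) (f y)} ->
    {in X &, forall x y, commute ((f x)^-1 * h x) (h y)} ->
  {in X, f =1 h}.
Proof.
move=> cf ch; pose z x := (f x)^-1 * h x.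
have zM : {in X &, {morph z : x y / x * y}}.
  move=> x y Xx Xy; rewrite /z !morphM // invMg [RHS]mulgA.
  by rewrite (commuteV (cf x y Xx Xy)) !mulgA.
have z1 : {in X, forall x, z x = 1}.
  apply: (perfect_morphim_abelian (f := Morphism zM)).
  apply/centsP => _ /morphimP[x _ Xx ->] _ /morphimP[y _ Xy ->] /=.
  by apply: commuteM; [apply: commuteV; apply: cf | apply: ch].
by move=> x Xx; apply/eqP; rewrite eq_mulVg1; apply/eqP; apply: z1.
Qed.

End PerfectMorphisms.

Lemma simple_nonabelian_center (sT : finGroupType) (S : {group sT}) :
  simple S -> ~~ abelian S -> 'Z(S) = 1.
Proof.
move=> /simpleP[_ simS] nabS; case: (simS 'Z(S)%G (center_normal S)) => //= ZS.
by case/negP: nabS; apply/center_idP.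
Qed.

Lemma dfung1E (xT : finGroupType) (I : finType) i j (b : xT) :
  @dfung1 I (fun=> xT) i b j = if i == j then b else 1.
Proof. by have [<- | ne_ij] := eqVneq i j; rewrite (dfung1_id, dfung1_dflt). Qed.

Section CommutingFamily.

Variables (xT gT : finGroupType) (X : {group xT}) (I : finType) (f : I -> xT -> gT).
Hypothesis fM : forall i, {in X &, {morph f i : x y / x * y}}.
Hypothesis fC : forall i j, i != j -> {in X &, forall x y, commute (f i x) (f j y)}.

Local Notation XI := (setXn (fun _ : I => gval X)).

Definition prodf (x : {dffun forall _ : I, xT}) := \prod_i f i (x i).

Lemma commuting_f1 i : f i 1 = 1.
Proof. by apply: (mulgI (f i 1)); rewrite -fM ?group1 // !mulg1. Qed.

Lemma prodfM : {in XI &, {morph prodf : x y / x * y}}.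
Proof.
move=> x y /setXnP Xx /setXnP Xy; rewrite /prodf.
elim: (index_enum I) (index_enum_uniq I) => [|i r IHr] /=;
  first by rewrite !big_nil mulg1.
case/andP=> r'i /IHr{}IHr; rewrite !big_cons IHr mulg_ffun fM // -!mulgA; congr (_ * _).
rewrite !mulgA; congr (_ * _); apply: commute_sym.
elim: r r'i {IHr} => [|j r IHr]; first by rewrite big_nil => _;
  apply/commute_sym/commute1.
rewrite inE negb_or big_cons => /andP[ne_ij /IHr cr].
by apply/commute_sym/commuteM; [apply: fC | apply: commute_sym].
Qed.

Lemma prodf1 i b : prodf (@dfung1 I (fun=> xT) i b) = f i b.
Proof.
rewrite /prodf (big_only1 i) ?dfung1_id // => j ne_ij _.
by rewrite dfung1_dflt 1?eq_sym // commuting_f1.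
Qed.

(** Products in a non-commutative group cannot simply be reindexed. The reordering is done in the
    direct power, where it is checked coordinate by coordinate, and is carried over by the morphism
    [prodf]. *)
Lemma prodf_perm (p : {perm I}) (b : I -> xT) : (forall i, b i \in X) ->
  \prod_i f (p i) (b i) = prodf [ffun j => b ((p^-1)%g j)].
Proof.
move=> Xb; pose e i := @dfung1 I (fun=> xT) (p i) (b i).
have Xe i : e i \in XI by apply/setXnP => j; rewrite ffunE; case: dfwithP => // k _;
  apply: group1.
have -> : [ffun j => b ((p^-1)%g j)] = \prod_i e i.
  apply/ffunP => j; rewrite prodg_ffun ffunE (big_only1 ((p^-1)%g j)) //.
    by rewrite /e dfung1E permKV eqxx.
  by move=> i ne_i _; rewrite /e dfung1E (canF_eq (permK p)) (negbTE ne_i).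
have [Xp ->] : \prod_i e i \in XI /\ prodf (\prod_i e i) = \prod_i f (p i) (b i).
  elim/big_ind2: _ => [|x1 x2 y1 y2 [X1 <-] [X2 <-]|i _].
  - split; first exact: group1.
    by rewrite /prodf big1 // => i _; rewrite oneg_ffun commuting_f1.
  - by split; [apply: groupM | rewrite prodfM].
  by split; [apply: Xe | rewrite /e prodf1].
by [].
Qed.

Lemma prodf_conj (g : gT) (p : {perm I}) (a : I -> {perm xT}) x :
    (forall i, a i \in Aut X) -> (forall i y, y \in X -> f i y ^ g = f (p i) (a i y)) ->
    x \in XI ->
  prodf x ^ g = prodf [ffun j => a ((p^-1)%g j) (x ((p^-1)%g j))].
Proof.
move=> Aa fg /setXnP Xx; rewrite /prodf.
rewrite (big_morph (fun u => u ^ g) (fun u v => conjMg u v g) (conj1g g)).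
rewrite (eq_bigr (fun i => f (p i) (a i (x i)))) => [|i _]; last exact: fg.
rewrite (prodf_perm p (fun i => Aut_closed (Aa i) (Xx i))).
by apply: eq_bigr => j _; rewrite !ffunE.
Qed.

End CommutingFamily.

(** [comp_cent] expresses that each f i has central kernel modulo the centre of its image. In
    [comp_trans] no automorphism of X intervenes: the parametrizations themselves are conjugate, so
    the same chi appears on every component. *)
Record components (gT xT : finGroupType) (G K : {group gT}) (X : {group xT})
    (I : finType) (f : I -> xT -> gT) : Prop := Components {
  comp_sub : forall i x, x \in X -> f i x \in K;
  comp_morph : forall i, {in X &, {morph f i : x y / x * y}};
  comp_commute : forall i j, i != j -> {in X &, forall x y, commute (f i x) (f j y)};
  comp_gen : forall k, k \in K -> exists z x,
    [/\ z \in 'Z(K), x \in setXn (fun _ : I => gval X) & k = z * prodf f x];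
  comp_conj : forall g, g \in G -> exists (p : {perm I}) (a : I -> {perm xT}),
    (forall i, a i \in Aut X) /\ forall i x, x \in X -> f i x ^ g = f (p i) (a i x);
  comp_cent : forall i y, y \in X -> (forall x, x \in X -> commute (f i y) (f i x)) ->
    y \in 'Z(X);
  comp_trans : forall i j, exists2 g, g \in G & forall x, x \in X -> f j x = f i x ^ g
}.

(** * Construction of the components from the universal property *)

Section Components.

Variables (gT sT xT : finGroupType) (G K : {group gT}) (S : {group sT}) (X : {group xT}).
Variable n : nat.
Hypotheses (nKG : K <| G) (sZG : 'Z(K) \subset 'Z(G)).
Hypothesis minKZ : minnormal (K / 'Z(K)) (G / 'Z(K)).
Hypothesis isoKZ : (K / 'Z(K)) \isog setXn (fun _ : 'I_n => gval S).
Hypotheses (simS : simple S) (nabS : ~~ abelian S).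
Hypothesis perfX : X^`(1) = X.
Variable pi : {morphism X >-> sT}.
Hypotheses (im_pi : pi @* X = S) (ker_pi : 'ker pi \subset 'Z(X)).
Hypothesis lift : forall (eT : finGroupType) (E : {group eT}) (rho : {morphism E >-> sT}),
  rho @* E = S -> 'ker rho \subset 'Z(E) ->
  exists f : {morphism X >-> eT}, f @* X \subset E /\ {in X, forall x, rho (f x) = pi x}.

Let Z := 'Z(K)%G.
Let sKG : K \subset G := normal_sub nKG.
Let sZK : Z \subset K := center_sub K.
Let cZG z g : z \in Z -> g \in G -> z ^ g = z.
Proof. by move=> /(subsetP sZG)/setIP[_ /centP cz] Gg; apply/conjg_fixP/commgP/cz. Qed.

Lemma quotient_proj : exists q : {morphism K >-> {dffun forall _ : 'I_n, sT}},
  'ker q = Z /\ q @* K = setXn (fun _ : 'I_n => gval S).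
Proof.
have /isogP[h injh imh] := isoKZ.
have nZK : K \subset 'N(Z) by apply: gFnorm.
have qM : {in K &, {morph (fun k => h (coset Z k)) : x y / x * y}}.
  move=> x y Kx Ky; have [Nx Ny] := (subsetP nZK x Kx, subsetP nZK y Ky).
  by rewrite -morphM ?mem_quotient // -coset_morphM.
exists (Morphism qM); split; last first.
  rewrite -imh; apply/setP => s;
    apply/morphimP/morphimP => [[k _ Kk ->] | [_ _ /morphimP[k _ Kk ->] ->]].
    by exists (coset Z k); rewrite ?mem_quotient.
  by exists k.
apply/setP => k; apply/idP/idP => [/morphpreP[Kk /set1P /= hk1] | Zk]; last first.
  by apply/morphpreP; rewrite (subsetP sZK) //= coset_id // morph1 set11.
apply: coset_idr; first exact: (subsetP nZK).
by apply: (injmP injh); rewrite ?group1 ?mem_quotient ?morph1.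
Qed.

Variable q : {morphism K >-> {dffun forall _ : 'I_n, sT}}.
Hypotheses (ker_q : 'ker q = Z) (im_q : q @* K = setXn (fun _ : 'I_n => gval S)).
Variable i0 : 'I_n.

Local Notation df := (@dfung1 'I_n (fun=> sT) i0).
Local Notation dfm := (@dfung1_morphism 'I_n (fun=> sT) i0).
(** The preimage in K of one factor S. Through its coordinate [rho] it is a central extension of S,
    to which the universal property applies. *)
Let K0 := (q @*^-1 (@set1gXn 'I_n (fun=> sT) i0 S))%G.

Let K0P k : reflect (k \in K /\ exists2 s, s \in S & q k = df s) (k \in K0).
Proof.
apply: (iffP morphpreP) => [[Kk /set1gXnP[s Ss Dq]] | [Kk [s Ss Dq]]].
  by split=> //; exists s.
by split=> //; apply/set1gXnP; exists s.
Qed.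

Let sK0K : K0 \subset K. Proof. by apply/subsetP => k /K0P[]. Qed.

Let q_S k i : k \in K -> q k i \in S.
Proof. by move=> Kk; have := mem_morphim q Kk Kk; rewrite im_q => /setXnP/(_ i). Qed.

Let nK0K : K0 <| K.
Proof.
rewrite /normal sK0K; apply/subsetP => g Kg; rewrite inE.
apply/subsetP => _ /imsetP[k /K0P[Kk [s Ss Dq]] ->]; apply/K0P; split;
  first by rewrite groupJ.
exists (s ^ q g i0); first by rewrite groupJ ?q_S.
rewrite morphJ // Dq; apply/ffunP => j; rewrite /conjg !(mulg_ffun, invg_ffun).
have [<- | ne_j] := eqVneq i0 j; first by rewrite !dfung1_id.
by rewrite !dfung1_dflt // mul1g mulVg.
Qed.

Let q1P k : k \in K -> q k = 1 -> k \in Z.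
Proof. by move=> Kk qk1; rewrite -ker_q; apply/morphpreP; rewrite qk1 set11. Qed.

Let qZ k : k \in Z -> q k = 1.
Proof. by rewrite -ker_q => /morphpreP[_ /set1P]. Qed.

Let sZK0 : Z \subset K0.
Proof.
apply/subsetP => z Zz; apply/K0P; split; first exact: (subsetP sZK).
by exists 1; rewrite ?group1 // qZ // -[RHS]/(dfm 1) morph1.
Qed.

Let rhoM : {in K0 &, {morph (fun k => q k i0) : x y / x * y}}.
Proof.
by move=> x y /(subsetP sK0K) Kx /(subsetP sK0K) Ky; rewrite morphM // mulg_ffun.
Qed.
Let rho := Morphism rhoM.

Let rho1 k : k \in K0 -> rho k = 1 -> k \in Z.
Proof.
move=> /K0P[Kk [s _ Dq]]; rewrite /= Dq dfung1_id => s1; apply: q1P => //.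
by rewrite Dq s1 -[LHS]/(dfm 1) morph1.
Qed.

Lemma rho_im : rho @* K0 = S.
Proof.
apply/eqP; rewrite eqEsubset; apply/andP; split; apply/subsetP => s.
  by case/morphimP => k _ /(subsetP sK0K) Kk ->; apply: q_S.
move=> Ss; have : df s \in q @* K.
  by rewrite im_q; apply/setXnP => j; rewrite ffunE; case: dfwithP.
case/morphimP => k _ Kk Dq; have K0k : k \in K0 by apply/K0P; split=> //; exists s.
have -> : s = rho k by rewrite /= -Dq dfung1_id.
exact: mem_morphim.
Qed.

Lemma rho_ker : 'ker rho \subset 'Z(K0).
Proof.
apply/subsetP => k /morphpreP[K0k /set1P rk1].
have /setIP[_ /centP cKk] := rho1 K0k rk1.
by rewrite inE K0k; apply/centP => x /(subsetP sK0K); apply: cKk.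
Qed.

Lemma first_component : exists f0 : {morphism X >-> gT},
  f0 @* X \subset K0 /\ {in X, forall x, rho (f0 x) = pi x}.
Proof. exact: lift rho_im rho_ker. Qed.

Variable f0 : {morphism X >-> gT}.
Hypotheses (f0K0 : f0 @* X \subset K0) (rho_f0 : {in X, forall x, rho (f0 x) = pi x}).
Let L := (f0 @* X)%G.

Let f0_K0 x : x \in X -> f0 x \in K0.
Proof. by move=> Xx; apply: (subsetP f0K0); apply: mem_morphim. Qed.

Let f0_G x : x \in X -> f0 x \in G.
Proof. by move/f0_K0/(subsetP sK0K)/(subsetP sKG). Qed.

Let sLK : L \subset K := subset_trans f0K0 sK0K.
Let sLG : L \subset G := subset_trans sLK sKG.

Let cLZ : Z \subset 'C(L).
Proof. by rewrite (subset_trans sZG) // (subset_trans (subsetIr _ _)) // centS. Qed.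

Let defK0 : L \* Z = K0.
Proof.
rewrite cprodE //; apply/eqP; rewrite eqEsubset mul_subG //=; apply/subsetP => k K0k.
have : rho k \in pi @* X by rewrite im_pi -rho_im; apply: mem_morphim.
case/morphimP => x _ Xx Dk; apply/mulsgP; exists (f0 x) ((f0 x)^-1 * k);
  rewrite ?mulKVg //.
  exact: mem_morphim.
apply: rho1; first by rewrite groupM ?groupV ?f0_K0.
by rewrite morphM ?groupV ?f0_K0 // morphV ?f0_K0 // rho_f0 // Dk mulVg.
Qed.

Let perfL : L^`(1) = L.
Proof. by have := morphim_der f0 1 (subxx X); rewrite perfX => /esym. Qed.

(** K0 is the central product of the perfect group L and Z. Thus K0 determines L, and whatever
    normalizes K0 normalizes L. *)
Let derK0 : K0^`(1) = L.
Proof.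
have /cprodP[_ <- _] := der_cprod 1 defK0; rewrite perfL.
by have /derG1P -> := center_abelian K; rewrite mulg1.
Qed.

Let f0_ker x : x \in X -> f0 x \in Z -> x \in 'Z(X).
Proof.
move=> Xx /qZ f1; apply: (subsetP ker_pi); apply/morphpreP; split=> //.
by apply/set1P; rewrite -rho_f0 //= f1 oneg_ffun.
Qed.

(** The image in S of the intersection of K0 and K0 :^ w is normal, hence S or 1. If it is S, then
    K0 = K0 :^ w and L is fixed. Otherwise [L, L :^ w] lies in the central subgroup Z, and the three
    subgroups lemma with L perfect makes it trivial. *)
Let LJ_cent w : w \in G -> L :^ w != L -> L :^ w \subset 'C(L).
Proof.
move=> Gw ne_Lw; have Kw : K :^ w = K by apply: normP; apply: (subsetP (normal_norm nKG)).
have nK0wK : K0 :^ w <| K by rewrite -[X in _ <| X]Kw normalJ.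
pose J := (K0 :&: K0 :^ w)%G.
have nJS : rho @* J <| S by rewrite -rho_im morphim_normal // (normalGI sK0K nK0wK).
have [_ /(_ _ nJS)[] /= imJ] := simpleP _ simS; last first.
  case/negP: ne_Lw; have sK0w : K0 \subset K0 :^ w.
    apply/subsetP => k K0k; have : rho k \in rho @* J.
      by rewrite imJ -rho_im mem_morphim.
    case/morphimP => j K0j /setIP[_ K0wj] eq_rho; rewrite -(mulKVg j k) groupM //.
    have Zjk : j^-1 * k \in Z.
      by apply: rho1; rewrite ?groupM ?groupV // morphM ?groupV // morphV // eq_rho mulVg.
    by rewrite -(cZG Zjk Gw) memJ_conjg (subsetP sZK0).
  have eqK0 : K0 :^ w = K0 by apply/esym/eqP; rewrite eqEcard sK0w cardJg /=.
  by rewrite -derK0 -derJ eqK0.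
have sJZ : J \subset Z.
  apply/subsetP => k Jk; have /setIP[K0k _] := Jk.
  by apply: rho1 => //; apply/set1gP; rewrite -imJ mem_morphim.
have sLwZ : [~: L, L :^ w] \subset Z.
  apply: subset_trans sJZ; apply: subset_trans (commgSS f0K0 (_ : _ \subset K0 :^ w)) _.
    by rewrite conjSg.
  rewrite subsetI commg_subl commg_subr; apply/andP; split.
    exact: subset_trans (normal_sub nK0wK) (normal_norm nK0K).
  exact: subset_trans sK0K (normal_norm nK0wK).
have L3 : [~: L, L, (L :^ w)%G] = 1.
  apply: three_subgroup; apply/commG1P; last by rewrite commGC; apply: subset_trans cLZ.
  exact: subset_trans cLZ.
by rewrite centsC; apply/commG1P; rewrite -[RHS]L3 -derg1 perfL.
Qed.

(** Twisting by w gives a second central covering [psi] of S by X. Lifting pi through it yields b :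
    X -> X, surjective since X = b(X) Z(X) is perfect. Then f0 and the twist of f0 o b agree modulo
    Z, hence agree by [perfect_morphism_eq]. *)
Let f0_aut w : w \in G -> L :^ w = L ->
  exists2 a, a \in Aut X & {in X, forall x, f0 x ^ w = f0 (a x)}.
Proof.
move=> Gw Lw; have L_w x : x \in X -> f0 x ^ w^-1 \in L.
  by move=> Xx; rewrite -mem_conjg Lw mem_morphim.
have K0_w x : x \in X -> f0 x ^ w^-1 \in K0 by move=> Xx; apply: (subsetP f0K0);
  apply: L_w.
have psiM : {in X &, {morph (fun x => rho (f0 x ^ w^-1)) : x y / x * y}}.
  by move=> x y Xx Xy; rewrite /= -[RHS]rhoM ?K0_w // morphM // conjMg.
pose psi := Morphism psiM.
have im_psi : psi @* X = S.
  apply/eqP; rewrite eqEsubset; apply/andP; split; apply/subsetP => s.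
    by case/morphimP => x _ Xx ->; rewrite -rho_im /= (mem_morphim rho) ?K0_w.
  rewrite -im_pi => /morphimP[x _ Xx ->]; rewrite -rho_f0 //.
  have : f0 x ^ w \in L by rewrite -Lw memJ_conjg mem_morphim.
  case/morphimP => y _ Xy Dy; have -> : rho (f0 x) = psi y by rewrite /= -Dy conjgK.
  exact: mem_morphim.
have ker_psi : 'ker psi \subset 'Z(X).
  apply/subsetP => x /morphpreP[Xx /set1P psi1]; apply: f0_ker => //.
  have Zfx : f0 x ^ w^-1 \in Z by apply: rho1 psi1; apply: K0_w.
  by rewrite -(conjgKV w (f0 x)) cZG.
have [b [sbX psi_b]] := lift im_psi ker_psi.
have b_X x : x \in X -> b x \in X by move=> Xx; apply: (subsetP sbX); apply: mem_morphim.
have cprodX : b @* X \* 'Z(X) = X.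
  rewrite cprodE; last by rewrite (subset_trans (subsetIr _ _)) ?centS.
  apply/eqP; rewrite eqEsubset mul_subG ?center_sub //=; apply/subsetP => y Xy.
  have : psi y \in pi @* X by rewrite im_pi -im_psi mem_morphim.
  case/morphimP => x _ Xx Dpsi; apply/mulsgP; exists (b x) ((b x)^-1 * y);
    rewrite ?mulKVg //.
    exact: mem_morphim.
  apply: (subsetP ker_psi); apply/morphpreP; split; first by rewrite groupM ?groupV ?b_X.
  apply/set1P; rewrite morphM ?groupV ?b_X // morphV ?b_X //.
  by rewrite psi_b // Dpsi mulVg.
have imb : b @* X = X.
  apply/eqP; rewrite eqEsubset sbX -{1}perfX.
  have /cprodP[_ <- _] := der_cprod 1 cprodX.
  by have /derG1P -> := center_abelian X; rewrite mulg1 der_sub.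
have injb : 'injm b by rewrite -card_im_injm imb.
exists (aut injb imb); first exact: Aut_aut.
have bwM : {in X &, {morph (fun x => f0 (b x) ^ w^-1) : x y / x * y}}.
  by move=> x y Xx Xy; rewrite !morphM ?b_X // conjMg.
have eq_fb : {in X, f0 =1 Morphism bwM}.
  have Zdiff x : x \in X -> (f0 x)^-1 * f0 (b x) ^ w^-1 \in Z.
    move=> Xx; have XbX := b_X x Xx; apply: rho1.
      by rewrite groupM ?groupV ?f0_K0 ?K0_w.
    rewrite morphM ?groupV ?f0_K0 ?K0_w // morphV ?f0_K0 //.
    by rewrite rho_f0 // -psi_b // mulVg.
  have cdiff x g : x \in X -> g \in G -> commute ((f0 x)^-1 * f0 (b x) ^ w^-1) g.
    by move=> /Zdiff Zx Gg; apply/commgP/conjg_fixP; apply: cZG.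
  apply: perfect_morphism_eq => // x y Xx Xy; apply: cdiff => //=.
    exact: f0_G.
  by rewrite groupJ ?groupV ?f0_G ?b_X.
by move=> x Xx; rewrite autE // eq_fb //= conjgKV.
Qed.

(** Indexing by the G-conjugates of L makes the action transitive by construction. *)
Let I := ({A : {set gT} | A \in (L :^: G)} : finType).

Lemma components_exist_from_first : exists (J : finType) (f : J -> xT -> gT),
  (0 < #|J|)%N /\ components G K X f.
Proof.
have gP (i : I) : exists g, g \in G /\ val i = L :^ g.
  by have /imsetP[g Gg Di] := valP i; exists g.
have [g_ gE] := fin_all_exists gP.
have Gg i : g_ i \in G by have [] := gE i.
have Dg i : val i = L :^ g_ i by have [] := gE i.
have memLG g : g \in G -> L :^ g \in L :^: G by move=> *; apply: imset_f.
pose f i x := f0 x ^ g_ i.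
have fL i x : x \in X -> f i x \in L :^ g_ i by move=> Xx; rewrite memJ_conjg mem_morphim.
have fK i x : x \in X -> f i x \in K.
  move=> Xx; rewrite memJ_norm ?(subsetP (normal_norm nKG)) //.
  exact/(subsetP sK0K)/f0_K0.
have fM i : {in X &, {morph f i : x y / x * y}}.
  by move=> x y Xx Xy; rewrite /f morphM // conjMg.
have fC i j : i != j -> {in X &, forall x y, commute (f i x) (f j y)}.
  move=> ne_ij x y Xx Xy; pose w := g_ j * (g_ i)^-1.
  have Gw : w \in G by rewrite groupM ?groupV.
  have neL : L :^ w != L.
    apply: contra ne_ij => /eqP Lw; rewrite -val_eqE /= !Dg -{1}Lw /w conjsgM conjsgKV.
    by [].
  have /centsP cL := LJ_cent Gw neL.
  have cxy : commute (f0 x) (f0 y ^ w).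
    by apply/commute_sym/cL; rewrite ?memJ_conjg mem_morphim.
  have -> : f j y = (f0 y ^ w) ^ g_ i by rewrite /w conjgM conjgKV.
  by rewrite /commute /f -!conjMg cxy.
have f_conj g : g \in G -> exists (p : {perm I}) (a : I -> {perm xT}),
    (forall i, a i \in Aut X) /\ forall i x, x \in X -> f i x ^ g = f (p i) (a i x).
  move=> Gg'; have Lp (i : I) : (val i :^ g) \in L :^: G.
    by rewrite Dg -conjsgM memLG // groupM.
  pose p0 i : I := Sub (val i :^ g) (Lp i).
  have p0_inj : injective p0.
    by move=> i j /(congr1 val) /= /conjsg_inj eq_ij; apply: val_inj.
  pose p := perm p0_inj.
  have aP i : exists a, a \in Aut X /\ {in X, forall x, f i x ^ g = f (p i) (a x)}.
    (* [w] leads from L to component i, along g, and back from component p i, so it normalizes L and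
       [f0_aut] applies. *)
    pose w := g_ i * g * (g_ (p i))^-1.
    have Gw : w \in G by rewrite !groupM ?groupV.
    have Lw : L :^ w = L.
      rewrite /w !conjsgM -Dg -[val i :^ g]/(val (p0 i)) -(permE p0_inj i) Dg.
      by rewrite -conjsgM mulgV conjsg1.
    have [a Aa fa] := f0_aut Gw Lw; exists a; split=> // x Xx.
    by rewrite /f -fa // /w -!conjgM mulgKV.
  have [a aE] := fin_all_exists aP; exists p, a.
  by split=> i; have [] := aE i.
exists I, f; split.
  by apply/card_gt0P; exists (Sub (L :^ 1) (memLG 1 (group1 G))).
split=> //.
- pose pf := Morphism (prodfM fM fC); pose XI := setXn_group (fun _ : I => X).
  pose M := (pf @* XI)%G; have Mf x : x \in XI -> prodf f x \in M.
    by move=> XIx; apply: (mem_morphim pf).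
  have cZM : M \subset 'C(Z).
    apply: subset_trans (subset_trans _ sKG) _;
    last by rewrite centsC (subset_trans sZG) ?subsetIr.
    apply/subsetP => _ /morphimP[x _ /setXnP Xx ->] /=.
    by apply: group_prod => i _; apply: fK; apply: Xx.
  pose W := (Z <*> M)%G; have defW : W = Z * M :> {set gT} by apply: cent_joinEr.
  suff sKW : K \subset W.
    move=> k /(subsetP sKW); rewrite defW => /mulsgP[z _ Zz /morphimP[x _ XIx ->] ->].
    by exists z, x.
  have sWK : W \subset K.
    rewrite join_subG sZK; apply/subsetP => _ /morphimP[x _ /setXnP Xx ->] /=.
    by apply: group_prod => i _; apply: fK; apply: Xx.
  have nWG : G \subset 'N(W).
    apply: normsY; first by rewrite cents_norm // centsC (subset_trans sZG) ?subsetIr.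
    apply/subsetP => g Gg'; rewrite inE;
    apply/subsetP => _ /imsetP[_ /morphimP[x _ XIx ->] ->].
    have [p [a [Aa fg]]] := f_conj g Gg'; rewrite /= (prodf_conj fM fC Aa fg XIx) Mf //.
    by apply/setXnP => j; rewrite ffunE Aut_closed //; have /setXnP := XIx; apply.
  have nZK : K \subset 'N(Z) by apply: gFnorm.
  have [/andP[_ nKZG] minK] := mingroupP minKZ.
  (* W is normal in G, so minimality gives W / Z = K / Z unless W lies in Z; in that case f0 would
     be central and S = pi(X) trivial. *)
  suff eqWK : (W / Z)%G :=: (K / Z)%G.
    by rewrite -(quotientSGK nZK (joing_subl _ _)) -[K / Z]eqWK.
  apply: minK; last exact: quotientS.
  rewrite quotient_norms // andbT; apply/negP => /eqP WZ1.
  have sWZ : W \subset Z by rewrite -quotient_sub1 ?WZ1 // (subset_trans sWK).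
  have [/negP[]] := simpleP _ simS; apply/eqP/trivgP; rewrite -im_pi.
  apply/subsetP => _ /morphimP[x _ Xx ->];
    pose i : I := Sub (L :^ 1) (memLG 1 (group1 G)).
  have Zfx : f i x \in Z.
    apply: (subsetP sWZ); apply: (subsetP (joing_subr _ _)).
    rewrite -(prodf1 fM) Mf //; apply/setXnP => j; rewrite dfung1E.
    by case: ifP => // _; apply: group1.
  have Zf0 : f0 x \in Z by rewrite -(conjgK (g_ i) (f0 x)) (cZG Zfx) ?groupV.
  by rewrite -rho_f0 //= (qZ Zf0) oneg_ffun set11.
- move=> i y Xy cfy.
  have cf0 x : x \in X -> commute (f0 y) (f0 x).
    by move=> /cfy; rewrite /commute /f -!conjMg => /conjg_inj.
  apply: (subsetP ker_pi); apply/morphpreP; split=> //.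
  suff : pi y \in 'Z(S) by rewrite (simple_nonabelian_center simS nabS).
  rewrite -im_pi; apply/setIP; split; first exact: mem_morphim.
  apply/centP => _ /morphimP[x _ Xx ->]; rewrite -!rho_f0 //= /commute.
  have [Kx Ky] := (subsetP sK0K _ (f0_K0 Xx), subsetP sK0K _ (f0_K0 Xy)).
  by have := congr1 (fun k => q k i0) (cf0 x Xx); rewrite /= !morphM // !mulg_ffun.
move=> i j; exists ((g_ i)^-1 * g_ j); first by rewrite groupM ?groupV.
by move=> x Xx; rewrite /f -conjgM mulKVg.
Qed.

End Components.

Lemma components_exist (gT sT xT : finGroupType) (G K : {group gT}) (S : {group sT})
    (X : {group xT}) n :
    K <| G -> 'Z(K) \subset 'Z(G) -> minnormal (K / 'Z(K)) (G / 'Z(K)) ->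
    (K / 'Z(K)) \isog setXn (fun _ : 'I_n => gval S) -> simple S -> ~~ abelian S ->
    universal_cover X S ->
  exists (J : finType) (f : J -> xT -> gT), (0 < #|J|)%N /\ components G K X f.
Proof.
move=> nKG sZG minKZ isoKZ simS nabS [perfX [pi [im_pi ker_pi lift]]].
have [q [ker_q im_q]] := quotient_proj isoKZ.
have n_gt0 : (0 < n)%N.
  rewrite lt0n; apply/eqP => n0; have [/andP[/negP[]]] := mingroupP minKZ.
  rewrite (isog_eq1 isoKZ); apply/eqP/trivgP/subsetP => s _.
  by apply/set1gP/ffunP => j; have := ltn_ord j; rewrite [X in (_ < X)%N]n0.
pose i0 := Ordinal n_gt0.
have [f0 [f0K0 rho_f0]] := first_component lift ker_q im_q i0.
exact: components_exist_from_first f0K0 rho_f0.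
Qed.

Local Open Scope ring_scope.

(** * Irreducible characters of a direct power *)

Section PowerCharacters.

Variables (xT : finGroupType) (I : finType) (V : {group xT}).
Local Notation VI := (setXn (fun _ : I => gval V)).

Lemma sum_setXn (F : I -> xT -> algC) :
  \sum_(x in VI) \prod_i F i (x i) = \prod_i \sum_(y in V) F i y.
Proof.
rewrite bigA_distr_big_dep /=; apply: eq_big => // x.
by apply/setXnP/familyP.
Qed.

Lemma card_power : #|VI|%:R = \prod_(i : I) #|V|%:R :> algC.
Proof.
transitivity (\sum_(x in VI) \prod_(i : I) (1 : algC)).
  by rewrite big1_eq sumr_const.
rewrite (sum_setXn (fun _ _ => 1)); apply: eq_bigr => i _.
by rewrite sumr_const.
Qed.

Lemma power_char_exists (psi : I -> 'CF(V)) : (forall i, psi i \is a character) ->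
  exists2 Psi : 'CF(setXn_group (fun _ : I => V)), Psi \is a character &
    {in VI, forall x, Psi x = \prod_i psi i (x i)}.
Proof.
move=> Npsi; have phiP i : exists phi : 'CF(setXn_group (fun _ : I => V)),
    phi \is a character /\ {in VI, forall x, phi x = psi i (x i)}.
  have /char_reprP[rV Dpsi] := Npsi i.
  have hR : mx_repr (setXn_group (fun _ : I => V))
      (fun x : {dffun forall _ : I, xT} => rV (x i)).
    split=> [|x y /setXnP Vx /setXnP Vy]; first by rewrite oneg_ffun repr_mx1.
    by rewrite mulg_ffun repr_mxM.
  exists (cfRepr (MxRepresentation hR)); split=> [|x VIx]; first exact: cfRepr_char.
  by rewrite Dpsi !cfunE VIx; have /setXnP -> := VIx.
have [phi phiE] := fin_all_exists phiP; exists (\prod_i phi i).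
  by apply: rpred_prod => i _; have [] := phiE i.
move=> x VIx; rewrite prod_cfunE //; apply: eq_bigr => i _.
by have [_ ->] := phiE i.
Qed.

Lemma power_dot (phi psi : I -> 'CF(V)) (Phi Psi : 'CF(setXn_group (fun _ : I => V))) :
    {in VI, forall x, Phi x = \prod_i phi i (x i)} ->
    {in VI, forall x, Psi x = \prod_i psi i (x i)} ->
  '[Phi, Psi] = \prod_i '[phi i, psi i].
Proof.
move=> PhiE PsiE; rewrite cfdotE /= card_power -prodfV.
rewrite (eq_bigr (fun x : {dffun forall _ : I, xT} => \prod_i (phi i (x i) * (psi i (x
  i))^*))) => [|x VIx]; last first.
  by rewrite PhiE // PsiE // rmorph_prod -big_split.
by rewrite (sum_setXn (fun i y => phi i y * (psi i y)^*)) -big_split;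
  apply: eq_bigr => i _; rewrite cfdotE.
Qed.

(* The regular character of a power is the product of the regular characters, *)
(* so every irreducible character is a constituent of some product.           *)
Lemma power_irr (Phi : 'CF(setXn_group (fun _ : I => V))) : Phi \in irr _ ->
  exists c : {ffun I -> Iirr V}, {in VI, forall x, Phi x = \prod_i 'chi_(c i) (x i)}.
Proof.
move=> irr_Phi.
have PsiP (c : {ffun I -> Iirr V}) : exists Psi : 'CF(setXn_group (fun _ : I => V)),
    Psi \in irr _ /\ {in VI, forall x, Psi x = \prod_i 'chi_(c i) (x i)}.
  have [Psi NPsi PsiE] := power_char_exists (fun i => irr_char (c i)); exists Psi.
  split=> //; rewrite irrEchar NPsi (power_dot PsiE PsiE) big1 ?eqxx // => i _.
  by rewrite cfnorm_irr.
have [Psi PsiE] := fin_all_exists PsiP.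
have [c Phi_c | no_c] := pickP (fun c => '[Phi, Psi c] != 0).
  exists c; have [irr_Psi Psi_c] := PsiE c; suff -> : Phi = Psi c by [].
  move: Phi_c; rewrite irr_dot_eq //; case: (Phi =P Psi c) => [-> // | _].
  by rewrite eqxx.
pose a (c : {ffun I -> Iirr V}) := \prod_i 'chi_(c i) 1%g.
have regE : {in VI, forall x, \sum_c (a c *: Psi c) x = #|VI|%:R *+ (x == 1%g)}.
  move=> x VIx; rewrite (eq_bigr (fun c : {ffun I -> Iirr V} =>
    \prod_i ('chi_(c i) 1%g * 'chi_(c i) (x i)))) => [|c _]; last first.
    by rewrite cfunE big_split; have [_ ->] := PsiE c.
  rewrite -(bigA_distr_bigA (fun i k => 'chi[V]_k 1%g * 'chi_k (x i))) /=.
  have regV i : \sum_k 'chi[V]_k 1%g * 'chi_k (x i) = #|V|%:R *+ (x i == 1%g).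
    rewrite -cfRegE cfReg_sum sum_cfunE; apply: eq_bigr => k _.
    by rewrite cfunE.
  rewrite (eq_bigr _ (fun i _ => regV i)) card_power.
  have [-> | ne_x1] := eqVneq x 1%g.
    by apply: eq_bigr => i _; rewrite oneg_ffun eqxx.
  have /existsP[i ne_i] : [exists i, x i != 1%g].
    apply: contraR ne_x1 => /existsPn x1; apply/eqP/ffunP => i.
    by rewrite oneg_ffun; apply/eqP; rewrite -[_ == _]negbK x1.
  by rewrite (bigD1 i) //= (negbTE ne_i) mul0r.
have : '[Phi, \sum_c a c *: Psi c] = Phi 1%g.
  rewrite cfdotE (bigD1 1%g) //= [X in _ * (_ + X)]big1 ?addr0 => [|x /andP[VIx ne_x1]].
    rewrite sum_cfunE regE ?group1 // eqxx conjC_nat mulrCA mulVf ?mulr1 //.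
    exact: (neq0CG (setXn_group (fun _ : I => V))).
  by rewrite sum_cfunE regE // (negbTE ne_x1) conjC0 mulr0.
rewrite cfdot_sumr big1 => [/esym/eqP | c _]; last first.
  by rewrite cfdotZr; have /negbFE/eqP -> := no_c c; rewrite mulr0.
by have /irrP[i ->] := irr_Phi; rewrite (negbTE (irr1_neq0 i)).
Qed.

End PowerCharacters.

(** * Subgroups generated by the components *)

Section ComponentTheory.

Variables (gT xT : finGroupType) (G K : {group gT}) (X : {group xT}).
Variables (I : finType) (f : I -> xT -> gT).
Hypothesis cmp : components G K X f.
Hypotheses (nKG : (K <| G)%g) (sZG : ('Z(K) \subset 'Z(G))%g).
Hypotheses (perfX : X^`(1)%g = X) (nabX : ~~ abelian X).

Local Notation F := (prodf f).
Local Notation power V := (setXn (fun _ : I => gval V)).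
Local Notation powerG V := (setXn_group (fun _ : I => V)).
Local Notation e_ i b := (@dfung1 I (fun=> xT) i b).

Let fM := comp_morph cmp.
Let fC := comp_commute cmp.
Let fK := comp_sub cmp.
Let Z := 'Z(K)%G.
Let sKG : K \subset G := normal_sub nKG.

Definition prodf_morphism := Morphism (prodfM fM fC).

Lemma memXn (V : {group xT}) (x : {dffun forall _ : I, xT}) i : x \in power V -> x i
  \in V.
Proof. by move=> /setXnP/(_ i). Qed.

Lemma powerS (V W : {group xT}) : V \subset W -> power V \subset power W.
Proof. by move=> sVW; apply/subsetP => x /setXnP Vx; apply/setXnP => i;
  apply: (subsetP sVW). Qed.

Lemma dfung1_mem (V : {group xT}) i b : b \in V -> e_ i b \in power V.
Proof. by move=> Vb; apply/setXnP => j; rewrite dfung1E; case: ifP => // _;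
  apply: group1. Qed.

Lemma prodf_sub x : x \in power X -> F x \in K.
Proof. by move=> /setXnP Xx; apply: group_prod => i _; apply/fK/Xx. Qed.

Lemma prodf_V x : x \in power X -> F x^-1%g = (F x)^-1%g.
Proof. by move=> Xx; apply: (morphV prodf_morphism). Qed.

Lemma prodf_one : F 1%g = 1%g.
Proof. exact: (morph1 prodf_morphism). Qed.

Lemma center_commute z g : z \in Z -> g \in G -> commute z g.
Proof. by move=> /(subsetP sZG)/setIP[_ /centP cz] /cz. Qed.

Lemma comp_conj_prodf i x y : x \in X -> y \in power X -> (f i x ^ F y = f i (x ^ y i))%g.
Proof.
move=> Xx Xy; rewrite -!(prodf1 fM); have Xe := dfung1_mem i Xx.
have := morphJ prodf_morphism Xe Xy; rewrite /= => <-; congr (F _).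
apply/ffunP => j; rewrite /conjg !(mulg_ffun, invg_ffun) !dfung1E.
by case: ifP => [/eqP <- // | _]; rewrite mul1g mulVg.
Qed.

Lemma prodf_center y : y \in power X -> F y \in Z -> forall i, y i \in 'Z(X)%g.
Proof.
move=> Xy ZFy i; have Xyi := memXn i Xy; apply: (comp_cent cmp (i := i)) => // x Xx.
have Gfx : f i x \in G by apply/(subsetP sKG)/fK.
have : (f i x ^ F y = f i x)%g by apply/conjg_fixP/commgP/commute_sym/center_commute.
rewrite comp_conj_prodf // => eq_f.
by rewrite /commute -[RHS]fM // [in RHS]conjgC fM ?groupJ // eq_f.
Qed.

(** Distinct components commute, so i != j would make X abelian; for i = j the automorphisms differ
    by central elements of the perfect group X. The uniqueness turns the choices of permutation and
    automorphisms attached to g into a homomorphism. *)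
Lemma comp_unique i j a b : a \in Aut X -> b \in Aut X ->
  (forall x, x \in X -> f i (a x) = f j (b x)) -> i = j /\ a = b.
Proof.
move=> Aa Ab eq_f; have Xa x : x \in X -> a x \in X by apply: Aut_closed.
have Xb x : x \in X -> b x \in X by apply: Aut_closed.
have eq_ij : i = j.
  apply: contraNeq nabX => ne_ij; apply/centsP => y Xy x Xx.
  suff /setIP[_ /centP] : y \in 'Z(X)%g by apply.
  apply: (comp_cent cmp (i := i)) => // {Xx}x Xx.
  have AaV : (a^-1)%g \in Aut X by rewrite groupV.
  rewrite -(permKV a x) eq_f; last exact: Aut_closed.
  by apply: fC => //; apply: Xb; apply: Aut_closed.
split=> //; rewrite -eq_ij in eq_f.
apply: (eq_Aut Aa Ab) => x Xx.
have Zab y : y \in X -> ((a y)^-1 * b y)%g \in 'Z(X)%g.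
  move=> Xy; apply: (comp_cent cmp (i := i)); first by rewrite groupM ?groupV ?Xa ?Xb.
  move=> u Xu; have fab1 : f i ((a y)^-1 * b y)%g = 1%g.
    by apply: (mulgI (f i (a y)));
    rewrite mulg1 -fM ?groupM ?groupV ?Xa ?Xb // mulKVg eq_f.
  by rewrite fab1; apply/commute_sym/commute1.
have := perfect_morphism_eq perfX (f := autm_morphism Aa) (h := autm_morphism Ab).
apply=> // u v Xu Xv /=; have /setIP[_ /centP cz] := Zab u Xu; apply: cz.
  exact: Xa.
exact: Xb.
Qed.

Lemma mul_prodf (z1 z2 : gT) x y : z1 \in Z -> z2 \in Z -> x \in power X -> y \in power
  X ->
  (z1 * F x * (z2 * F y) = z1 * z2 * F (x * y))%g.
Proof.
move=> Zz1 Zz2 Xx Xy; rewrite (prodfM fM fC) // -!mulgA; congr (_ * _)%g.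
by rewrite !mulgA (center_commute Zz2) // (subsetP sKG) ?prodf_sub.
Qed.

Section SubPower.

Variable V : {group xT}.
Hypothesis sVX : V \subset X.

Definition subpower_set := [set (z * F v)%g | z in Z, v in power V].

Lemma subpower_group_set : group_set subpower_set.
Proof.
have sVI := subsetP (powerS sVX).
apply/group_setP; split.
  by apply/imset2P; exists 1%g 1%g; rewrite ?group1 ?prodf_one ?mulg1.
move=> _ _ /imset2P[z1 v1 Zz1 Vv1 ->] /imset2P[z2 v2 Zz2 Vv2 ->].
by apply/imset2P; exists (z1 * z2)%g (v1 * v2)%g; rewrite ?groupM ?mul_prodf ?sVI.
Qed.
Canonical subpower := Group subpower_group_set.

Lemma subpowerP k :
  reflect (exists z v, [/\ z \in Z, v \in power V & k = (z * F v)%g]) (k \in subpower).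
Proof.
by apply: (iffP imset2P) => [[z v Zz Vv ->] | [z [v [Zz Vv ->]]]];
  [exists z, v | exists z v].
Qed.

Lemma subpower_sub : subpower \subset K.
Proof.
apply/subsetP => _ /subpowerP[z [v [Zz Vv ->]]].
by rewrite groupM ?prodf_sub ?(subsetP (powerS sVX)) // (subsetP (center_sub K)).
Qed.

Lemma sub_subpower : Z \subset subpower.
Proof.
by apply/subsetP => z Zz; apply/subpowerP; exists z, 1%g; rewrite prodf_one mulg1 group1.
Qed.

(* Averaging over subpower makes the fibres of (z, v) |-> z * F v irrelevant. *)
Lemma sum_subpower (g : gT -> algC) :
  #|subpower|%:R * \sum_(z in Z) \sum_(v in power V) g (z * F v)%g
    = #|Z|%:R * #|power V|%:R * \sum_(k in subpower) g k.
Proof.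
have sVI := subsetP (powerS sVX).
have shift k : k \in subpower ->
    \sum_(z in Z) \sum_(v in power V) g (z * F v)%g
      = \sum_(z in Z) \sum_(v in power V) g (z * F v * k)%g.
  case/subpowerP => z0 [v0 [Zz0 Vv0 ->]].
  rewrite (reindex_inj (mulIg z0)) /=; apply: eq_big => [z | z Zz];
    first by rewrite groupMr.
  rewrite (reindex_inj (mulIg v0)) /=; apply: eq_big => [v | v Vv].
    by rewrite (groupMr (G := powerG V)).
  rewrite groupMr // in Zz; rewrite (groupMr (G := powerG V)) // in Vv.
  by rewrite mul_prodf ?sVI.
rewrite mulr_natl -sumr_const (eq_bigr _ shift) exchange_big -mulrA /=.
rewrite mulr_natl -sumr_const; apply: eq_bigr => z Zz.
rewrite exchange_big mulr_natl -sumr_const /=; apply: eq_bigr => v Vv.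
rewrite (reindex_inj (mulgI (z * F v)^-1%g)) /=; apply: eq_big => [k | k _].
  by rewrite groupMl // groupV; apply/subpowerP; exists z, v.
by rewrite mulKVg.
Qed.

(** Only absolute values enter a norm, so the scalars of modulus 1 by which Z acts do not matter.
    This transfers irreducibility between a subgroup of K and a direct power. *)
Lemma subpower_norm (A : {group gT}) (phi : 'CF(A)) (Psi : 'CF(powerG V)) :
    A = subpower :> {set gT} ->
    {in Z & power V, forall z v, `|phi (z * F v)%g| = `|Psi v|} ->
  '[phi] = '[Psi].
Proof.
move=> defA phiE; have nzS := neq0CG subpower; have nzZ := neq0CG Z.
have nzV := neq0CG (powerG V).
have := sum_subpower (fun k => phi k * (phi k)^*).
rewrite (eq_bigr (fun=> \sum_(v in power V) Psi v * (Psi v)^*)) => [|z Zz]; last first.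
  by apply: eq_bigr => v Vv; rewrite -!normCK phiE.
rewrite sumr_const -[X in _ * X = _]mulr_natl mulrCA -mulrA => /(mulfI nzZ) eq_sum.
rewrite -defA in eq_sum nzS; rewrite !cfdotE; apply: (mulfI nzS); rewrite mulVKf //;
  apply: (mulfI nzV).
by rewrite -eq_sum mulrCA mulVKf.
Qed.

End SubPower.

Lemma subpower_full : subpower (subxx X) = K.
Proof.
apply/val_inj/eqP; rewrite eqEsubset subpower_sub; apply/subsetP => k /(comp_gen cmp).
by case=> z [x [Zz Xx ->]]; apply/subpowerP; exists z, x.
Qed.

End ComponentTheory.

(** * Invariant characters as tensor powers *)

Section InvariantCharacter.

Variables (gT xT : finGroupType) (G K : {group gT}) (X : {group xT}).
Variables (I : finType) (f : I -> xT -> gT).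
Hypothesis cmp : components G K X f.
Hypotheses (nKG : (K <| G)%g) (sZG : ('Z(K) \subset 'Z(G))%g).
Hypothesis I_gt0 : (0 < #|I|)%N.
Variable tau : 'CF(K).
Hypotheses (irr_tau : tau \in irr K) (inv_tau : G \subset 'I[tau]%g).

Local Notation F := (prodf f).
Local Notation power V := (setXn (fun _ : I => gval V)).
Local Notation powerG V := (setXn_group (fun _ : I => V)).

Let fM := comp_morph cmp.
Let fC := comp_commute cmp.
Let Z := 'Z(K)%G.
Let sKG : K \subset G := normal_sub nKG.
Let sZK : Z \subset K := center_sub K.
Let defK : K = subpower cmp nKG sZG (subxx X) :> {set gT}.
Proof. by rewrite subpower_full. Qed.

Lemma affords_center d (T : gT -> 'M[algC]_d) : affords T tau ->
  exists w : gT -> algC, {in Z, forall z, T z = (w z)%:M}.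
Proof.
move=> affT; have [_ cT] := affords_irr_cent affT irr_tau; have [[_ TM] _] := affT.
have wP (z : gT) : exists w : algC, z \in Z -> T z = w%:M.
  have [Zz | _] := boolP (z \in Z); last by exists 0.
  have [Kz /centP cz] := setIP Zz.
  by have [|w Dw] := cT (T z); [move=> x Kx; rewrite -!TM // cz | exists w].
by have [w Dw] := fin_all_exists wP; exists w => z /Dw.
Qed.

Section Scalars.

Variables (d : nat) (T : gT -> 'M[algC]_d) (w : gT -> algC).
Hypotheses (affT : affords T tau) (Tw : {in Z, forall z, T z = (w z)%:M}).

Lemma center_tau z k : z \in Z -> k \in K -> tau (z * k)%g = w z * tau k.
Proof.
move=> Zz Kk; have [[_ TM] trT] := affT; have Kz := subsetP sZK z Zz.
by rewrite !trT ?groupM // TM // Tw // mul_scalar_mx mxtraceZ.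
Qed.

Lemma center_scalarM z1 z2 : z1 \in Z -> z2 \in Z -> w (z1 * z2)%g = w z1 * w z2.
Proof.
move=> Zz1 Zz2; apply: (mulIf (irr1_neq0 (cfIirr tau))); rewrite cfIirrE //.
rewrite -mulrA -!center_tau ?group1 ?groupM ?(subsetP sZK) // mulgA //.
Qed.

Lemma center_scalar1 : w 1%g = 1.
Proof.
apply: (mulIf (irr1_neq0 (cfIirr tau))); rewrite cfIirrE //.
by rewrite -center_tau ?group1 // mulg1 mul1r.
Qed.

Lemma center_scalar_neq0 z : z \in Z -> w z != 0.
Proof.
move=> Zz; apply: contraTneq (oner_neq0 algC) => wz0.
by rewrite -center_scalar1 -(mulgV z) center_scalarM ?groupV // wz0 mul0r eqxx.
Qed.

Lemma center_scalar_norm z : z \in Z -> `|w z| = 1.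
Proof.
move=> Zz; have nz_tau1 : tau 1%g != 0 by have /irrP[i ->] := irr_tau; apply: irr1_neq0.
have conjw : (w z)^* = w z^-1%g.
  apply: (mulIf nz_tau1); rewrite -[RHS]center_tau ?group1 ?groupV // mulg1.
  rewrite (char_inv _ (irrWchar irr_tau)) -{2}(mulg1 z) center_tau // rmorphM.
  by congr (_ * _); rewrite /= -(char_inv _ (irrWchar irr_tau)) invg1.
apply/eqP; rewrite -sqrp_eq1 ?normr_ge0 // normCK conjw -center_scalarM ?groupV //.
by rewrite mulgV center_scalar1.
Qed.

End Scalars.

(** x |-> tau (F x) has norm 1, hence is irreducible and a product of characters ['chi_(c i)].
    Restricted to component i, tau is a multiple of ['chi_(c i)]; invariance under an element of G
    carrying one component to another makes c constant. *)
Lemma tau_power : exists2 chi : 'CF(X), chi \in irr X &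
  {in power X, forall x, tau (F x) = \prod_i chi (x i)}.
Proof.
have Ntau := irrWchar irr_tau.
have [d Dd] : exists d : nat, tau 1%g = d%:R by apply/natrP; apply: Cnat_char1.
have [T affT] := char_afforded Ntau Dd; have [w Tw] := affords_center affT.
have [hT trT] := affT; have [T1 TM] := hT.
have hTF : mx_repr (powerG X) (fun x => T (F x)).
  split=> [|x y Xx Xy]; first by rewrite (prodf_one cmp).
  by rewrite (prodfM fM fC) // TM ?(prodf_sub cmp).
pose Phi := cfRepr (MxRepresentation hTF).
have PhiE : {in power X, forall x, Phi x = tau (F x)}.
  by move=> x Xx; rewrite cfunE Xx trT ?(prodf_sub cmp).
have irr_Phi : Phi \in irr _.
  rewrite irrEchar cfRepr_char -(subpower_norm (phi := tau) defK) ?irrWnorm ?eqxx //.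
  move=> z v Zz Vv; rewrite (center_tau affT Tw) ?(prodf_sub cmp) //.
  by rewrite normrM (center_scalar_norm affT Tw) // mul1r PhiE.
have [c cE] := power_irr irr_Phi.
pose A i := \prod_(j | j != i) 'chi[X]_(c j) 1%g.
have nzA i : A i != 0 by apply/prodf_neq0 => j _; apply: irr1_neq0.
have tau_f i x : x \in X -> tau (f i x) = 'chi_(c i) x * A i.
  move=> Xx; rewrite -(prodf1 fM) -PhiE ?cE ?dfung1_mem // (bigD1 i) //= dfung1E eqxx.
  by congr (_ * _); apply: eq_bigr => j ne_ji; rewrite dfung1E eq_sym (negbTE ne_ji).
have [i0 _] := card_gt0P I_gt0.
have c_eq j : c j = c i0.
  have [g Gg fj] := comp_trans cmp i0 j.
  have : 'chi[X]_(c j) = (A i0 / A j) *: 'chi_(c i0).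
    apply/cfun_inP => x Xx; rewrite cfunE mulrAC; apply: (mulIf (nzA j)).
    rewrite mulfVK // -tau_f // fj // (inertia_valJ _ (subsetP inv_tau g Gg)).
    by rewrite tau_f // mulrC.
  move/(congr1 (fun psi => '[psi, 'chi_(c j)])); rewrite cfnorm_irr cfdotZl cfdot_irr.
  by case: eqP => // _ /eqP; rewrite mulr0 oner_eq0.
exists 'chi_(c i0); first exact: mem_irr.
by move=> x Xx; rewrite -PhiE // cE //; apply: eq_bigr => j _; rewrite c_eq.
Qed.

(** Both representations of the power afford the same character, so a change of basis makes T
    literally a tensor product. *)
Lemma tau_tens (chi : 'CF(X)) d (D : xT -> 'M[algC]_d) :
    {in power X, forall x, tau (F x) = \prod_i chi (x i)} -> affords D chi ->
  exists T : gT -> 'M[algC]_#|{ffun I -> 'I_d}|, affords T tau /\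
    {in power X, forall x, T (F x) = tens_perm (fun i => D (x i)) 1}.
Proof.
move=> tauE affD; have [[D1 DM] trD] := affD.
have tau1 : tau 1%g = #|{ffun I -> 'I_d}|%:R.
  rewrite -(prodf_one cmp) tauE ?(group1 (powerG X)) // card_ffun card_ord natrX
    -prodr_const.
  by apply: eq_bigr => i _; rewrite oneg_ffun (affords1 affD).
have [T affT] := char_afforded (irrWchar irr_tau) tau1.
have [[T1 TM] trT] := affT.
have hTF : mx_repr (powerG X) (fun x => T (F x)).
  split=> [|x y Xx Xy]; first by rewrite (prodf_one cmp).
  by rewrite (prodfM fM fC) // TM ?(prodf_sub cmp).
pose Phi := cfRepr (MxRepresentation hTF).
have affTF : affords (fun x => T (F x)) Phi.
  by split=> // x Xx; rewrite cfunE Xx.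
have affDI : affords (fun x : {dffun forall _ : I, xT} => tens_perm (fun i => D (x i))
  1) Phi.
  split=> [|x Xx].
    split=> [|x y /setXnP Xx /setXnP Xy].
      by rewrite -tens_perm1; apply: eq_tens_perm => i; rewrite oneg_ffun D1.
    rewrite tens_permM mulg1; apply: eq_tens_perm => i.
    by rewrite mulg_ffun perm1 DM ?Xx ?Xy.
  rewrite cfunE Xx -trT ?(prodf_sub cmp) // tauE // tens_perm_tr.
  by apply: eq_bigr => i _; rewrite trD // (memXn _ Xx).
have [B uB TB] := affords_sim affTF affDI.
exists (fun k => invmx B *m T k *m B); split.
  split=> [|k Kk]; last by rewrite trT // mxtrace_mulC mulmxA mulmxV // mul1mx.
  split=> [|k l Kk Kl]; first by rewrite T1 mulmx1 mulVmx.
  by rewrite TM // !mulmxA mulmxK.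
by move=> x Xx; rewrite -mulmxA TB // mulKmx.
Qed.

End InvariantCharacter.

(** * Projective representations of the normalizer *)

(** The same S stands in every factor, so its tensor power commutes with permuting the factors. *)
Lemma tens_perm_conj (I : finType) d (S : 'M[algC]_d) (A : I -> 'M[algC]_d) p :
    S \in unitmx ->
  tens_perm (fun i => invmx S *m A i *m S) p
    = invmx (tens_perm (fun=> S) 1) *m tens_perm A p *m tens_perm (fun=> S) 1.
Proof.
move=> uS; have SV : tens_perm (fun _ : I => S) 1 *m tens_perm (fun=> invmx S) 1 = 1%:M.
  by rewrite tens_permM mulg1 -tens_perm1; apply: eq_tens_perm => i; rewrite mulmxV.
have uT := mulmx1_unit SV.
rewrite -[invmx (tens_perm _ _)]mulmx1 -SV mulKmx ?uT.1 // !tens_permM mul1g mulg1.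
by apply: eq_tens_perm => i; rewrite perm1.
Qed.

Section Assembly.

Variables (gT xT : finGroupType) (G K : {group gT}) (X : {group xT}).
Variables (I : finType) (f : I -> xT -> gT).
Hypothesis cmp : components G K X f.
Hypotheses (nKG : (K <| G)%g) (sZG : ('Z(K) \subset 'Z(G))%g).
Hypotheses (perfX : X^`(1)%g = X) (nabX : ~~ abelian X).
Hypothesis I_gt0 : (0 < #|I|)%N.
Variable tau : 'CF(K).
Hypotheses (irr_tau : tau \in irr K) (inv_tau : G \subset 'I[tau]%g).

Local Notation F := (prodf f).
Local Notation power V := (setXn (fun _ : I => gval V)).
Local Notation powerG V := (setXn_group (fun _ : I => V)).
Local Notation e_ i b := (@dfung1 I (fun=> xT) i b).

Variables (chi : 'CF(X)) (U0 : {group xT}) (mu : 'CF(U0)).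
Hypothesis irr_chi : chi \in irr X.
Hypothesis tauE : {in power X, forall x, tau (F x) = \prod_i chi (x i)}.
Variables (d d' : nat) (D : xT -> 'M[algC]_d) (D' : xT -> 'M[algC]_d').
Variables (Pa : {perm xT} -> 'M[algC]_d) (Pa' : {perm xT} -> 'M[algC]_d').
Hypothesis fd : feit_data chi mu D D' Pa Pa'.
Variable T : gT -> 'M[algC]_#|{ffun I -> 'I_d}|.
Hypothesis affT : affords T tau.
Hypothesis TF : {in power X, forall x, T (F x) = tens_perm (fun i => D (x i)) 1}.
Variable w : gT -> algC.
Hypothesis Tw : {in 'Z(K)%G, forall z, T z = (w z)%:M}.

Let fM := comp_morph cmp.
Let fC := comp_commute cmp.
Let fK := comp_sub cmp.
Let Z := 'Z(K)%G.
Let sKG : K \subset G := normal_sub nKG.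
Let sZK : Z \subset K := center_sub K.
Let sUX : U0 \subset X := proper_sub (feit_proper fd).
Let sUI := subsetP (@powerS xT I _ _ sUX).
Let Uk := subpower cmp nKG sZG sUX.
Let UkP := @subpowerP _ _ _ _ _ _ _ cmp nKG sZG _ sUX.
Let sUK : Uk \subset K := subpower_sub cmp nKG sZG sUX.
Let sZU : Z \subset Uk := sub_subpower cmp nKG sZG sUX.
Let FK := prodf_sub cmp.
Let wM := center_scalarM irr_tau affT Tw.
Let w1 := center_scalar1 irr_tau affT Tw.
Let nzw := center_scalar_neq0 irr_tau affT Tw.
Let tauZ := center_tau affT Tw.

Lemma center_sub_selfnorm : 'Z(X)%g \subset U0.
Proof.
rewrite -(feit_selfnorm fd) subsetI center_sub cents_norm //.
by rewrite (subset_trans (subsetIr _ _)) ?centS.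
Qed.

Lemma comp_mem i u : u \in U0 -> f i u \in Uk.
Proof.
move=> Uu; apply/UkP; exists 1%g, (e_ i u); rewrite group1 dfung1_mem // mul1g.
by rewrite (prodf1 fM).
Qed.

(** Two tuples with the same image modulo Z differ by central coordinates, and Z(X) lies in the
    self-normalizing U0. *)
Lemma comp_preim i x : x \in X -> f i x \in Uk -> x \in U0.
Proof.
move=> Xx /UkP[z [u [Zz Uu Dfx]]]; have Xu := sUI Uu.
have Xe := dfung1_mem i Xx; have Xy : (e_ i x * u^-1)%g \in power X.
  by rewrite (groupM (G := powerG X)) ?(groupV (powerG X)).
have FyZ : F (e_ i x * u^-1)%g \in Z.
  rewrite (prodfM fM fC) ?(groupV (powerG X)) // (prodf1 fM) Dfx.
  by rewrite (prodf_V cmp) // mulgK.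
have := subsetP center_sub_selfnorm _ (prodf_center cmp nKG sZG Xy FyZ i).
rewrite mulg_ffun invg_ffun dfung1E eqxx groupMr // groupV.
exact: memXn Uu.
Qed.

Lemma comp_conj_mul i x z y : x \in X -> z \in Z -> y \in power X ->
  (f i x ^ (z * F y) = f i (x ^ y i))%g.
Proof.
move=> Xx Zz Xy; rewrite conjgM -(comp_conj_prodf cmp i Xx Xy); congr (_ ^ _)%g.
have Gfx : f i x \in G by apply/(subsetP sKG)/fK.
by apply/conjg_fixP/commgP/commute_sym/(center_commute sZG).
Qed.

(** An element z F x acts on component i as conjugation by x i, so self-normalization is checked
    coordinatewise. *)
Lemma normal_subpower_K : 'N_K(Uk)%g = Uk.
Proof.
apply/eqP; rewrite eqEsubset subsetI sUK normG !andbT.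
apply/subsetP => k /setIP[/(comp_gen cmp)[z [x [Zz Xx ->]]] nUk].
apply/UkP; exists z, x; split=> //; apply/setXnP => i; have Xxi := memXn i Xx.
rewrite -(feit_selfnorm fd) inE Xxi inE; apply/subsetP => _ /imsetP[u Uu ->].
have Xu := subsetP sUX u Uu; apply: (comp_preim (i := i)); first by rewrite groupJ.
by rewrite -(comp_conj_mul i Xu Zz Xx) memJ_norm // comp_mem.
Qed.

Lemma subpower_proper : Uk \proper K.
Proof.
have [i _] := card_gt0P I_gt0; have /properP[_ [x Xx notUx]] := feit_proper fd.
apply/properP; split=> //; exists (f i x); first exact: fK.
by apply: contra notUx; apply: comp_preim.
Qed.

Lemma subpower_memJ g : g \in G ->
  (forall i u, u \in U0 -> (f i u ^ g)%g \in Uk) -> g \in 'N(Uk)%g.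
Proof.
move=> Gg Uf; rewrite inE; apply/subsetP => _ /imsetP[_ /UkP[z [u [Zz Uu ->]]] ->].
rewrite conjMg groupM //.
  rewrite (_ : (z ^ g)%g = z) ?(subsetP sZU) //.
  by apply/conjg_fixP/commgP/(center_commute sZG).
rewrite /prodf (big_morph (fun u => u ^ g)%g (fun u v => conjMg u v g) (conj1g g)).
by apply: group_prod => i _; apply: Uf; apply: memXn Uu.
Qed.

(** A Frattini argument: by intravariance each automorphism a i moves U0 to an X-conjugate, and an
    element of K undoes all these conjugations at once. *)
Lemma frattini_subpower : G = (K * 'N_G(Uk))%g :> {set gT}.
Proof.
apply/eqP; rewrite eqEsubset mul_subG ?subsetIl // andbT; apply/subsetP => g Gg.
have [p [a [Aa fg]]] := comp_conj cmp Gg.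
have xP i : exists x, x \in X /\ a i @: U0 = (U0 :^ x)%g.
  by have [x Xx Ux] := feit_intravariant fd (Aa i); exists x.
have [x xE] := fin_all_exists xP.
(* The inverse of p appears because g moves component i to component p i, where the correction by (x
   i)^-1 is required. *)
pose y : {dffun forall _ : I, xT} := [ffun j => (x ((p^-1)%g j))^-1%g].
have Xy : y \in power X by apply/setXnP => j; rewrite ffunE groupV;
  case: (xE ((p^-1)%g j)).
have GFy : F y \in G by apply/(subsetP sKG)/FK.
have NgFy : (g * F y)%g \in 'N_G(Uk)%g.
  rewrite inE groupM //; apply: subpower_memJ; first by rewrite groupM.
  move=> i u Uu; have Xu := subsetP sUX u Uu; have Xau := Aut_closed (Aa i) Xu.
  rewrite conjgM fg // (comp_conj_prodf cmp) // ffunE permK; apply: comp_mem.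
  have [Xx Ux] := xE i.
  by rewrite -mem_conjg -Ux imset_f.
have -> : g = ((F y)^-1 ^ g^-1 * (g * F y))%g.
  by rewrite /conjg invgK !mulgA !mulgKV.
apply: mem_mulg NgFy; rewrite memJ_norm ?groupV ?FK //.
exact: (subsetP (normal_norm nKG)).
Qed.

Lemma subpower_meet : Uk = (K :&: 'N_G(Uk))%g :> {set gT}.
Proof. by rewrite setIA (setIidPl sKG) normal_subpower_K. Qed.

Lemma tau_comp i x : x \in X -> tau (f i x) = chi x * chi 1%g ^+ #|I|.-1.
Proof.
move=> Xx; rewrite -(prodf1 fM) tauE ?dfung1_mem // (bigD1 i) //= dfung1E eqxx.
congr (_ * _); rewrite -(cardC1 i) -prodr_const.
by apply: eq_big => // j ne_ji; rewrite dfung1E eq_sym (negbTE ne_ji).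
Qed.

Let nz_chi1 : chi 1%g != 0.
Proof. by have /irrP[i ->] := irr_chi; apply: irr1_neq0. Qed.

Let nz_mu1 : mu 1%g != 0.
Proof. by have /irrP[i ->] := feit_irr fd; apply: irr1_neq0. Qed.

Let H := 'N_G(Uk)%G.

Lemma conj_data : exists (p : gT -> {perm I}) (a : gT -> I -> {perm xT}),
  {in G, forall g, (forall i, a g i \in Aut X) /\
    forall i x, x \in X -> (f i x ^ g)%g = f (p g i) (a g i x)}.
Proof.
have paP g : exists pa : {perm I} * (I -> {perm xT}), g \in G ->
    (forall i, pa.2 i \in Aut X) /\
    forall i x, x \in X -> (f i x ^ g)%g = f (pa.1 i) (pa.2 i x).
  have [/(comp_conj cmp)[p [a pa]] | _] := boolP (g \in G); first by exists (p, a).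
  by exists (1%g, fun=> 1%g).
have [pa paE] := fin_all_exists paP.
by exists (fun g => (pa g).1), (fun g => (pa g).2) => g /paE.
Qed.

Variables (p : gT -> {perm I}) (a : gT -> I -> {perm xT}).
Hypothesis paE : {in G, forall g, (forall i, a g i \in Aut X) /\
    forall i x, x \in X -> (f i x ^ g)%g = f (p g i) (a g i x)}.

Let Aa g i : g \in G -> a g i \in Aut X. Proof. by case/paE. Qed.
Let fa g i x : g \in G -> x \in X -> (f i x ^ g)%g = f (p g i) (a g i x).
Proof. by case/paE => _; apply. Qed.
Let sHG : H \subset G := subsetIl _ _.

(** U0 is preserved because Uk meets component i exactly in f i (U0); chi is preserved because the
    G-invariant tau is the same multiple of chi on every component. *)
Lemma conj_stab h i : h \in H -> Aut_pair_stab U0 chi (a h i).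
Proof.
move=> /setIP[Gh nUh]; have Aah := Aa i Gh; apply/and3P; split=> //.
  rewrite eqEcard card_imset ?leqnn ?andbT; last exact: perm_inj.
  apply/subsetP => _ /imsetP[u Uu ->]; have Xu := subsetP sUX u Uu.
  apply: (comp_preim (i := p h i)); first exact: Aut_closed.
  by rewrite -fa // memJ_norm // comp_mem.
apply/forall_inP => x Xx; apply/eqP; have Xax := Aut_closed Aah Xx.
apply: (mulIf (expf_neq0 #|I|.-1 nz_chi1)).
rewrite -(tau_comp (p h i) Xax) -(tau_comp i Xx) -fa //.
exact: (inertia_valJ _ (subsetP inv_tau h Gh)).
Qed.

(** The multiplication rule of the wreath product of Aut X with the permutations of I, forced by
    [comp_unique]. *)
Lemma conj_dataM g h i : g \in G -> h \in G ->
  p (g * h)%g i = (p g * p h)%g i /\ a (g * h)%g i = (a g i * a h (p g i))%g.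
Proof.
move=> Gg Gh; apply: (comp_unique cmp perfX nabX) => [||x Xx].
- by apply: Aa; rewrite groupM.
- by rewrite groupM ?Aa.
rewrite -fa ?groupM // conjgM fa // fa ?Aut_closed ?Aa //.
by rewrite !permM.
Qed.

Lemma conj_aut_Aut x : x \in X -> conj_aut X x \in Aut X.
Proof.
move=> Xx; apply: (subsetP (Aut_conj_aut X X)); apply: mem_morphim => //.
exact: (subsetP (normG X)).
Qed.

Lemma conj_data_inner z v i : z \in Z -> v \in power X ->
  p (z * F v)%g i = i /\ a (z * F v)%g i = conj_aut X (v i).
Proof.
move=> Zz Xv; have Gzv : (z * F v)%g \in G.
  by apply/(subsetP sKG); rewrite groupM ?FK ?(subsetP sZK).
have Xvi := memXn i Xv.
apply: (comp_unique cmp perfX nabX) => [||x Xx]; first exact: Aa.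
  exact: conj_aut_Aut.
by rewrite -fa // comp_conj_mul // conj_autE.
Qed.

Definition projK h := tens_perm (fun i => Pa (a h i)) (p h).
Definition projU h := tens_perm (fun i => Pa' (a h i)) (p h).

Lemma projK_unit : {in H, forall h, projK h \in unitmx}.
Proof.
by move=> h Hh; apply: tens_perm_unit => i; have [] := feit_unit fd (conj_stab i Hh).
Qed.

Lemma projU_unit : {in H, forall h, projU h \in unitmx}.
Proof.
by move=> h Hh; apply: tens_perm_unit => i; have [] := feit_unit fd (conj_stab i Hh).
Qed.

Lemma T_mul z x : z \in Z -> x \in power X ->
  T (z * F x)%g = w z *: tens_perm (fun i => D (x i)) 1.
Proof.
move=> Zz Xx; have [[_ TM] _] := affT.
by rewrite TM ?FK ?(subsetP sZK) // Tw // TF // mul_scalar_mx.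
Qed.

Lemma T_projK : {in K & H, forall k h, T k *m projK h = projK h *m T (k ^ h)%g}.
Proof.
move=> k h /(comp_gen cmp)[z [x [Zz Xx ->]]] Hh; have Gh := subsetP sHG h Hh.
have [Aah fah] := paE Gh; rewrite conjMg (prodf_conj fM fC Aah fah Xx).
have -> : (z ^ h)%g = z by apply/conjg_fixP/commgP/(center_commute sZG).
rewrite !T_mul //; last by apply/setXnP => j; rewrite ffunE Aut_closed // (memXn _ Xx).
rewrite -scalemxAl -scalemxAr !tens_permM mul1g mulg1; congr (_ *: _).
apply: eq_tens_perm => i; rewrite perm1 ffunE permK.
by apply: (feit_intertwines fd (conj_stab i Hh)); apply: memXn Xx.
Qed.

Lemma projKM : {in H &, forall h l, exists c, [/\ c != 0,
  projK h *m projK l = c *: projK (h * l)%g & projU h *m projU l = c *: projU (h * l)%g]}.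
Proof.
move=> h l Hh Hl; have [Gh Gl] := (subsetP sHG h Hh, subsetP sHG l Hl).
have cP i := feit_mult fd (conj_stab i Hh) (conj_stab (p h i) Hl).
have [c cE] := fin_all_exists cP.
have pE : p (h * l)%g = (p h * p l)%g by apply/permP => i; have [] := conj_dataM i Gh Gl.
have aE i : a (h * l)%g i = (a h i * a l (p h i))%g by have [] := conj_dataM i Gh Gl.
exists (\prod_i c i); split.
- by apply/prodf_neq0 => i _; have [] := cE i.
- rewrite /projK tens_permM pE -tens_permZ; apply: eq_tens_perm => i.
  by rewrite aE; have [] := cE i.
rewrite /projU tens_permM pE -tens_permZ; apply: eq_tens_perm => i.
by rewrite aE; have [] := cE i.
Qed.

(** The coordinates of y are central in X, where D and D' take equal scalars; their product is the
    scalar w (F y) of T. It is the compatibility that makes T' well defined. *)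
Lemma feit_center_power y : y \in power X -> F y \in Z ->
  {in power U0, forall v, tens_perm (fun i => D' ((v * y)%g i)) 1
    = w (F y) *: tens_perm (fun i => D' (v i)) 1}.
Proof.
move=> Xy ZFy v Uv; have Zy := prodf_center cmp nKG sZG Xy ZFy.
have cP i := feit_center fd (Zy i); have [c cE] := fin_all_exists cP.
have [[_ D'M] _] := feit_affords' fd.
have n_gt0 : (0 < #|{ffun I -> 'I_d}|)%N by have [] := affords_irr_cent affT irr_tau.
have wE : w (F y) = \prod_i c i.
  have : T (F y) = (\prod_i c i)%:M.
    by rewrite TF // -tens_perm_scalar; apply: eq_tens_perm => i; have [] := cE i.
  rewrite Tw // => /matrixP/(_ (Ordinal n_gt0) (Ordinal n_gt0)).
  by rewrite !mxE eqxx.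
rewrite wE -tens_permZ; apply: eq_tens_perm => i; have [_ cE'] := cE i.
rewrite mulg_ffun D'M ?(memXn i Uv) // ?cE' ?mul_mx_scalar //.
exact: (subsetP center_sub_selfnorm).
Qed.

Lemma sub_tens_exists : exists T' : gT -> 'M[algC]_#|{ffun I -> 'I_d'}|,
  {in Z & power U0, forall z v, T' (z * F v)%g = w z *: tens_perm (fun i => D' (v i)) 1}.
Proof.
have MP (u : gT) : exists M : 'M[algC]_#|{ffun I -> 'I_d'}|,
    forall z v, z \in Z -> v \in power U0 -> u = (z * F v)%g ->
      M = w z *: tens_perm (fun i => D' (v i)) 1.
  have [/UkP[z0 [v0 [Zz0 Uv0 Du0]]] | notUu] := boolP (u \in Uk); last first.
    by exists 0 => z v Zz Uv Du; case/negP: notUu; apply/UkP; exists z, v.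
  (* Two expressions z F v = z0 F v0 differ by y = v^-1 v0, whose image under F lies in Z, so
     [feit_center_power] compares their values. *)
  exists (w z0 *: tens_perm (fun i => D' (v0 i)) 1) => z v Zz Uv; rewrite Du0 => Du.
  have [Xv Xv0] := (sUI Uv, sUI Uv0).
  have Xy : (v^-1 * v0)%g \in power X.
    by rewrite (groupM (G := powerG X)) ?(groupV (powerG X)).
  have Fy : F (v^-1 * v0)%g = (z * z0^-1)%g.
    rewrite (prodfM fM fC) ?(groupV (powerG X)) // (prodf_V cmp) //.
    have -> : F v0 = (z0^-1 * z * F v)%g by rewrite -mulgA -Du mulKg.
    have Zzz : (z0^-1 * z)%g \in Z by rewrite groupM ?groupV.
    have cz := center_commute sZG Zzz (subsetP sKG _ (FK Xv)).
    rewrite cz mulKg; apply: (center_commute sZG); rewrite ?groupV //.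
    exact/(subsetP sKG)/(subsetP sZK).
  have ZFy : F (v^-1 * v0)%g \in Z by rewrite Fy groupM ?groupV.
  have := feit_center_power Xy ZFy Uv; rewrite mulKVg => ->.
  rewrite scalerA Fy; congr (_ *: _).
  by rewrite mulrC -wM ?groupM ?groupV // mulgKV.
have [T' T'E] := fin_all_exists MP; exists T' => z v Zz Uv.
exact: (T'E _ z v Zz Uv (erefl _)).
Qed.

Variable T' : gT -> 'M[algC]_#|{ffun I -> 'I_d'}|.
Hypothesis T'E : {in Z & power U0, forall z v,
  T' (z * F v)%g = w z *: tens_perm (fun i => D' (v i)) 1}.

Lemma sub_tens_repr : mx_repr Uk T'.
Proof.
have [[D'1 D'M] _] := feit_affords' fd; split.
  rewrite -[1%g]mul1g -{2}(prodf_one cmp) T'E ?group1 // ?(group1 (powerG U0)) // w1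
    scale1r.
  by rewrite -tens_perm1; apply: eq_tens_perm => i; rewrite oneg_ffun.
move=> _ _ /UkP[z1 [v1 [Zz1 Uv1 ->]]] /UkP[z2 [v2 [Zz2 Uv2 ->]]].
rewrite (mul_prodf cmp nKG sZG) ?sUI // !T'E ?groupM // ?(groupM (G := powerG U0)) //.
rewrite -scalemxAl -scalemxAr scalerA tens_permM mulg1 wM //; congr (_ *: _).
by apply: eq_tens_perm => i; rewrite mulg_ffun perm1 D'M ?(memXn i Uv1) ?(memXn i Uv2).
Qed.

Definition muK := cfRepr (MxRepresentation sub_tens_repr).

Lemma muK_affords : affords T' muK.
Proof. by split=> [|u Uu]; [apply: sub_tens_repr | rewrite cfunE Uu]. Qed.

Lemma muKE z v : z \in Z -> v \in power U0 -> muK (z * F v)%g = w z * \prod_i mu (v i).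
Proof.
move=> Zz Uv; have [_ ->] := muK_affords; last by apply/UkP; exists z, v.
rewrite T'E // mxtraceZ tens_perm_tr; congr (_ * _); apply: eq_bigr => i _.
by have [_ ->] := feit_affords' fd; rewrite ?(memXn i Uv).
Qed.

Lemma muK_irr : muK \in irr Uk.
Proof.
rewrite irrEchar cfRepr_char.
have Nmu (i : I) : mu \is a character by apply: irrWchar (feit_irr fd).
have [Psi NPsi PsiE] := power_char_exists Nmu.
rewrite (subpower_norm (phi := muK) (Psi := Psi) (erefl (gval Uk))).
  by rewrite (power_dot PsiE PsiE) big1 ?eqxx // => i _; rewrite irrWnorm ?(feit_irr fd).
move=> z v Zz Uv; rewrite muKE // PsiE // normrM.
by rewrite (center_scalar_norm irr_tau affT Tw) // mul1r.
Qed.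

Lemma projK_inner : {in Uk, forall u, exists c,
  [/\ c != 0, projK u = c *: T u & projU u = c *: T' u]}.
Proof.
move=> _ /UkP[z [v [Zz Uv ->]]]; have Xv := sUI Uv.
have pE : p (z * F v)%g = 1%g.
  by apply/permP => i; rewrite perm1; have [] := conj_data_inner i Zz Xv.
have cP i : exists c, [/\ c != 0, Pa (a (z * F v)%g i) = c *: D (v i)
    & Pa' (a (z * F v)%g i) = c *: D' (v i)].
  have [_ aE] := conj_data_inner i Zz Xv; have Uvi := memXn i Uv; have Xvi := memXn i Xv.
  apply: (feit_inner fd Uvi); first by rewrite aE conj_aut_Aut.
  by move=> x Xx; rewrite aE conj_autE.
have [c cE] := fin_all_exists cP.
have wK := mulfV (nzw Zz).
(* [projK] and [projU] do not see z, while T and T' contain w z; hence the division. *)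
exists ((\prod_i c i) / w z); split.
- rewrite mulf_neq0 ?invr_eq0 ?nzw //.
  by apply/prodf_neq0 => i _; have [] := cE i.
- rewrite T_mul // scalerA mulfVK ?nzw // /projK pE -tens_permZ.
  by apply: eq_tens_perm => i; have [] := cE i.
rewrite T'E // scalerA mulfVK ?nzw // /projU pE -tens_permZ.
by apply: eq_tens_perm => i; have [] := cE i.
Qed.

(** On one component tau is chi times a rational integer, and on Z it is w times tau 1. The
    condition on w recurs for [muK], so comparing the two stabilizers reduces to comparing those of
    chi and mu, which is [feit_gal]. *)
Lemma stab_tau (nu : {rmorphism algC -> algC}) : cfAut nu tau = tau <->
  cfAut nu chi = chi /\ {in Z, forall z, nu (w z) = w z}.
Proof.
split=> [/cfunP nu_tau | [/cfunP nu_chi nu_w]]; last first.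
  apply/cfun_inP => k /(comp_gen cmp)[z [x [Zz Xx ->]]].
  rewrite cfunE tauZ ?FK // tauE // rmorphM rmorph_prod nu_w //; congr (_ * _).
  by apply: eq_bigr => i _; have := nu_chi (x i); rewrite cfunE.
have nat1 (V : {group xT}) (psi : 'CF(V)) : psi \in irr V -> nu (psi 1%g) = psi 1%g.
  by move=> /irrWchar/Cnat_char1/natrP[k ->]; rewrite rmorph_nat.
split.
  apply/cfun_inP => x Xx; rewrite cfunE; have [i _] := card_gt0P I_gt0.
  have := nu_tau (f i x); rewrite cfunE tau_comp // rmorphM rmorphXn (nat1 _ _ irr_chi).
  by move/(mulIf (expf_neq0 _ nz_chi1)).
move=> z Zz; have nz_tau1 : tau 1%g != 0 by have /irrP[i ->] := irr_tau; apply: irr1_neq0.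
have nu1 : nu (tau 1%g) = tau 1%g by have := nu_tau 1%g; rewrite cfunE.
apply: (mulIf nz_tau1); rewrite -{1}nu1 -rmorphM -tauZ // mulg1.
by have := nu_tau z; rewrite cfunE.
Qed.

Lemma muK_scalar z : z \in Z -> muK z = w z * muK 1%g.
Proof.
move=> Zz; have U1 := group1 (powerG U0).
have := muKE Zz U1; have := muKE (group1 Z) U1.
by rewrite (prodf_one cmp) !mulg1 w1 mul1r => <-.
Qed.

Lemma stab_muK (nu : {rmorphism algC -> algC}) : cfAut nu muK = muK <->
  cfAut nu mu = mu /\ {in Z, forall z, nu (w z) = w z}.
Proof.
split=> [/cfunP nu_mu | [/cfunP nu_mu nu_w]]; last first.
  apply/cfun_inP => k /UkP[z [x [Zz Xx ->]]].
  rewrite cfunE muKE // rmorphM rmorph_prod nu_w //; congr (_ * _).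
  by apply: eq_bigr => i _; have := nu_mu (x i); rewrite cfunE.
have nat1 : nu (mu 1%g) = mu 1%g.
  by have /irrWchar/Cnat_char1/natrP[k ->] := feit_irr fd; rewrite rmorph_nat.
split.
  apply/cfun_inP => u Uu; rewrite cfunE; have [i _] := card_gt0P I_gt0.
  have muE b : b \in U0 -> muK (f i b) = mu b * mu 1%g ^+ #|I|.-1.
    move=> Ub; rewrite -(prodf1 fM) -[F _]mul1g muKE ?group1 ?dfung1_mem // w1 mul1r.
    rewrite (bigD1 i) //= dfung1E eqxx; congr (_ * _); rewrite -(cardC1 i) -prodr_const.
    by apply: eq_big => // j ne_ji; rewrite dfung1E eq_sym (negbTE ne_ji).
  have := nu_mu (f i u); rewrite cfunE muE // rmorphM rmorphXn nat1.
  by move/(mulIf (expf_neq0 _ nz_mu1)).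
have nz_muK1 : muK 1%g != 0 by have /irrP[i ->] := muK_irr; apply: irr1_neq0.
move=> z Zz; apply: (mulIf nz_muK1).
have nu1 : nu (muK 1%g) = muK 1%g by have := nu_mu 1%g; rewrite cfunE.
rewrite -{1}nu1 -rmorphM -muK_scalar //.
by have := nu_mu z; rewrite cfunE.
Qed.

Lemma stab_tau_muK nu : cfAut nu tau = tau <-> cfAut nu muK = muK.
Proof.
by split=> [/stab_tau[chi_nu w_nu] | /stab_muK[mu_nu w_nu]];
   [apply/stab_muK | apply/stab_tau]; split=> //; apply/(feit_gal fd).
Qed.

(** The conjugating matrices are the tensor powers of S and S', and the common factor is the product
    of the factors m (a h i). *)
Lemma projK_aut nu : cfAut nu tau = tau -> compatible_aut K H Uk T T' projK projU nu.
Proof.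
move=> /stab_tau[/(feit_aut fd)[S [S' [m [[uS uS'] nuD nuD' nuP]]]] nu_w].
exists (tens_perm (fun=> S) 1), (tens_perm (fun=> S') 1), (fun h => \prod_i m (a h i)).
split.
- by split; apply: tens_perm_unit.
- move=> _ /(comp_gen cmp)[z [x [Zz Xx ->]]].
  rewrite T_mul // map_mxZ nu_w // map_tens_perm -scalemxAr -scalemxAl -tens_perm_conj //.
  by congr (_ *: _); apply: eq_tens_perm => i; rewrite nuD ?(memXn i Xx).
- move=> _ /UkP[z [x [Zz Xx ->]]].
  rewrite T'E // map_mxZ nu_w // map_tens_perm -scalemxAr -scalemxAl -tens_perm_conj //.
  by congr (_ *: _); apply: eq_tens_perm => i; rewrite nuD' ?(memXn i Xx).
move=> h Hh; have nuPh i := nuP _ (conj_stab i Hh); split.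
- by apply/prodf_neq0 => i _; have [] := nuPh i.
- rewrite /projK map_tens_perm -tens_perm_conj // -tens_permZ.
  by apply: eq_tens_perm => i; have [] := nuPh i.
rewrite /projU map_tens_perm -tens_perm_conj // -tens_permZ.
by apply: eq_tens_perm => i; have [] := nuPh i.
Qed.

Lemma muK_center : {in Z, forall z, muK z * tau 1%g = tau z * muK 1%g}.
Proof.
by move=> z Zz; rewrite muK_scalar // -{2}[z]mulg1 tauZ // mulrAC.
Qed.

Lemma star_exists : exists star : 'CF(G) -> 'CF(H),
  [/\ functions.set_bij (@IrrOver _ G K tau) (@IrrOver _ H Uk muK) star,
      forall (s : galQab) (psi : 'CF(G)),
        IrrOver tau psi -> star (cfGal s psi) = cfGal s (star psi)
    & forall psi : 'CF(G), IrrOver tau psi ->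
      let xi := star psi in
      [/\ psi 1%g / tau 1%g = xi 1%g / muK 1%g,
          forall z, cfField psi z <-> cfField xi z
        & '['Res[Z] psi, 'Res[Z] xi] != 0]].
Proof.
have sUH : Uk \subset H by rewrite {1}subpower_meet subsetIr.
apply: (@orbit_bijection _ _ _ _ _ sHG sKG sUH _ _ irr_tau muK_irr
  (triple_corr T T' tau muK projK projU)) => //.
- by move=> psi xi [].
- move=> psi xi [_ _ m _ _];
  exact: (triple_match_Res nKG sHG subpower_meet affT muK_affords projK_inner m).
- exact: (triple_corr_fun nKG sHG frattini_subpower subpower_meet affT irr_tau
    muK_affords muK_irr projK_unit projU_unit T_projK projKM projK_inner).
- exact: (triple_corr_onto nKG sHG frattini_subpower subpower_meet affT irr_tau
    muK_affords muK_irr projK_unit projU_unit T_projK projKM projK_inner).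
- exact: (triple_corr_eq nKG sHG frattini_subpower subpower_meet affT irr_tau
    muK_affords muK_irr projK_unit projU_unit).
- move=> nu psi xi nu_tau [irr_psi irr_xi m res1 res2].
  have nu_mu : cfAut nu muK = muK by apply/stab_tau_muK.
  split; rewrite ?cfAut_irr //.
  + exact: (triple_match_aut projK_unit projU_unit (projK_aut nu_tau) m).
  + by rewrite -cfAutRes -nu_tau cfdot_aut_char ?fmorph_eq0 ?irrWchar.
  by rewrite -cfAutRes -nu_mu cfdot_aut_char ?fmorph_eq0 ?irrWchar ?muK_irr.
- exact: stab_tau_muK.
exact: muK_center.
Qed.

End Assembly.

(** * From the Feit condition on S to the pair (U, mu) *)

Lemma universal_cover_nonabelian (xT sT : finGroupType) (X : {group xT}) (S : {group
  sT}) :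
  universal_cover X S -> S :!=: 1%g -> ~~ abelian X.
Proof.
move=> [perfX [pi [im_pi _ _]]]; apply: contra => /derG1P abX.
have X1 : X = 1%g :> {set xT} by rewrite -perfX.
by rewrite -im_pi; apply/eqP/trivgP; rewrite -(morphim1 pi) morphimS // X1.
Qed.

(* Imported last: classical_sets shadows subsetP and other finset names. *)
From mathcomp Require Import boolp classical_sets functions.

Theorem corollary4p4 (gT sT : finGroupType) (G K : {group gT})
    (S : {group sT}) (n : nat) (tau : 'CF(K))
    (nKG : (K <| G)%g)
    (sZKZG : ('Z(K) \subset 'Z(G))%g)
    (minKZ : minnormal (K / 'Z(K))%g (G / 'Z(K))%g)
    (isoKZ : ((K / 'Z(K)) \isog setXn (fun _ : 'I_n => gval S))%g)
    (simpleS : simple S)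
    (nonabS : ~~ abelian S)
    (feitS : inductive_Feit S)
    (irr_tau : tau \in irr K)
    (inv_tau : G \subset 'I[tau]%g) :
  exists (U : {group gT}) (mu : 'CF(U)),
    [/\ U \proper K, mu \in irr U, ('N_K(U))%g = U,
        G = (K * 'N_G(U))%g :> {set gT}
      & exists star : 'CF(G) -> 'CF('N_G(U)%G),
        [/\ set_bij (@IrrOver _ G K tau) (@IrrOver _ 'N_G(U)%G U mu) star,
            forall (s : galQab) (chi : 'CF(G)),
              IrrOver tau chi -> star (cfGal s chi) = cfGal s (star chi)
          & forall chi : 'CF(G), IrrOver tau chi ->
            let xi := star chi in
            [/\ chi 1%g / tau 1%g = xi 1%g / mu 1%g,
                forall z, cfField chi z <-> cfField xi z
              & '['Res['Z(K)%g] chi, 'Res['Z(K)%g] xi] != 0]]].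
Proof.
have [xT [X [univX feitX]]] := feitS.
have [perfX _] := univX.
have [ntS _] := simpleP _ simpleS.
have nabX := universal_cover_nonabelian univX ntS.
have [I [f [I_gt0 cmp]]] := components_exist nKG sZKZG minKZ isoKZ simpleS nonabS univX.
have [chi irr_chi tauE] := tau_power cmp nKG sZKZG I_gt0 irr_tau inv_tau.
have [U0 [mu [pUX [irr_mu [NU IU] eq_stab ge_c]]]] := feitX chi irr_chi.
have [d [d' [D [D' [Pa [Pa' fd]]]]]] := extract_feit irr_chi irr_mu NU IU eq_stab ge_c.
have [T [affT TF]] := tau_tens cmp irr_tau tauE (feit_affords fd).
have [w Tw] := affords_center irr_tau affT.
have [p [a paE]] := conj_data cmp.
have [T' T'E] := sub_tens_exists cmp nKG sZKZG irr_tau fd affT TF Tw.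
exists (subpower cmp nKG sZKZG (proper_sub (feit_proper fd))).
exists (muK cmp nKG sZKZG irr_tau fd affT Tw T'E).
split.
- exact: subpower_proper.
- exact: muK_irr.
- exact: normal_subpower_K.
- exact: frattini_subpower.
exact: (star_exists cmp nKG sZKZG perfX nabX I_gt0 irr_tau inv_tau irr_chi tauE
  fd affT TF Tw paE T'E).
Qed.
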